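(* Let $S$ be a linear operator on $F^2_\alpha$ satisfying the standing assumptions. Suppose that there exist some $p>2$ and $C>0$ such that $\|S_z1\|_p\le C$ for all $z\in\mathbb{C}$. Then $S$ is compact on $F^2_\alpha$ if and only if $\widetilde{S}(z)\to0$ as $z\to\infty$.
   Context: Fix $\alpha>0$. Let $d\lambda_\alpha(z)=\frac{\alpha}{\pi}e^{-\alpha|z|^2}\,dA(z)$, where $dA$ is Euclidean area measure on $\mathbb{C}$ (a probability measure). The Fock space $F^2_\alpha$ is the closed subspace of $L^2(\mathbb{C},d\lambda_\alpha)$ consisting of entire functions, with the inherited inner product $\langle f,g\rangle=\int_{\mathbb{C}}f\overline{g}\,d\lambda_\alpha$; its reproducing kernel is $K_w(z)=K(z,w)=e^{\alpha z\overline{w}}$. For $p>0$ write $\|f\|_p=\left(\int_{\mathbb{C}}|f|^p\,d\lambda_\alpha\right)^{1/p}\in[0,\infty]$. Let $\mathcal{D}$ be the set of all finite linear combinations of kernel functions $K_w$, $w\in\mathbb{C}$; it is dense in $F^2_\alpha$. Standing assumptions: a linear operator $S$ on $F^2_\alpha$ is not necessarily bounded or everywhere defined, but the domain of $S$ contains $\mathcal{D}$, the domain of its adjoint $S^*$ contains $\mathcal{D}$, and the map $z\mapsto SK_z$ is conjugate analytic. Saying that $S$ is bounded (compact) on $F^2_\alpha$ means that $S$ extends to a bounded (compact) linear operator on all of $F^2_\alpha$. For $z\in\mathbb{C}$ let $\varphi_z(w)=z-w$, let $k_z(w)=K(w,z)/\sqrt{K(z,z)}=e^{-\frac{\alpha}{2}|z|^2+\alpha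 w\overline{z}}$ be the normalized reproducing kernel, and let $U_z$ be the operator on $F^2_\alpha$ given by $U_zf=(f\circ\varphi_z)k_z$. Each $U_z$ is a self-adjoint unitary operator and maps $\mathcal{D}$ onto $\mathcal{D}$. Set $S_z=U_zSU_z$; here $1=K_0\in\mathcal{D}$ denotes the constant function. The Berezin transform of $S$ is the function $\widetilde{S}(z)=\langle Sk_z,k_z\rangle$, $z\in\mathbb{C}$. *)

(* Defs.v *)
From HB Require Import structures.
From mathcomp Require Import all_boot all_order all_algebra.
From mathcomp Require Import all_classical all_reals all_analysis.
From mathcomp Require Import measurable_realfun complex.

Set Implicit Arguments.
Unset Strict Implicit.
Unset Printing Implicit Defensive.

Import Order.TTheory GRing.Theory Num.Theory.
Import numFieldNormedType.Exports.

Local Open Scope classical_set_scope.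
Local Open Scope complex_scope.
Local Open Scope ring_scope.

Section Complex.
Variable R : realType.

Definition cmod (z : R[i]) : R := complex.Re `|z|.

Definition cexp (z : R[i]) : R[i] :=
  (expR (complex.Re z))%:C * (cos (complex.Im z) +i* sin (complex.Im z)).

(* The alias [^o] selects the topology of the valued field [R[i]] and makes
   [derivable] mean complex differentiability. *)
Definition entire (f : R[i] -> R[i]) : Prop :=
  forall z : R[i], derivable (f : R[i]^o -> R[i]^o) z 1.

End Complex.

Section GaussianMeasure.
Variables (R : realType) (alpha : {posnum R}).

Definition gauss_density (x : R * R) : R :=
  alpha%:num / pi * expR (- alpha%:num * (x.1 ^+ 2 + x.2 ^+ 2)).

(* The complex plane is identified with [R * R], which carries the product
   Lebesgue measure. *)
Definition gauss_measure (A : set (R * R)) : \bar R :=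
  (\int[(@lebesgue_measure R \x @lebesgue_measure R)%E]_(x in A)
     (gauss_density x)%:E)%E.

Lemma gauss_density_ge0 x : 0 <= gauss_density x.
Proof. by rewrite mulr_ge0 ?expR_ge0 ?divr_ge0 ?pi_ge0. Qed.

Lemma measurable_gauss_density : measurable_fun [set: R * R] gauss_density.
Proof.
apply: measurable_funM => //.
apply: measurableT_comp => //; apply: measurable_funM => //.
by apply: measurable_funD; apply: measurable_funX;
  [exact: measurable_fst | exact: measurable_snd].
Qed.

Let gauss0 : gauss_measure set0 = 0%E.
Proof. by rewrite /gauss_measure integral_set0. Qed.

Let gauss_ge0 A : (0 <= gauss_measure A)%E.
Proof. by apply: integral_ge0 => x _; rewrite lee_fin gauss_density_ge0. Qed.

Let gauss_sigma_additive : semi_sigma_additive gauss_measure.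
Proof.
move=> A mA tA mUA; rewrite /gauss_measure ge0_integral_bigcup//=; first last.
- by move=> x _; rewrite lee_fin gauss_density_ge0.
- apply/measurable_EFinP; apply: measurable_funTS.
  exact: measurable_gauss_density.
apply: is_cvg_ereal_nneg_natsum_cond => n _ _.
by apply: integral_ge0 => x _; rewrite lee_fin gauss_density_ge0.
Qed.

HB.instance Definition _ := isMeasure.Build _ _ _
  gauss_measure gauss0 gauss_ge0 gauss_sigma_additive.

End GaussianMeasure.

Section Fock.
Variables (R : realType) (alpha : {posnum R}).
Local Notation C := R[i].
Local Notation a := (alpha%:num%:C : C).

Definition fnorm (p : R) (f : C -> C) : \bar R :=
  Lnorm (gauss_measure alpha) p%:E (fun x => (cmod (f (x.1 +i* x.2)))%:E).

Definition cintegral (f : C -> C) : C :=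
  Rintegral (gauss_measure alpha) setT
    (fun x => complex.Re (f (x.1 +i* x.2)))
  +i* Rintegral (gauss_measure alpha) setT
    (fun x => complex.Im (f (x.1 +i* x.2))).

Definition inner (f g : C -> C) : C := cintegral (fun z => f z * (g z)^*).

(* Elements are genuine functions: two entire functions that agree almost
   everywhere are equal, so no quotient is needed. *)
Definition fock : set (C -> C) :=
  [set f | entire f /\ (fnorm 2 f < +oo)%E].

Definition rkernel (w z : C) : C := cexp (a * z * w^*).

Definition nkernel (z w : C) : C :=
  cexp (- (a / 2%:R) * ((cmod z) ^+ 2)%:C + a * w * z^*).

Definition kernel_span : set (C -> C) :=
  [set f | exists n (c w : 'I_n -> C),
     f = fun z => \sum_(i < n) c i * rkernel (w i) z].

(* A possibly unbounded linear operator on the Fock space; the values of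
   [oapp] outside [odom] are irrelevant. *)
Record operator := Operator {
  odom : set (C -> C);
  oapp :> (C -> C) -> (C -> C);
  odom_fock : odom `<=` fock;
  odom0 : odom (fun=> 0);
  odom_linear : forall (c : C) f g, odom f -> odom g ->
    odom (fun z => c * f z + g z);
  oapp_fock : forall f, odom f -> fock (oapp f);
  oapp_linear : forall (c : C) f g, odom f -> odom g ->
    oapp (fun z => c * f z + g z) = (fun z => c * oapp f z + oapp g z)
}.

Definition adjoint_dom (S : operator) : set (C -> C) :=
  [set g | fock g /\ exists2 h, fock h &
     forall f, odom S f -> inner (S f) g = inner f h].

(* Conjugate differentiability everywhere, for the norm of the Fock space. *)
Definition conj_analytic (F : C -> (C -> C)) : Prop :=
  forall z : C, exists2 G, fock G &
    fnorm 2 (fun w => (h^*)^-1 * (F (z + h) w - F z w) - G w)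
      @[h --> (0 : C^o)^'] --> 0%E.

Definition admissible (S : operator) : Prop :=
  [/\ kernel_span `<=` odom S,
      kernel_span `<=` adjoint_dom S
    & conj_analytic (fun z => S (rkernel z))].

Definition compact_operator (T : operator) : Prop :=
  forall u : nat -> (C -> C),
    (forall n, odom T (u n)) ->
    (exists M : R, forall n, (fnorm 2 (u n) <= M%:E)%E) ->
    exists2 phi : nat -> nat, {homo phi : m n / (m < n)%N} &
    exists2 g, fock g &
      fnorm 2 (fun z => T (u (phi n)) z - g z) @[n --> \oo] --> 0%E.

Definition extends_to_compact (S : operator) : Prop :=
  exists T : operator, [/\ odom T = fock, compact_operator T
    & forall f, odom S f -> T f = S f].

Definition Uop (z : C) (f : C -> C) : C -> C :=
  fun w => f (z - w) * nkernel z w.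

Definition conj_by_U (S : operator) (z : C) (f : C -> C) : C -> C :=
  Uop z (S (Uop z f)).

Definition berezin (S : operator) (z : C) : C :=
  inner (S (nkernel z)) (nkernel z).

Definition vanishes_at_infinity (F : C -> C) : Prop :=
  forall e : R, 0 < e -> exists M : R, forall z, M < cmod z -> cmod (F z) < e.

End Fock.

(* Main.v *)
(* Let Phi u v = (S K_u)(v). The adjoint of S makes Phi anti-holomorphic in u,
   and S f is the integral of f against Phi on the domain of S. Since S_z 1 is
   Phi z (z - v) up to an exponential factor, the L^p bound with p > 2 and the
   pointwise estimate for entire functions give
     |Phi u v| <= K exp (alpha |u|^2 / 2 + alpha |v|^2 / 2 - c |u - v|^2), c > 0,
   so that Schur's test applies to the normalised kernel.
   If the Berezin transform vanishes at infinity, then the normalised kernel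
   tends to 0 on the diagonal, hence, by polarization and a normal families
   argument, at (z, z + v) for every v as z tends to infinity. By dominated
   convergence the row sums of the kernel tend to 0, and the weighted Schur
   estimate turns pointwise convergence of a bounded sequence (extracted by
   Montel's theorem) into convergence in norm of its image.
   Conversely, along a sequence z_n going to infinity a compact extension maps
   k_(z_n) to a sequence with a convergent subsequence, and
   |g z| exp (- alpha |z|^2 / 2) tends to 0 for every g in the Fock space.
   Cauchy's theorem enters through Gaussian mean values, from which the
   reproducing formula and the Taylor expansion are derived. *)

Require Import Defs.
From HB Require Import structures.
From mathcomp Require Import all_boot all_order all_algebra.
From mathcomp Require Import all_classical all_reals all_analysis.
From mathcomp Require Import measurable_realfun complex.
From mathcomp Require Import ring lra.

Set Implicit Arguments.
Unset Strict Implicit.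
Unset Printing Implicit Defensive.

Import Order.TTheory GRing.Theory Num.Theory.
Import numFieldNormedType.Exports.

Local Open Scope classical_set_scope.
Local Open Scope complex_scope.
Local Open Scope ring_scope.

(** * Modulus and exponential *)

(** The hypothesis [p > 2] decides the sign of one exponent: [S_z 1] grows at most like exp (alpha
    |v|^2 / p), the normalised kernel carries exp (- alpha |u - v|^2 / 2), and [c] is the difference
    alpha / 2 - alpha / p. The obstacle on the way from the Berezin transform to compactness is that
    the transform sees only the diagonal, while Schur's test needs the kernel around it. The bound
    on [S_z 1] depends on u - v alone, so the kernels recentred at points [z_n] obey one common
    bound. They are holomorphic in (x, y) once the first variable is conjugated, and the diagonal
    becomes the set x = conj y, a set of uniqueness for such functions; smallness therefore spreads
    from it. Complex analysis runs on absolutely convergent Gaussian integrals over the plane.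
    Contours occur only as rectangles in logarithmic coordinates, which yield circle means;
    integrating these against a radial Gaussian yields all the rest. Gaussian masses stay symbolic
    positive constants ([gmass], [cmass]), and moduli of complex integrals are bounded up to a
    factor 2, which changes nothing but constants. *)

Section Modulus.
Variable R : realType.
Implicit Types z w : R[i].

Lemma normC_cmod z : `|z| = (cmod z)%:C.
Proof. by rewrite /cmod normc_def. Qed.

Lemma cmod_def z : cmod z = Num.sqrt (complex.Re z ^+ 2 + complex.Im z ^+ 2).
Proof. by rewrite /cmod normc_def. Qed.

Lemma cmod_sqr z : cmod z ^+ 2 = complex.Re z ^+ 2 + complex.Im z ^+ 2.
Proof. by rewrite cmod_def sqr_sqrtr// addr_ge0// sqr_ge0. Qed.

Lemma cmod_ge0 z : 0 <= cmod z.
Proof. by rewrite cmod_def sqrtr_ge0. Qed.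

Lemma cmodM z w : cmod (z * w) = cmod z * cmod w.
Proof. by apply: complexI; rewrite rmorphM -!normC_cmod normrM. Qed.

Lemma cmodD z w : cmod (z + w) <= cmod z + cmod w.
Proof. by rewrite -lecR rmorphD -!normC_cmod ler_normD. Qed.

Lemma cmodN z : cmod (- z) = cmod z.
Proof. by apply: complexI; rewrite -!normC_cmod normrN. Qed.

Lemma cmodB z w : cmod (z - w) <= cmod z + cmod w.
Proof. by rewrite -(cmodN w) cmodD. Qed.

Lemma cmodBC z w : cmod (z - w) = cmod (w - z).
Proof. by rewrite -cmodN opprB. Qed.

Lemma cmod0 : cmod (0 : R[i]) = 0.
Proof. by apply: complexI; rewrite -normC_cmod normr0. Qed.

Lemma cmod1 : cmod (1 : R[i]) = 1.
Proof. by apply: complexI; rewrite -normC_cmod normr1. Qed.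

Lemma cmodX z n : cmod (z ^+ n) = cmod z ^+ n.
Proof. by elim: n => [|n IH]; rewrite ?expr0 ?cmod1// !exprS cmodM IH. Qed.

Lemma cmod_eq0 z : (cmod z == 0) = (z == 0).
Proof.
apply/eqP/eqP => [h|->]; last exact: cmod0.
by apply/eqP; rewrite -normr_eq0 normC_cmod h.
Qed.

Lemma cmod_gt0 z : (0 < cmod z) = (z != 0).
Proof. by rewrite lt_neqAle cmod_ge0 andbT eq_sym cmod_eq0. Qed.

Lemma cmodV z : cmod z^-1 = (cmod z)^-1.
Proof.
have [->|z0] := eqVneq z 0; first by rewrite invr0 cmod0 invr0.
apply: (mulfI (x := cmod z)); first by rewrite cmod_eq0.
by rewrite -cmodM divff// divff ?cmod_eq0// cmod1.
Qed.

Lemma cmodR (x : R) : cmod x%:C = `|x|.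
Proof. by rewrite cmod_def/= expr0n addr0 sqrtr_sqr. Qed.

Lemma cmodJ z : cmod z^* = cmod z.
Proof. by apply: complexI; rewrite -!normC_cmod normcJ. Qed.

Lemma normr_Re_le z : `|complex.Re z| <= cmod z.
Proof. by rewrite cmod_def -sqrtr_sqr ler_sqrt ?lerDl ?addr_ge0 ?sqr_ge0. Qed.

Lemma normr_Im_le z : `|complex.Im z| <= cmod z.
Proof. by rewrite cmod_def -sqrtr_sqr ler_sqrt ?lerDr ?addr_ge0 ?sqr_ge0. Qed.

Lemma cmod_le_ReIm z : cmod z <= `|complex.Re z| + `|complex.Im z|.
Proof.
rewrite -(@ler_pXn2r _ 2) ?nnegrE ?addr_ge0 ?cmod_ge0//.
rewrite cmod_sqr sqrrD !real_normK ?num_real// addrAC.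
by rewrite lerDl mulrn_wge0// mulr_ge0.
Qed.

Lemma cmod_conjM z : z * z^* = ((cmod z) ^+ 2)%:C.
Proof. by rewrite -sqr_normc normC_cmod rmorphXn. Qed.

Lemma ReD z w : complex.Re (z + w) = complex.Re z + complex.Re w.
Proof. by case: z; case: w. Qed.
Lemma ImD z w : complex.Im (z + w) = complex.Im z + complex.Im w.
Proof. by case: z; case: w. Qed.
Lemma ReN z : complex.Re (- z) = - complex.Re z. Proof. by case: z. Qed.
Lemma ImN z : complex.Im (- z) = - complex.Im z. Proof. by case: z. Qed.
Lemma ReM z w : complex.Re (z * w) =
  complex.Re z * complex.Re w - complex.Im z * complex.Im w.
Proof. by case: z; case: w. Qed.
Lemma ImM z w : complex.Im (z * w) =
  complex.Re z * complex.Im w + complex.Im z * complex.Re w.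
Proof. by case: z; case: w. Qed.
Lemma ReJ z : complex.Re z^* = complex.Re z. Proof. by case: z. Qed.
Lemma ImJ z : complex.Im z^* = - complex.Im z. Proof. by case: z. Qed.

Definition reimE := (ReD, ImD, ReN, ImN, ReM, ImM, ReJ, ImJ).

Lemma complexP z w : complex.Re z = complex.Re w ->
  complex.Im z = complex.Im w -> z = w.
Proof. by case: z; case: w => a b c d /= -> ->. Qed.

(** Turns a bound on a modulus into a bound on the real part of a rotated number, where the real
    mean value theorem applies. *)
Lemma cmod_align z : exists2 c : R[i], cmod c = 1 & complex.Re (c * z) = cmod z.
Proof.
have [->|z0] := eqVneq z 0.
  by exists 1; rewrite ?cmod1// mulr0 cmod0.
exists (z^* / (cmod z)%:C).
  rewrite cmodM cmodJ cmodV cmodR ger0_norm ?cmod_ge0// divff//.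
  by rewrite cmod_eq0.
rewrite mulrAC [z^* * z]mulrC cmod_conjM -rmorphV ?unitfE ?cmod_eq0//.
by rewrite -rmorphM/= expr2 mulfK// cmod_eq0.
Qed.

End Modulus.

Lemma is_derive_monomial (R : realType) (c t : R) n :
  is_derive t (1 : R) (fun x : R => c * x ^+ n) (c * n%:R * t ^+ n.-1).
Proof.
rewrite (_ : (fun _ => _) = c \*: (id ^+ n : R -> R)); last first.
  by apply/funext => x; rewrite exprfctE.
by apply: is_derive_eq; rewrite /GRing.scale/=; ring.
Qed.

Section ComplexExp.
Variable R : realType.
Implicit Types z w : R[i].

Lemma Re_cexp z : complex.Re (cexp z) = expR (complex.Re z) * cos (complex.Im z).
Proof. by rewrite /cexp reimE/=; ring. Qed.

Lemma Im_cexp z : complex.Im (cexp z) = expR (complex.Re z) * sin (complex.Im z).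
Proof. by rewrite /cexp reimE/=; ring. Qed.

Lemma cexpD z w : cexp (z + w) = cexp z * cexp w.
Proof.
by apply: complexP; rewrite !(reimE, Re_cexp, Im_cexp) expRD ?cosD ?sinD;
  ring.
Qed.

Lemma cexp0 : cexp (0 : R[i]) = 1.
Proof. by apply: complexP; rewrite !(Re_cexp, Im_cexp)/= expR0 ?cos0 ?sin0; ring. Qed.

Lemma cmod_cexp z : cmod (cexp z) = expR (complex.Re z).
Proof.
apply/eqP; rewrite -(@eqrXn2 _ 2) ?cmod_ge0 ?expR_ge0// cmod_sqr Re_cexp Im_cexp.
by rewrite !exprMn -mulrDr cos2Dsin2 mulr1.
Qed.

Lemma cexpJ z : (cexp z)^* = cexp z^*.
Proof.
by apply: complexP; rewrite !(reimE, Re_cexp, Im_cexp) ?cosN ?sinN; ring.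
Qed.

Lemma cexpR (x : R) : cexp x%:C = (expR x)%:C.
Proof.
by apply: complexP; rewrite !(Re_cexp, Im_cexp)/= ?cos0 ?sin0; ring.
Qed.

Let tail m z := cexp z - \sum_(k < m) (k`!%:R^-1)%:C * z ^+ k.

(** The real part of (x + i y) exp (t (a + i b)). Differentiating in [t] multiplies x + i y by a + i
    b, so the family is closed under differentiation. *)
Let line (a b x y t : R) := expR (t * a) * (x * cos (t * b) - y * sin (t * b)).

Let Re_line (c z : R[i]) t : complex.Re (c * cexp (t%:C * z)) =
  line (complex.Re z) (complex.Im z) (complex.Re c) (complex.Im c) t.
Proof. by rewrite reimE Re_cexp Im_cexp !reimE/= !mul0r subr0 addr0 /line; ring. Qed.


Let is_derive_line (a b x y t : R) : is_derive t (1:R) (line a b x y)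
  (line a b (x * a - y * b) (x * b + y * a) t).
Proof.
rewrite /line; apply: trigger_derive.
by rewrite /GRing.scale/=; ring.
Qed.

Let Re_tail (c z : R[i]) m t : complex.Re (c * tail m (t%:C * z)) =
  line (complex.Re z) (complex.Im z) (complex.Re c) (complex.Im c) t -
  \sum_(k < m) k`!%:R^-1 * complex.Re (c * z ^+ k) * t ^+ k.
Proof.
rewrite /tail mulrBr reimE Re_line; congr (_ + _); rewrite ReN; congr (- _).
rewrite mulr_sumr (big_morph (@complex.Re R) (id1 := 0) (op1 := +%R))//; last first.
  exact: ReD.
apply: eq_bigr => k _; rewrite exprMn -rmorphXn/= mulrCA mulrC -!mulrA.
by rewrite !(reimE, mul0r, subr0, addr0)/=; ring.
Qed.

Let is_derive_psum (a : nat -> R) m (t : R) :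
  is_derive t (1 : R) (fun t => \sum_(k < m.+1) a k * t ^+ k)
    (\sum_(k < m) a k.+1 * k.+1%:R * t ^+ k).
Proof.
elim: m => [|m IH].
  rewrite big_ord0 (_ : (fun t => _) = cst (a 0)); first exact: is_derive_cst.
  by apply/funext => x; rewrite big_ord1 expr0 mulr1.
rewrite (_ : (fun t => _) = (fun t => \sum_(k < m.+1) a k * t ^+ k) +
    (fun t => a m.+1 * t ^+ m.+1)); last first.
  by apply/funext => x; rewrite big_ord_recr.
rewrite big_ord_recr; apply: is_deriveD.
exact: is_derive_monomial.
Qed.

Let is_derive_tail (c z : R[i]) m t :
  is_derive t (1 : R) (fun t => complex.Re (c * tail m.+1 (t%:C * z)))
    (complex.Re (c * z * tail m (t%:C * z))).
Proof.
rewrite Re_tail.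
rewrite (_ : (fun t => _) = (fun t =>
  line (complex.Re z) (complex.Im z) (complex.Re c) (complex.Im c) t -
  \sum_(k < m.+1) k`!%:R^-1 * complex.Re (c * z ^+ k) * t ^+ k)); last first.
  by apply/funext => x; rewrite Re_tail.
apply: is_deriveB.
  apply: (is_derive_eq (is_derive_line _ _ _ _ _)).
  by rewrite !reimE /line; ring.
apply: (is_derive_eq (is_derive_psum (fun k => k`!%:R^-1 * complex.Re (c * z ^+ k)) _ _)).
apply: eq_bigr => k _; rewrite exprS mulrA; congr (_ * _).
rewrite mulrAC; congr (_ * _).
by rewrite factS natrM invfM mulrAC mulVf ?mul1r// pnatr_eq0.
Qed.

(** Induction on [m]: along the ray t z, the derivative of a tail is [z] times the preceding
    tail. *)
Lemma cexp_tail m z :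
  cmod (cexp z - \sum_(k < m) (k`!%:R^-1)%:C * z ^+ k) <=
  cmod z ^+ m / m`!%:R * expR (cmod z).
Proof.
rewrite -/(tail m z); elim: m z => [|m IH] z.
  rewrite /tail big_ord0 subr0 cmod_cexp expr0 fact0 invr1 !mul1r ler_expR.
  exact: le_trans (ler_norm _) (normr_Re_le _).
have [c c1 <-] := cmod_align (tail m.+1 z).
(* The majorant is subtracted so that [g] vanishes at 0 and has a nonpositive derivative on
   [0, 1]. *)
pose g t := complex.Re (c * tail m.+1 (t%:C * z)) -
  t ^+ m.+1 * (cmod z ^+ m.+1 / m.+1`!%:R * expR (cmod z)).
pose dg t := complex.Re (c * z * tail m (t%:C * z)) -
  t ^+ m * (cmod z ^+ m.+1 / m`!%:R * expR (cmod z)).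
have gd t : is_derive t (1 : R) g (dg t).
  apply: is_deriveB; first exact: is_derive_tail.
  under eq_fun do rewrite mulrC.
  apply: (is_derive_eq (is_derive_monomial _ _ _)).
  rewrite /= factS natrM invfM.
  have : (m.+1%:R : R) != 0 by rewrite pnatr_eq0.
  move: (m.+1%:R : R) => q q0; have : (m`!%:R : R) != 0 by rewrite pnatr_eq0 -lt0n fact_gt0.
  move: (m`!%:R : R) => q' q'0.
  move: (cmod z ^+ m.+1) (expR _) (t ^+ m : R) => X Y Z.
  transitivity (X * q'^-1 * Y * Z * (q^-1 * q)); first by ring.
  by rewrite mulVf//; ring.
have [|x /[!in_itv]/= /andP[x0 x1]] := @MVT_segment _ g dg 0 1 ler01 (fun x _ => gd x).
  apply: derivable_within_continuous => x _; exact: (@ex_derive _ _ _ _ _ _ _ (gd x)).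
have g0 : g 0 = 0.
  rewrite /g /tail mul0r cexp0 big_ord_recl/= expr0 invr1 mulr1 big1 ?addr0.
    by rewrite expr0n/= mul0r subr0 subrr mulr0.
  by move=> k _; rewrite expr0n/= mulr0.
rewrite g0 !subr0 mulr1 /g expr1n !mul1r => /eqP; rewrite subr_eq => /eqP ->.
rewrite gerDr /dg subr_le0.
apply: le_trans (le_trans (ler_norm _) (normr_Re_le _)) _.
rewrite !cmodM c1 mul1r; apply: (le_trans (ler_wpM2l (cmod_ge0 _) (IH _))).
rewrite cmodM cmodR ger0_norm// exprMn exprS.
rewrite -!mulrA mulrCA; apply: ler_wpM2l; first exact: exprn_ge0.
apply: ler_wpM2l; first exact: cmod_ge0.
apply: ler_wpM2l; first by rewrite exprn_ge0// cmod_ge0.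
by rewrite ler_wpM2l ?invr_ge0// ler_expR ler_piMl// cmod_ge0.
Qed.

End ComplexExp.

Notation plane R := (measurableTypeR R * measurableTypeR R)%type.

(** * Integration over the plane *)

Section Plane.
Variable R : realType.

Definition cx (x : plane R) : R[i] := x.1 +i* x.2.

Definition rcont (f : R[i] -> R) := forall z e, 0 < e ->
  exists2 d, 0 < d & forall w, cmod (w - z) < d -> `|f w - f z| < e.

Definition ccont (f : R[i] -> R[i]) := forall z e, 0 < e ->
  exists2 d, 0 < d & forall w, cmod (w - z) < d -> cmod (f w - f z) < e.

Let lattice n (x : plane R) : int * int :=
  (Num.floor (n.+1%:R * x.1), Num.floor (n.+1%:R * x.2)).

Let node n (k : int * int) : R[i] := (k.1%:~R / n.+1%:R) +i* (k.2%:~R / n.+1%:R).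

Let node_close n x : cmod (node n (lattice n x) - cx x) <= 2 / n.+1%:R.
Proof.
have n0 : 0 < n.+1%:R :> R by rewrite ltr0n.
have H (t : R) : `|(Num.floor (n.+1%:R * t))%:~R / n.+1%:R - t| <= n.+1%:R^-1.
  rewrite ler_norml; apply/andP; split.
    rewrite lerBrDr -(@ler_pM2l _ n.+1%:R)// mulrDr mulrN mulfV ?gt_eqF//.
    rewrite mulrCA mulfV ?gt_eqF// mulr1 addrC.
    by rewrite lerBlDr (le_trans (ltW (lt_succ_floor _)))// intrD.
  rewrite lerBlDr -(@ler_pM2l _ n.+1%:R)// mulrDr mulfV ?gt_eqF//.
  rewrite mulrCA mulfV ?gt_eqF// mulr1.
  by rewrite (le_trans (ge_floor _)) ?lerDr// num_real.
apply: (le_trans (cmod_le_ReIm _)); rewrite mulrDl !mul1r.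
by rewrite lerD//=; exact: H.
Qed.

Let lattice_measurable n k : measurable (lattice n @^-1` [set k]).
Proof.
have H (j : int) : measurable [set t : R | Num.floor (n.+1%:R * t) = j].
  rewrite (_ : [set _ | _] = setT `&` (fun t : R => n.+1%:R * t) @^-1` `[j%:~R, (j + 1)%:~R[%classic).
    have /= : measurable_fun setT (fun t : R => n.+1%:R * t) by exact: measurable_funM.
    by apply => //.
  rewrite setTI; apply/seteqP; split => t /=; rewrite in_itv/= .
    by move=> <-; rewrite ge_floor ?num_real// floorD1_gt// num_real.
  by move=> h; exact: floor_def.
rewrite (_ : _ @^-1` _ = 
    [set t : measurableTypeR R | Num.floor (n.+1%:R * t) = k.1] `*`
    [set t : measurableTypeR R | Num.floor (n.+1%:R * t) = k.2]).
  by apply: measurableX; exact: H.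
apply/seteqP; split => [[x y]|[x y]] /=.
  by rewrite /lattice/= => <-.
by case: k => a b /= [<- <-].
Qed.

(* Round the first variable down to a grid of mesh [1 / n] and let [n] tend to infinity. *)
Lemma caratheodory_measurable d (T : measurableType d) (f : R[i] -> T -> R) :
  (forall t, rcont (f^~ t)) -> (forall z, measurable_fun setT (f z)) ->
  measurable_fun setT (fun xt : plane R * T => f (cx xt.1) xt.2).
Proof.
move=> fc fm.
pose h n (xt : plane R * T) := f (node n (lattice n xt.1)) xt.2.
apply: (measurable_fun_cvg (h := h)).
  move=> n _ Y mY; rewrite setTI.
  rewrite (_ : _ @^-1` _ = \bigcup_(k in [set: int * int])
     ((lattice n @^-1` [set k]) `*` (f (node n k) @^-1` Y))).
    apply: countable_bigcupT_measurable => [|k]; first exact: countableP.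
    apply: measurableX; first exact: lattice_measurable.
    by have := fm (node n k) measurableT _ mY; rewrite setTI.
  apply/seteqP; split => [[x t]|[x t]] /=.
    by move=> Yx; exists (lattice n x).
  by move=> [k _ [/= <-]].
move=> [x t] _; apply/cvgrPdist_lt => e e0 /=.
have [dd d0 H] := fc t (cx x) e e0.
have : (2 / n.+1%:R : R) @[n --> \oo] --> (0 : R).
  rewrite -(mulr0 2); apply: cvgM; first exact: cvg_cst.
  exact: cvg_harmonic.
move/cvgrPdist_lt => /(_ dd d0) [N _ HN]; exists N => // n /HN.
rewrite /= sub0r normrN => /(le_lt_trans (ler_norm _)) hd.
by rewrite distrC; apply: H; exact: le_lt_trans (node_close _ _) hd.
Qed.

Lemma rcont_measurable (f : R[i] -> R) : rcont f ->
  measurable_fun setT (fun x : plane R => f (cx x)).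
Proof.
move=> fc; have := @caratheodory_measurable _ unit (fun z _ => f z)
  (fun=> fc) (fun z => measurable_cst _).
by move=> H; exact: (measurableT_comp H (pair2_measurable tt)).
Qed.

End Plane.

Section PlaneMeasure.
Variable R : realType.
Local Notation leb := (@lebesgue_measure R).

(** Named so that sigma-finiteness can be attached to it: Fubini is later applied to products in
    which the plane itself is a factor. *)
Definition plane_measure : set (plane R) -> \bar R := (leb \x leb)%E.
HB.instance Definition _ := Measure.on plane_measure.
Lemma plane_measure_sigma_finite : sigma_finite setT plane_measure.
Proof.
have /sigma_finiteP[F [TF ndF Foo]] := sigma_finiteT leb.
exists (fun n => F n `*` F n)%classic.
  rewrite -setXTT TF predeqE => -[x y]; split.
    move=> [/= [n _ Fnx] [k _ Gky]]; exists (maxn n k) => //; split.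
    - by move: x Fnx; exact/subsetPset/ndF/leq_maxl.
    - by move: y Gky; exact/subsetPset/ndF/leq_maxr.
  by move=> [n _ []/= ? ?]; split; exists n.
move=> k; have [mk fk] := Foo k.
split; first exact: measurableX.
by rewrite /plane_measure product_measure1E// lte_mul_pinfty// ge0_fin_numE.
Qed.
HB.instance Definition _ := Measure_isSigmaFinite.Build _ _ _ plane_measure plane_measure_sigma_finite.

End PlaneMeasure.

(** * Translations and rotations preserve planar Lebesgue measure *)

Section Invariance.
Variable R : realType.
Local Notation leb := (@lebesgue_measure R).
Local Notation leb2 := (@plane_measure R).

(** The pushforward gives half-open intervals their length, and this determines Lebesgue measure. *)
Lemma lebesgue_measure_shift (a : R) (A : set (measurableTypeR R)) : measurable A ->
  leb ((fun x => x + a) @^-1` A) = leb A.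
Proof.
move=> mA.
have mf : measurable_fun setT (fun x : measurableTypeR R => x + a) by exact: measurable_funD.
pose nu := pushforward leb (fun x : measurableTypeR R => x + a : measurableTypeR R).
apply/esym; apply: (lebesgue_measure_unique (mu := nu)) => //= _ [[b c]] _ <-.
rewrite /nu /pushforward (_ : _ @^-1` _ = `]b - a, c - a]%classic); last first.
  by apply/seteqP; split => x /=; rewrite !in_itv/= ltrBlDr lerBrDr.
by rewrite !lebesgue_measure_itv/= !lte_fin ltrD2r EFinB; case: ifP => // _;
   rewrite -!EFinB; congr EFin; ring.
Qed.

Lemma product_lebesgueC (A : set (plane R)) : measurable A ->
  leb2 A = (leb \x^ leb)%E A.
Proof.
move=> mA; apply: product_measure_unique => // B C mB mC.
exact: product_measure2E.
Qed.

Definition preserving (phi : plane R -> plane R) :=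
  measurable_fun setT phi /\
  forall A, measurable A -> leb2 (phi @^-1` A) = leb2 A.

Lemma preserving_comp phi psi : preserving phi -> preserving psi ->
  preserving (phi \o psi).
Proof.
move=> [mphi hphi] [mpsi hpsi]; split; first exact: measurableT_comp.
move=> A mA; rewrite comp_preimage hpsi ?hphi//.
by rewrite -[X in measurable X]setTI; exact: mphi.
Qed.

(** Each vertical section is merely translated, by an amount that depends only on the section. *)
Lemma preserving_sheary (g : measurableTypeR R -> measurableTypeR R) : measurable_fun setT g ->
  preserving (fun x => (x.1, x.2 + g x.1)).
Proof.
move=> mg; have mphi : measurable_fun setT (fun x : plane R => (x.1, x.2 + g x.1)).
  apply/measurable_fun_pairP; split => /=; first exact: measurable_fst.
  by apply: measurable_funD; [exact: measurable_snd|
     apply: measurableT_comp => //; exact: measurable_fst].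
split => // A mA; rewrite /plane_measure /product_measure1; apply: eq_integral => x _ /=.
rewrite -[RHS](lebesgue_measure_shift (g x)); last exact: measurable_xsection.
by congr (leb _); apply/seteqP; split => y; rewrite /xsection/= !inE.
Qed.

Lemma preserving_shearx (g : measurableTypeR R -> measurableTypeR R) : measurable_fun setT g ->
  preserving (fun x => (x.1 + g x.2, x.2)).
Proof.
move=> mg; have mphi : measurable_fun setT (fun x : plane R => (x.1 + g x.2, x.2)).
  apply/measurable_fun_pairP; split => /=; last exact: measurable_snd.
  by apply: measurable_funD; [exact: measurable_fst|
     apply: measurableT_comp => //; exact: measurable_snd].
split => // A mA; rewrite !product_lebesgueC//; last first.
  by rewrite -[X in measurable X]setTI; exact: mphi.
rewrite /product_measure2; apply: eq_integral => x _ /=.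
rewrite -[RHS](lebesgue_measure_shift (g x)); last exact: measurable_ysection.
by congr (leb _); apply/seteqP; split => y; rewrite /ysection/= !inE.
Qed.

Lemma preserving_translate (a b : R) :
  preserving (fun x => (x.1 + a, x.2 + b)).
Proof.
exact: (preserving_comp (preserving_sheary (g := cst b) _)
  (preserving_shearx (g := cst a) _)).
Qed.

(* A rotation other than the half-turn is a product of three shears. *)
Lemma preserving_rotate (c s : R) : c ^+ 2 + s ^+ 2 = 1 ->
  preserving (fun x => (c * x.1 - s * x.2, s * x.1 + c * x.2)).
Proof.
have main (c' s' : R) : c' ^+ 2 + s' ^+ 2 = 1 -> c' != -1 ->
    preserving (fun x => (c' * x.1 - s' * x.2, s' * x.1 + c' * x.2)).
  move=> cs c1; have c0 : 1 + c' != 0 by rewrite addrC addr_eq0.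
  (* The tangent of the half angle, which is the coefficient of the two outer shears. *)
  pose t := s' / (1 + c').
  have m k : measurable_fun setT (fun x : measurableTypeR R => k * x) by exact: measurable_funM.
  have := preserving_comp (preserving_shearx (m (- t)))
    (preserving_comp (preserving_sheary (m s')) (preserving_shearx (m (- t)))).
  rewrite (_ : _ \o _ = (fun x => (c' * x.1 - s' * x.2, s' * x.1 + c' * x.2)))//.
  apply/funext => -[x y] /=.
  have st : s' * t = 1 - c'.
    apply: (mulIf c0); rewrite /t mulrA mulfVK//.
    by rewrite -expr2; transitivity (1 - c' ^+ 2); [rewrite -cs; ring|ring].
  have s't : t * (1 + c') = s' by rewrite /t mulfVK.
  congr (_, _); rewrite -[in RHS]s't; last first.
    transitivity (s' * x + y - (s' * t) * y); first by ring.
    by rewrite st s't; ring.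
  transitivity (x - t * y - (s' * t) * x - t * y + t * (s' * t) * y); first by ring.
  by rewrite st; ring.
move=> cs; have [c1|] := eqVneq c (-1); last exact: main.
have s0 : s = 0.
  by apply/eqP; rewrite -sqrf_eq0; apply/eqP; move: cs; rewrite c1 sqrrN expr1n; lra.
(* The half-turn is the quarter-turn composed with itself. *)
have h : preserving (fun x => (0 * x.1 - 1 * x.2, 1 * x.1 + 0 * x.2)).
  by apply: main; [rewrite expr0n expr1n add0r|rewrite eq_sym oppr_eq0 oner_eq0].
have := preserving_comp h h.
rewrite (_ : _ \o _ = (fun x => (c * x.1 - s * x.2, s * x.1 + c * x.2)))//.
by apply/funext => -[x y] /=; rewrite c1 s0; congr (_, _); ring.
Qed.

Lemma preserving_integral phi (f : plane R -> \bar R) : preserving phi ->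
  measurable_fun setT f ->
  (\int[leb2]_x f (phi x) = \int[leb2]_x f x)%E.
Proof.
move=> [mphi hphi] mf.
have main (g : plane R -> \bar R) : measurable_fun setT g -> (forall x, 0 <= g x)%E ->
    (\int[leb2]_x g (phi x) = \int[leb2]_x g x)%E.
  move=> mg g0; have := @ge0_integral_pushforward _ _ _ _ R phi mphi leb2 setT g
    measurableT mg (fun x _ => g0 x).
  rewrite preimage_setT => <-; apply: eq_measure_integral => A mA _.
  exact: hphi.
rewrite integralE [RHS]integralE; congr (_ - _)%E.
  rewrite -[RHS]main; [|exact: measurable_funepos|by move=> x; exact: funepos_ge0].
  by apply: eq_integral => x _; rewrite !unlock.
rewrite -[RHS]main; [|exact: measurable_funeneg|by move=> x; exact: funeneg_ge0].
by apply: eq_integral => x _; rewrite !unlock.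
Qed.

End Invariance.

Section PlaneIntegral.
Variable R : realType.
Local Notation leb := (@lebesgue_measure R).
Local Notation leb2 := (@plane_measure R).
Implicit Types (f g : R[i] -> R).

(** Integrands are functions of a complex variable; only the domain of integration is read as
    [plane R], through [cx]. *)
Definition rmeas f := measurable_fun setT (fun x : plane R => f (cx x)).
Definition gint f := leb2.-integrable setT (fun x : plane R => (f (cx x))%:E).
Definition rI f := Rintegral leb2 setT (fun x : plane R => f (cx x)).

Lemma gint_rmeas f : gint f -> rmeas f.
Proof. by move=> /measurable_int /measurable_EFinP. Qed.

Lemma rI_EFin f : gint f -> ((rI f)%:E = \int[leb2]_x (f (cx x))%:E)%E.
Proof. by move=> fi; rewrite /rI /Rintegral fineK// integrable_fin_num. Qed.

Lemma gint_le f g : rmeas f -> gint g -> (forall z, `|f z| <= g z) -> gint f.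
Proof.
move=> mf ig fg; apply: le_integrable ig => //; first exact/measurable_EFinP.
by move=> x _ /=; rewrite lee_fin (le_trans (fg _))// ler_norm.
Qed.

Lemma gint_abs f : gint f -> gint (fun z => `|f z|).
Proof.
move=> fi; exact: (integrable_abse fi).
Qed.

Lemma gintD f g : gint f -> gint g -> gint (fun z => f z + g z).
Proof. by move=> fi gi; exact: (integrableD measurableT fi gi). Qed.

Lemma gintZ k f : gint f -> gint (fun z => k * f z).
Proof. by move=> fi; exact: (integrableZl measurableT k fi). Qed.

Lemma rID f g : gint f -> gint g -> rI (fun z => f z + g z) = rI f + rI g.
Proof. by move=> fi gi; rewrite /rI RintegralD. Qed.

Lemma rIZ k f : gint f -> rI (fun z => k * f z) = k * rI f.
Proof. by move=> fi; rewrite /rI RintegralZl. Qed.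

Lemma rI_le f g : gint f -> gint g -> (forall z, f z <= g z) -> rI f <= rI g.
Proof. by move=> fi gi fg; apply: le_Rintegral. Qed.

Lemma rI_ge0 f : (forall z, 0 <= f z) -> 0 <= rI f.
Proof. by move=> f0; apply: Rintegral_ge0. Qed.

Lemma rI_abs f : gint f -> `|rI f| <= rI (fun z => `|f z|).
Proof. by move=> fi; exact: le_normr_Rintegral. Qed.

Lemma gint_lty f : rmeas f -> (forall z, 0 <= f z) ->
  (\int[leb2]_x (f (cx x))%:E < +oo)%E -> gint f.
Proof.
move=> mf f0 fi; apply/integrableP; split; first exact/measurable_EFinP.
by under eq_integral do rewrite /= ger0_norm//.
Qed.

Lemma rI_dominated (f_ : nat -> R[i] -> R) f g : (forall n, rmeas (f_ n)) ->
  (forall z, f_ n z @[n --> \oo] --> f z) -> gint g ->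
  (forall n z, `|f_ n z| <= g z) ->
  rmeas f /\ rI (f_ n) @[n --> \oo] --> rI f.
Proof.
move=> mf_ f_f gi f_g.
have mf : rmeas f by apply: (measurable_fun_cvg mf_) => x _; exact: f_f.
split => //.
have [] := @dominated_convergence _ _ R leb2 setT measurableT
  (fun n x => (f_ n (cx x))%:E) (fun x => (f (cx x))%:E) (fun x => (g (cx x))%:E).
- by move=> n; apply/measurable_EFinP; exact: mf_.
- by apply/measurable_EFinP.
- by apply: aeW => x _; apply: cvg_EFin; [exact: nearW|exact: f_f].
- exact: gi.
- by apply: aeW => x n _; rewrite lee_fin.
by move=> fi _; rewrite -(rI_EFin fi) => /fine_cvg.
Qed.

Lemma gint_translate w f : gint f -> gint (fun z => f (z + w)).
Proof.
move=> fi; have mf := gint_rmeas fi.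
have h := preserving_translate (complex.Re w) (complex.Im w).
have E x : cx x + w = cx (x.1 + complex.Re w, x.2 + complex.Im w).
  by case: w h => a b.
have mf' : rmeas (fun z => f (z + w)).
  rewrite /rmeas; under eq_fun do rewrite E.
  by apply: (measurableT_comp mf); exact: h.1.
apply/integrableP; split; first exact/measurable_EFinP.
move/integrableP : fi => [mef]; rewrite -(preserving_integral h); last exact: measurableT_comp.
by under [X in _ -> (X < _)%E]eq_integral do rewrite E.
Qed.

Lemma rI_translate w f : rmeas f -> rI (fun z => f (z + w)) = rI f.
Proof.
move=> mf; have h := preserving_translate (complex.Re w) (complex.Im w).
have E x : cx x + w = cx (x.1 + complex.Re w, x.2 + complex.Im w).
  by case: w h => a b.
rewrite /rI /Rintegral -[in RHS](preserving_integral h); last exact/measurable_EFinP.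
by congr fine; apply: eq_integral => x _; rewrite E.
Qed.

Lemma rI_rotate w f : cmod w = 1 -> rmeas f -> rI (fun z => f (w * z)) = rI f.
Proof.
move=> w1 mf.
have h : preserving (fun x => (complex.Re w * x.1 - complex.Im w * x.2,
    complex.Im w * x.1 + complex.Re w * x.2)).
  by apply: preserving_rotate; rewrite -cmod_sqr w1 expr1n.
rewrite /rI /Rintegral -[in RHS](preserving_integral h); last exact/measurable_EFinP.
congr fine; apply: eq_integral => x _; congr (EFin (f _)).
by case: w w1 h => a b _ _; rewrite /cx/=; apply: complexP; rewrite /=; ring.
Qed.

(** Read off the normalisation of the centred normal law with variance 1 / (2 g); of the value only
    finiteness and positivity are kept. *)
Lemma gauss_line (g : R) : 0 < g -> exists2 c : R, 0 < c &
  (\int[leb]_y (expR (- g * y ^+ 2))%:E = c%:E)%E.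
Proof.
move=> g0; pose s := Num.sqrt (2 * g)^-1.
have s2 : s ^+ 2 = (2 * g)^-1 by rewrite sqr_sqrtr// invr_ge0 mulr_ge0// ltW.
have s0 : s != 0 by rewrite gt_eqF// sqrtr_gt0 invr_gt0 mulr_gt0.
have := @integral_normal_pdf R 0 s.
under eq_integral => x _.
  rewrite normal_pdfE// /normal_fun subr0 s2.
  rewrite (_ : - x ^+ 2 / _ = - g * x ^+ 2); last first.
    by rewrite -mulr_natr; field; rewrite gt_eqF.
  rewrite EFinM; over.
have p0 := normal_peak_gt0 s0.
have mg : measurable_fun setT (fun x : measurableTypeR R => (expR (- g * x ^+ 2))%:E).
  apply/measurable_EFinP; apply: measurableT_comp => //.
  by apply: measurable_funM => //; exact: measurable_funX.
rewrite ge0_integralZl//=; last by rewrite lee_fin ltW.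
case: (\int[_]_ _ _)%E => [c| |]; last 2 first.
- by rewrite gt0_muley// lte_fin.
- by rewrite gt0_muleNy// lte_fin.
rewrite -EFinM => -[pc]; exists c => //.
by rewrite -(pmulr_rgt0 _ p0) pc.
Qed.

Definition gauss (b : R) (z : R[i]) : R := expR (- b * cmod z ^+ 2).

Lemma gauss_ge0 b z : 0 <= gauss b z. Proof. exact: expR_ge0. Qed.
Lemma gauss_gt0 b z : 0 < gauss b z. Proof. exact: expR_gt0. Qed.

Lemma rmeas_cst k : rmeas (fun=> k). Proof. exact: measurable_cst. Qed.

Lemma rmeasM f g : rmeas f -> rmeas g -> rmeas (fun z => f z * g z).
Proof. by move=> mf mg; exact: measurable_funM. Qed.

Lemma rmeasD f g : rmeas f -> rmeas g -> rmeas (fun z => f z + g z).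
Proof. by move=> mf mg; exact: measurable_funD. Qed.

Lemma rmeasX n f : rmeas f -> rmeas (fun z => f z ^+ n).
Proof. by move=> mf; exact: measurable_funX. Qed.

Lemma rmeasN f : rmeas f -> rmeas (fun z => - f z).
Proof. by move=> mf; exact: measurableT_comp. Qed.

Lemma rmeas_abs f : rmeas f -> rmeas (fun z => `|f z|).
Proof. by move=> mf; exact: measurableT_comp. Qed.

Lemma rmeas_expR f : rmeas f -> rmeas (fun z => expR (f z)).
Proof. by move=> mf; exact: measurableT_comp. Qed.

Lemma rmeas_Re : rmeas (@complex.Re R).
Proof. exact: measurable_fst. Qed.

Lemma rmeas_Im : rmeas (@complex.Im R).
Proof. exact: measurable_snd. Qed.

Lemma rmeas_cmod2 : rmeas (fun z => cmod z ^+ 2).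
Proof.
rewrite (_ : (fun _ => _) = fun z : R[i] => complex.Re z ^+ 2 + complex.Im z ^+ 2).
  by apply: rmeasD; apply: rmeasX; [exact: rmeas_Re|exact: rmeas_Im].
by apply/funext => z; rewrite cmod_sqr.
Qed.

Lemma rmeas_gauss b : rmeas (gauss b).
Proof.
by apply: rmeas_expR; apply: rmeasM; [exact: rmeas_cst|exact: rmeas_cmod2].
Qed.

Lemma gauss_integral b : 0 < b -> gint (gauss b) /\ 0 < rI (gauss b).
Proof.
move=> g0; have [c c0 cE] := gauss_line g0.
have E : (\int[leb2]_x (gauss b (cx x))%:E = (c * c)%:E)%E.
  transitivity (\int[(leb \x leb)%E]_x (gauss b (cx x))%:E)%E; first by [].
  rewrite fubini_tonelli1//=; last 2 first.
  - by apply/measurable_EFinP; exact: rmeas_gauss.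
  - by move=> x; rewrite lee_fin gauss_ge0.
  rewrite /fubini_F/=.
  have mb : measurable_fun setT (fun x : measurableTypeR R => (expR (- b * x ^+ 2))%:E).
    apply/measurable_EFinP; apply: measurableT_comp => //.
    by apply: measurable_funM => //; exact: measurable_funX.
  under eq_integral => x _.
    under eq_integral => y _.
      rewrite /gauss cmod_sqr/= mulrDr expRD EFinM; over.
    rewrite ge0_integralZl//=.
    rewrite [X in (_ * X)%E]cE; over.
  rewrite ge0_integralZr//=; last by rewrite lee_fin ltW.
  by rewrite [X in (X * _)%E]cE.
have gi : gint (gauss b).
  apply: gint_lty; [exact: rmeas_gauss|by move=> z; exact: gauss_ge0|].
  by rewrite E ltry.
by split => //; rewrite -lte_fin rI_EFin// E lte_fin mulr_gt0.
Qed.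

End PlaneIntegral.

Section ComplexIntegral.
Variable R : realType.
Implicit Types (f g : R[i] -> R[i]) (m : R[i] -> R).

Definition cmeas f := rmeas (fun z => complex.Re (f z)) /\
  rmeas (fun z => complex.Im (f z)).
Definition cint f := cmeas f /\ gint (fun z => cmod (f z)).
Definition cI f : R[i] :=
  rI (fun z => complex.Re (f z)) +i* rI (fun z => complex.Im (f z)).

Lemma eq_rmeas (h k : R[i] -> R) : h =1 k -> rmeas k -> rmeas h.
Proof. by move=> /funext ->. Qed.

Lemma rmeas_sqrt (h : R[i] -> R) : rmeas h -> rmeas (fun z => Num.sqrt (h z)).
Proof.
move=> mh; apply: (measurableT_comp (f := @Num.sqrt R)) => //.
by apply: continuous_measurable_fun; exact: sqrt_continuous.
Qed.

Lemma cmeas_cmod f : cmeas f -> rmeas (fun z => cmod (f z)).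
Proof.
move=> [mr mi]; apply: (eq_rmeas (fun z => cmod_def (f z))).
by apply: rmeas_sqrt; apply: rmeasD; exact: rmeasX.
Qed.

Lemma cmeas_id : cmeas id.
Proof. by split; [exact: rmeas_Re|exact: rmeas_Im]. Qed.

Lemma cmeas_cst c : cmeas (fun=> c).
Proof. by split; exact: rmeas_cst. Qed.

Lemma cmeasD f g : cmeas f -> cmeas g -> cmeas (fun z => f z + g z).
Proof.
move=> [fr fi] [gr gi]; split.
  by apply: (eq_rmeas (fun z => ReD _ _)); exact: rmeasD.
by apply: (eq_rmeas (fun z => ImD _ _)); exact: rmeasD.
Qed.

Lemma cmeasM f g : cmeas f -> cmeas g -> cmeas (fun z => f z * g z).
Proof.
move=> [fr fi] [gr gi]; split.
  apply: (eq_rmeas (fun z => ReM _ _)).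
  by apply: rmeasD; [exact: rmeasM|apply: rmeasN; exact: rmeasM].
by apply: (eq_rmeas (fun z => ImM _ _)); apply: rmeasD; exact: rmeasM.
Qed.

Lemma cmeasN f : cmeas f -> cmeas (fun z => - f z).
Proof.
move=> [fr fi]; split.
  by apply: (eq_rmeas (fun z => ReN _)); exact: rmeasN.
by apply: (eq_rmeas (fun z => ImN _)); exact: rmeasN.
Qed.

Lemma cmeasB f g : cmeas f -> cmeas g -> cmeas (fun z => f z - g z).
Proof. by move=> mf mg; apply: cmeasD => //; exact: cmeasN. Qed.

Lemma cmeasJ f : cmeas f -> cmeas (fun z => (f z)^*).
Proof.
move=> [fr fi]; split; first exact: (eq_rmeas (fun z => ReJ _)).
by apply: (eq_rmeas (fun z => ImJ _)); exact: rmeasN.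
Qed.

Lemma rmeas_sin m : rmeas m -> rmeas (fun z => sin (m z)).
Proof.
move=> mm; apply: (measurableT_comp (f := @sin R)) => //.
by apply: continuous_measurable_fun; exact: continuous_sin.
Qed.

Lemma rmeas_cos m : rmeas m -> rmeas (fun z => cos (m z)).
Proof.
move=> mm; apply: (measurableT_comp (f := @cos R)) => //.
by apply: continuous_measurable_fun; exact: continuous_cos.
Qed.

Lemma cmeas_cexp f : cmeas f -> cmeas (fun z => cexp (f z)).
Proof.
move=> [fr fi]; split.
  apply: (eq_rmeas (fun z => Re_cexp _)).
  by apply: rmeasM; [exact: rmeas_expR|exact: rmeas_cos].
apply: (eq_rmeas (fun z => Im_cexp _)).
by apply: rmeasM; [exact: rmeas_expR|exact: rmeas_sin].
Qed.

Lemma cmeas_real m : rmeas m -> cmeas (fun z => (m z)%:C).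
Proof. by move=> mm; split => //=; exact: rmeas_cst. Qed.

Lemma cint_Re f : cint f -> gint (fun z => complex.Re (f z)).
Proof.
by move=> [[fr fi] fint]; apply: gint_le fint _ => // z; exact: normr_Re_le.
Qed.

Lemma cint_Im f : cint f -> gint (fun z => complex.Im (f z)).
Proof.
by move=> [[fr fi] fint]; apply: gint_le fint _ => // z; exact: normr_Im_le.
Qed.

Lemma cint_le f m : cmeas f -> gint m -> (forall z, cmod (f z) <= m z) -> cint f.
Proof.
move=> mf im fm; split => //; apply: gint_le im _; first exact: cmeas_cmod.
by move=> z; rewrite ger0_norm ?cmod_ge0.
Qed.

Lemma cintD f g : cint f -> cint g -> cint (fun z => f z + g z).
Proof.
move=> [mf fi] [mg gi]; apply: (cint_le _ (gintD fi gi)); first exact: cmeasD.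
by move=> z; exact: cmodD.
Qed.

Lemma cintZ c f : cint f -> cint (fun z => c * f z).
Proof.
move=> [mf fi]; apply: (cint_le _ (gintZ (cmod c) fi)); last by move=> z; rewrite cmodM.
by apply: cmeasM => //; exact: cmeas_cst.
Qed.

Lemma cID f g : cint f -> cint g -> cI (fun z => f z + g z) = cI f + cI g.
Proof.
move=> fi gi; rewrite /cI; under eq_fun do rewrite ReD.
under [X in _ +i* rI X]eq_fun do rewrite ImD.
by rewrite !rID//; [exact: cint_Im|exact: cint_Im|exact: cint_Re|exact: cint_Re].
Qed.

Lemma cIZ c f : cint f -> cI (fun z => c * f z) = c * cI f.
Proof.
move=> fi; have fr := cint_Re fi; have fm := cint_Im fi.
rewrite /cI; under eq_fun do rewrite ReM -mulNr.
under [X in _ +i* rI X]eq_fun do rewrite ImM.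
by rewrite !rID ?rIZ//; [apply: complexP; rewrite !reimE/=; ring|
  exact: gintZ..].
Qed.

(** The factor 2 comes from bounding the real and imaginary parts separately. *)
Lemma cI_cmod f : cint f -> cmod (cI f) <= 2 * rI (fun z => cmod (f z)).
Proof.
move=> fi; apply: (le_trans (cmod_le_ReIm _)); rewrite mulr2n mulrDl mul1r /=.
apply: lerD.
  apply: (le_trans (rI_abs (cint_Re fi))); apply: rI_le => [||z].
  - exact/gint_abs/cint_Re.
  - exact: fi.2.
  - exact: normr_Re_le.
apply: (le_trans (rI_abs (cint_Im fi))); apply: rI_le => [||z].
- exact/gint_abs/cint_Im.
- exact: fi.2.
- exact: normr_Im_le.
Qed.

Lemma cI_le f m : cint f -> gint m -> (forall z, cmod (f z) <= m z) ->
  cmod (cI f) <= 2 * rI m.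
Proof.
move=> fi im fm; apply: (le_trans (cI_cmod fi)); rewrite ler_wpM2l//.
by apply: rI_le => //; exact: fi.2.
Qed.

Lemma cI_translate w f : cmeas f -> cI (fun z => f (z + w)) = cI f.
Proof.
move=> [fr fi]; rewrite /cI (rI_translate w (f := fun z => complex.Re (f z)))//.
by rewrite (rI_translate w (f := fun z => complex.Im (f z))).
Qed.

Lemma cint_translate w f : cint f -> cint (fun z => f (z + w)).
Proof.
move=> fi; split; last exact: (gint_translate w fi.2).
by split; apply: gint_rmeas; [exact: (gint_translate w (cint_Re fi))|
  exact: (gint_translate w (cint_Im fi))].
Qed.

End ComplexIntegral.

(** * Complex differentiability by first-order expansions *)

Section Entire.
Variable R : realType.
Implicit Types (f g : R[i] -> R[i]).

(** An expansion instead of a difference quotient: no case [h = 0] arises in the product and chain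
    rules. *)
Definition cderiv f z l := forall e : R, 0 < e -> exists2 d, 0 < d &
  forall h, cmod h < d -> cmod (f (z + h) - f z - l * h) <= e * cmod h.

Lemma nbhs0_cmod (P : R[i] -> Prop) :
  (\forall h \near (0 : R[i]^o), P h) <-> exists2 d, 0 < d & forall h, cmod h < d -> P h.
Proof.
split.
  move=> /nbhs_ballP[[d d'] /=]; rewrite ltcE/= => /andP[/eqP d'0 d0] H.
  exists d => // h hd; apply: H; rewrite /ball/= sub0r normrN normC_cmod d'0.
  by rewrite ltcR.
move=> [d d0 H]; apply/nbhs_ballP; exists d%:C => /=; first by rewrite ltcR.
by move=> h; rewrite /ball/= sub0r normrN normC_cmod ltcR; exact: H.
Qed.

Lemma entireP f : entire f <-> forall z, exists l, cderiv f z l.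
Proof.
split=> fe z.
  have /cvg_ex[/= l /cvgrPdist_le H] := fe z; exists l => e e0.
  have := H e%:C; rewrite ltcR => /(_ e0); rewrite near_withinE.
  move=> /nbhs0_cmod [d d0 Hd]; exists d => // h hd.
  have [->|h0] := eqVneq h 0; first by rewrite addr0 mulr0 !subrr cmod0 mulr0.
  have := Hd h hd h0; rewrite normC_cmod lecR.
  rewrite /GRing.scale/= mulr1 [h + z]addrC => K.
  rewrite (_ : _ - _ = - ((l - h^-1 * (f (z + h) - f z)) * h)); last first.
    by rewrite mulrBl mulrAC mulVf//; ring.
  by rewrite cmodN cmodM ler_wpM2r ?cmod_ge0.
have [l H] := fe z; apply/cvg_ex; exists l; apply/cvgrPdist_le => /= -[e e'].
rewrite ltcE/= => /andP[/eqP -> e0]; rewrite near_withinE.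
apply/nbhs0_cmod; have [d d0 Hd] := H e e0; exists d => // h hd h0.
have := Hd h hd; rewrite normC_cmod lecR /GRing.scale/= mulr1 [h + z]addrC.
rewrite (_ : _ - _ - _ = - ((l - h^-1 * (f (z + h) - f z)) * h)); last first.
  by rewrite mulrBl mulrAC mulVf//; ring.
by rewrite cmodN cmodM ler_pM2r// cmod_gt0.
Qed.

Lemma cderiv_cont f z l : cderiv f z l -> forall e : R, 0 < e ->
  exists2 d, 0 < d & forall w, cmod (w - z) < d -> cmod (f w - f z) < e.
Proof.
move=> H e e0; have [d d0 Hd] := H 1 ltr01.
have K : 0 < 1 + cmod l by rewrite ltr_pwDl// cmod_ge0.
exists (Num.min d (e / (1 + cmod l))); first by rewrite lt_min d0 divr_gt0.
move=> w; rewrite lt_min => /andP[wd we].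
have := Hd _ wd; rewrite [z + _]addrC subrK mul1r => Hw.
rewrite (_ : f w - f z = f w - f z - l * (w - z) + l * (w - z)); last by ring.
apply: (le_lt_trans (cmodD _ _)); rewrite cmodM.
apply: (le_lt_trans (lerD Hw (lexx _))).
by rewrite -[X in X + _]mul1r -mulrDl mulrC -ltr_pdivlMr.
Qed.

Lemma entire_ccont f : entire f -> ccont f.
Proof. by move=> /entireP fe z; have [l] := fe z; exact: cderiv_cont. Qed.

Lemma ccont_cmeas f : ccont f -> cmeas f.
Proof.
move=> fc; split; apply: rcont_measurable => z e e0.
  have [d d0 H] := fc z e e0; exists d => // w /H; apply: le_lt_trans.
  by rewrite -ReN -ReD normr_Re_le.
have [d d0 H] := fc z e e0; exists d => // w /H; apply: le_lt_trans.
by rewrite -ImN -ImD normr_Im_le.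
Qed.

Lemma entire_cmeas f : entire f -> cmeas f.
Proof. by move=> /entire_ccont/ccont_cmeas. Qed.

Lemma cderiv_cst c z : cderiv (fun=> c) z 0.
Proof.
by move=> e e0; exists 1 => // h _; rewrite subrr mul0r subr0 cmod0 mulr_ge0 ?cmod_ge0// ltW.
Qed.

Lemma cderiv_affine a b z : cderiv (fun z => a * z + b) z a.
Proof.
move=> e e0; exists 1 => // h _.
rewrite (_ : _ - _ = 0); last by ring.
by rewrite cmod0 mulr_ge0 ?cmod_ge0 ?ltW.
Qed.

Lemma cderivD f g z l k : cderiv f z l -> cderiv g z k ->
  cderiv (fun z => f z + g z) z (l + k).
Proof.
move=> hf hg e e0; have e2 : 0 < e / 2 by rewrite divr_gt0.
have [d d0 Hd] := hf _ e2; have [d' d'0 Hd'] := hg _ e2.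
exists (Num.min d d'); first by rewrite lt_min d0.
move=> h; rewrite lt_min => /andP[/Hd h1 /Hd' h2].
rewrite (_ : _ - _ = (f (z + h) - f z - l * h) + (g (z + h) - g z - k * h)); last by ring.
by rewrite [e]splitr mulrDl (le_trans (cmodD _ _))// lerD.
Qed.

Lemma cderiv_comp f g z l k : cderiv g z k -> cderiv f (g z) l ->
  cderiv (fun z => f (g z)) z (l * k).
Proof.
move=> hg hf e e0.
have K : 0 < 1 + cmod k by rewrite ltr_pwDl// cmod_ge0.
have L : 0 < 1 + cmod l by rewrite ltr_pwDl// cmod_ge0.
have e2 : 0 < e / 2 by rewrite divr_gt0.
have [d d0 Hd] := hf _ (divr_gt0 e2 K).
have [d1 d10 Hd1] := hg 1 ltr01.
have [d2 d20 Hd2] := hg _ (divr_gt0 e2 L).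
exists (Num.min (Num.min d1 d2) (d / (1 + cmod k))).
  by rewrite !lt_min d10 d20 divr_gt0.
move=> h; rewrite !lt_min => /andP[/andP[/Hd1 h1 /Hd2 h2] h3].
pose q := g (z + h) - g z.
have qh : cmod q <= (1 + cmod k) * cmod h.
  rewrite (_ : q = q - k * h + k * h); last by ring.
  by rewrite (le_trans (cmodD _ _))// mulrDl lerD// cmodM.
have /Hd : cmod q < d.
  by apply: (le_lt_trans qh); rewrite mulrC -ltr_pdivlMr.
rewrite /q [g z + _]addrC subrK -/q => h4.
rewrite (_ : _ - _ = (f (g (z + h)) - f (g z) - l * q) + l * (q - k * h)); last first.
  by rewrite /q; ring.
rewrite (le_trans (cmodD _ _))// [X in _ <= X * _](splitr e) mulrDl lerD//.
  apply: (le_trans h4); apply: (le_trans (ler_wpM2l _ qh)).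
    by rewrite ltW// !divr_gt0.
  by rewrite mulrA divfK// gt_eqF.
rewrite cmodM; apply: (le_trans (ler_wpM2l (cmod_ge0 _) h2)).
rewrite mulrA ler_wpM2r ?cmod_ge0// mulrCA ler_piMr ?divr_ge0 ?ltW//.
by rewrite ltr_pdivrMr// mul1r ltrDr.
Qed.

Lemma cderivM f g z l k : cderiv f z l -> cderiv g z k ->
  cderiv (fun z => f z * g z) z (l * g z + f z * k).
Proof.
move=> hf hg e e0.
have F : 0 < 1 + cmod (f z) by rewrite ltr_pwDl// cmod_ge0.
have G : 0 < 1 + cmod (g z) by rewrite ltr_pwDl// cmod_ge0.
have L : 0 < 1 + cmod l by rewrite ltr_pwDl// cmod_ge0.
have e3 : 0 < e / 3 by rewrite divr_gt0.
have [d1 d10 H1] := hf _ (divr_gt0 e3 (addr_gt0 ltr01 G)).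
have [d2 d20 H2] := hg _ (divr_gt0 e3 F).
have [d3 d30 H3] := cderiv_cont hg ltr01.
have [d4 d40 H4] := cderiv_cont hg (divr_gt0 e3 L).
exists (Num.min (Num.min d1 d2) (Num.min d3 d4)).
  by rewrite !lt_min d10 d20 d30.
move=> h; rewrite !lt_min => /andP[/andP[/H1 h1 /H2 h2] /andP[hd3 hd4]].
have zh : z + h - z = h by ring.
have := H3 (z + h); rewrite zh => /(_ hd3) h3.
have := H4 (z + h); rewrite zh => /(_ hd4) h4.
rewrite (_ : _ - _ = (f (z + h) - f z - l * h) * g (z + h) +
   f z * (g (z + h) - g z - k * h) + l * h * (g (z + h) - g z)); last by ring.
rewrite (_ : e * cmod h = e / 3 * cmod h + e / 3 * cmod h + e / 3 * cmod h); last by field.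
apply: (le_trans (cmodD _ _)); apply: lerD; first (apply: (le_trans (cmodD _ _)); apply: lerD).
- rewrite cmodM; have gh : cmod (g (z + h)) <= 1 + (1 + cmod (g z)).
    rewrite (_ : g (z + h) = (g (z + h) - g z) + g z); last by ring.
    by rewrite (le_trans (cmodD _ _))// lerD ?(ltW h3)// lerDr.
  apply: (le_trans (ler_pM (cmod_ge0 _) (cmod_ge0 _) h1 gh)).
  by rewrite mulrAC divfK// gt_eqF// addr_gt0.
- rewrite cmodM; apply: (le_trans (ler_wpM2l (cmod_ge0 _) h2)).
  rewrite mulrA ler_wpM2r ?cmod_ge0// mulrCA ler_piMr ?(ltW e3)//.
  by rewrite ltW// ltr_pdivrMr// mul1r ltrDr.
- rewrite !cmodM mulrAC ler_wpM2r ?cmod_ge0//.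
  apply: (le_trans (ler_wpM2l (cmod_ge0 _) (ltW h4))).
  rewrite mulrCA ler_piMr ?(ltW e3)//.
  by rewrite ltW// ltr_pdivrMr// mul1r ltrDr.
Qed.

Lemma cderiv_cexp z : cderiv (@cexp R) z (cexp z).
Proof.
move=> e e0; pose d := e / (expR 1 * expR (complex.Re z)).
have E : 0 < expR 1 * expR (complex.Re z) by rewrite mulr_gt0 ?expR_gt0.
exists (Num.min 1 d); first by rewrite lt_min ltr01 divr_gt0.
move=> h; rewrite lt_min => /andP[h1 hd].
have := @cexp_tail R 2 h; rewrite !big_ord_recl big_ord0/= fact0 !factS fact0.
rewrite !muln1 expr0 expr1 addr0 invr1 !mul1r => H.
rewrite cexpD (_ : _ - _ = cexp z * (cexp h - (1 + h))); last by ring.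
rewrite cmodM cmod_cexp.
have {}H : cmod (cexp h - (1 + h)) <= cmod h * expR 1 * cmod h.
  apply: (le_trans H); rewrite expr2 -!mulrA ler_wpM2l ?cmod_ge0// mulrC.
  rewrite ler_wpM2r ?cmod_ge0// -[leRHS]mul1r ler_pM ?expR_ge0//; last by rewrite ler_expR ltW.
  by rewrite invf_le1// ler1n.
apply: (le_trans (ler_wpM2l (expR_ge0 _) H)).
rewrite !mulrA ler_wpM2r ?cmod_ge0// mulrC mulrA -ler_pdivlMl ?expR_gt0//.
by move: hd; rewrite /d [X in _ < X]mulrC => /ltW.
Qed.

End Entire.

(** * Cauchy's theorem and mean values *)

Section Segment.
Variable R : realType.
Local Notation leb := (@lebesgue_measure R).
Implicit Types (f g : R -> R).

Definition iI f (a b : R) := Rintegral leb `[a, b]%classic f.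

Lemma iI_integrable f a b : continuous f ->
  leb.-integrable `[a, b]%classic (EFin \o f).
Proof.
move=> fc; apply: continuous_compact_integrable; first exact: segment_compact.
exact: continuous_subspaceT.
Qed.

Lemma iID f g a b : continuous f -> continuous g ->
  iI (fun x => f x + g x) a b = iI f a b + iI g a b.
Proof. by move=> fc gc; rewrite /iI RintegralD//; exact: iI_integrable. Qed.

Lemma iIB f g a b : continuous f -> continuous g ->
  iI (fun x => f x - g x) a b = iI f a b - iI g a b.
Proof. by move=> fc gc; rewrite /iI RintegralB//; exact: iI_integrable. Qed.

Lemma iI_cst k a b : a <= b -> iI (fun=> k) a b = k * (b - a).
Proof.
move=> ab; rewrite /iI Rintegral_cst//= lebesgue_measure_itv/= lte_fin.
by move: ab; rewrite le_eqVlt => /predU1P[->|->//]; rewrite ltxx subrr.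
Qed.

Lemma iI_bound f k a b : a <= b -> continuous f ->
  (forall x, a <= x <= b -> `|f x| <= k) -> `|iI f a b| <= k * (b - a).
Proof.
move=> ab fc fk; have mI : measurable (`[a, b]%classic : set (measurableTypeR R)) by exact: measurable_itv.
have h := le_normr_Rintegral mI (iI_integrable a b fc).
rewrite /iI; apply: (le_trans h).
rewrite -iI_cst//; apply: le_Rintegral => //.
- by apply: iI_integrable => x; apply: cvg_norm; exact: fc.
- by apply: iI_integrable => x; exact: cvg_cst.
Qed.

Lemma iI_split f a m b : a <= m -> m <= b -> continuous f ->
  iI f a b = iI f a m + iI f m b.
Proof.
move=> am mb fc; rewrite /iI addrC; apply/eqP; rewrite -subr_eq; apply/eqP.
rewrite Rintegral_itvB//; last exact: iI_integrable.
rewrite Rintegral_itv_obnd_cbnd//; apply: integrableS (iI_integrable m b fc) => //.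
by apply: subset_itvr; rewrite bnd_simp.
Qed.

End Segment.

Section NestedSegments.
Variable R : realType.

Lemma nested_segments (a b : nat -> R) :
  (forall n, a n <= a n.+1) -> (forall n, b n.+1 <= b n) ->
  (forall n, a n <= b n) -> exists x, forall n, a n <= x <= b n.
Proof.
move=> aS bS ab.
have ma m n : (m <= n)%N -> a m <= a n.
  by elim: n => [|n IH]; [rewrite leqn0 => /eqP->|
    rewrite leq_eqVlt => /predU1P[->//|/IH /le_trans]; apply].
have mb m n : (m <= n)%N -> b n <= b m.
  elim: n => [|n IH]; first by rewrite leqn0 => /eqP->.
  rewrite leq_eqVlt => /predU1P[->//|/IH]; exact: le_trans.
have amn m n : a m <= b n.
  by rewrite (le_trans (ma m (maxn m n) (leq_maxl _ _)))// (le_trans (ab _))// mb// leq_maxr.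
exists (sup (range a)) => n; apply/andP; split.
  by apply: sup_ubound; [exists (b 0%N) => _ [m _ <-]|exists n].
by apply: ge_sup; [exists (a 0%N), 0%N|move=> _ [m _ <-]].
Qed.

End NestedSegments.

Section NearAffine.
Variable R : realType.

(** Total differentiability at one point, with gradient [(p, q)]. Nothing is asked of the gradient
    as a function of the point, so holomorphy in the weak sense of [entire] is enough for Goursat's
    argument. *)
Definition near_affine (f : R -> R -> R) x0 y0 p q := forall e, 0 < e ->
  exists2 d, 0 < d & forall x y, `|x - x0| < d -> `|y - y0| < d ->
    `|f x y - f x0 y0 - (p * (x - x0) + q * (y - y0))| <=
    e * (`|x - x0| + `|y - y0|).

Lemma near_affine_cont f x0 y0 p q : near_affine f x0 y0 p q ->
  {for x0, continuous (f^~ y0)} /\ {for y0, continuous (f x0)}.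
Proof.
move=> H; have [d d0 Hd] := H 1 ltr01.
have K : 0 < 1 + (`|p| + `|q|) by rewrite ltr_pwDl// addr_ge0.
split; apply/cvgrPdist_lt => e e0; near=> t; rewrite distrC.
  have := Hd t y0; rewrite subrr normr0 mulr0 !addr0 mul1r => /(_ _ d0).
  have td : `|t - x0| < d by near: t; exact: cvgr_distC_lt.
  move=> /(_ td) h.
  rewrite (_ : f t y0 - _ = f t y0 - f x0 y0 - p * (t - x0) + p * (t - x0)); last by ring.
  apply: (le_lt_trans (ler_normD _ _)); rewrite normrM.
  apply: (@le_lt_trans _ _ ((1 + (`|p| + `|q|)) * `|t - x0|)).
    by rewrite mulrDl mul1r lerD// ler_wpM2r// lerDl.
  rewrite mulrC -ltr_pdivlMr//; near: t; apply: cvgr_distC_lt => //.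
  by rewrite divr_gt0.
have := Hd x0 t; rewrite subrr normr0 mulr0 !add0r mul1r => /(_ d0).
have td : `|t - y0| < d by near: t; exact: cvgr_distC_lt.
move=> /(_ td) h.
rewrite (_ : f x0 t - _ = f x0 t - f x0 y0 - q * (t - y0) + q * (t - y0)); last by ring.
apply: (le_lt_trans (ler_normD _ _)); rewrite normrM.
apply: (@le_lt_trans _ _ ((1 + (`|p| + `|q|)) * `|t - y0|)).
  by rewrite mulrDl mul1r lerD// ler_wpM2r// lerDr.
rewrite mulrC -ltr_pdivlMr//; near: t; apply: cvgr_distC_lt => //.
by rewrite divr_gt0.
Unshelve. all: by end_near. Qed.

End NearAffine.

Section Goursat.
Variable R : realType.
Variables P Q : R -> R -> R.

(* The form [P dx + Q dy] is differentiable and closed. *)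
Hypothesis closed_form : forall x0 y0, exists p1 p2 q2,
  near_affine P x0 y0 p1 p2 /\ near_affine Q x0 y0 p2 q2.

Let Px y : continuous (P^~ y).
Proof.
by move=> x; have [p1 [p2 [q2 [h _]]]] := closed_form x y; have [] := near_affine_cont h.
Qed.
Let Qy x : continuous (Q x).
Proof.
by move=> y; have [p1 [p2 [q2 [_ h]]]] := closed_form x y; have [] := near_affine_cont h.
Qed.

(** The counterclockwise line integral of P dx + Q dy around the rectangle [a, b] x [c, d]. *)
Definition circulation a b c d :=
  iI (P^~ c) a b + iI (Q b) c d - iI (P^~ d) a b - iI (Q a) c d.

Let circ_splitx a m b c d : a <= m -> m <= b ->
  circulation a b c d = circulation a m c d + circulation m b c d.
Proof.
by move=> am mb; rewrite /circulation (iI_split am mb (@Px c)) (iI_split am mb (@Px d)); ring.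
Qed.

Let circ_splity a b c m d : c <= m -> m <= d ->
  circulation a b c d = circulation a b c m + circulation a b m d.
Proof.
by move=> am mb; rewrite /circulation (iI_split am mb (@Qy a)) (iI_split am mb (@Qy b)); ring.
Qed.

(** The affine part has no circulation because the coefficient [p2] is common to [P] and [Q]: adding
    p2 (d - c) to the horizontal sides and subtracting p2 (b - a) from the vertical ones changes
    nothing in total. What is left is a first-order remainder times a side length, hence quadratic
    in the size. *)
Let circ_small x0 y0 e : 0 < e -> exists2 r, 0 < r &
  forall a b c d, a <= x0 <= b -> c <= y0 <= d -> b - a < r -> d - c < r ->
    `|circulation a b c d| <= e * ((b - a) + (d - c)) ^+ 2.
Proof.
move=> e0; have [p1 [p2 [q2 [hP hQ]]]] := closed_form x0 y0.
have e4 : 0 < e / 2 by rewrite divr_gt0.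
have [r1 r10 H1] := hP _ e4; have [r2 r20 H2] := hQ _ e4.
exists (Num.min r1 r2); first by rewrite lt_min r10.
move=> a b c d /andP[ax xb] /andP[cy yd]; rewrite !lt_min => /andP[w1 w2] /andP[h1 h2].
have ab := le_trans ax xb; have cd := le_trans cy yd.
have near x : a <= x <= b -> `|x - x0| <= b - a.
  by move=> /andP[? ?]; rewrite ler_norml; lra.
have near' y : c <= y <= d -> `|y - y0| <= d - c.
  by move=> /andP[? ?]; rewrite ler_norml; lra.
set s := (b - a) + (d - c).
have key1 x : a <= x <= b -> `|P x c - P x d + p2 * (d - c)| <= e * s.
  move=> xab; have nx := near _ xab.
  have nc : `|c - y0| <= d - c by apply: near'; rewrite lexx.
  have nd : `|d - y0| <= d - c by apply: near'; rewrite lexx andbT.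
  have Hc := H1 x c (le_lt_trans nx w1) (le_lt_trans nc h1).
  have Hd := H1 x d (le_lt_trans nx w1) (le_lt_trans nd h1).
  rewrite (_ : _ + _ = (P x c - P x0 y0 - (p1 * (x - x0) + p2 * (c - y0))) -
    (P x d - P x0 y0 - (p1 * (x - x0) + p2 * (d - y0)))); last by ring.
  apply: (le_trans (ler_normB _ _)); rewrite [e]splitr mulrDl.
  by apply: lerD; [apply: (le_trans Hc)|apply: (le_trans Hd)];
    rewrite ler_wpM2l ?(ltW e4)// lerD.
have key2 y : c <= y <= d -> `|Q b y - Q a y - p2 * (b - a)| <= e * s.
  move=> ycd; have ny := near' _ ycd.
  have na : `|a - x0| <= b - a by apply: near; rewrite lexx.
  have nb : `|b - x0| <= b - a by apply: near; rewrite lexx andbT.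
  have Ha := H2 a y (le_lt_trans na w2) (le_lt_trans ny h2).
  have Hb := H2 b y (le_lt_trans nb w2) (le_lt_trans ny h2).
  rewrite (_ : _ - _ = (Q b y - Q x0 y0 - (p2 * (b - x0) + q2 * (y - y0))) -
    (Q a y - Q x0 y0 - (p2 * (a - x0) + q2 * (y - y0)))); last by ring.
  apply: (le_trans (ler_normB _ _)); rewrite [e]splitr mulrDl.
  by apply: lerD; [apply: (le_trans Hb)|apply: (le_trans Ha)];
    rewrite ler_wpM2l ?(ltW e4)// lerD.
have kc (k : R) : continuous (fun _ : R => k) by move=> x; exact: cvg_cst.
have cB (f g : R -> R) : continuous f -> continuous g -> continuous (fun x => f x - g x).
  by move=> fc gc x; apply: cvgB; [exact: fc|exact: gc].
have cD (f g : R -> R) : continuous f -> continuous g -> continuous (fun x => f x + g x).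
  by move=> fc gc x; apply: cvgD; [exact: fc|exact: gc].
rewrite (_ : circulation a b c d =
    iI (fun x => P x c - P x d + p2 * (d - c)) a b +
    iI (fun y => Q b y - Q a y - p2 * (b - a)) c d); last first.
  rewrite iID//; last exact: (cB _ _ (@Px c) (@Px d)).
  rewrite iIB//.
  rewrite [X in _ = _ + X]iIB//; last exact: (cB _ _ (@Qy b) (@Qy a)).
  rewrite [X in _ = _ + (X - _)]iIB//.
  by rewrite !iI_cst// /circulation; ring.
apply: (le_trans (ler_normD _ _)).
rewrite (_ : e * s ^+ 2 = e * s * (b - a) + e * s * (d - c)); last by rewrite /s; ring.
apply: lerD.
  by apply: iI_bound => //; apply: (cD) => //; exact: (cB _ _ (@Px c) (@Px d)).
by apply: iI_bound => //; apply: (cB) => //; exact: (cB _ _ (@Qy b) (@Qy a)).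
Qed.

Let rect := ((R * R) * (R * R))%type.
Let ok (q : rect) := q.1.1 <= q.1.2 /\ q.2.1 <= q.2.2.
Let circ (q : rect) := circulation q.1.1 q.1.2 q.2.1 q.2.2.
(** Guarded by [ok q] so that every [q] has a child and [choice] yields a total map to iterate. *)
Let child (q q' : rect) := ok q -> [/\ ok q',
  q.1.1 <= q'.1.1 /\ q'.1.2 <= q.1.2,
  q.2.1 <= q'.2.1 /\ q'.2.2 <= q.2.2,
  q'.1.2 - q'.1.1 = (q.1.2 - q.1.1) / 2 /\ q'.2.2 - q'.2.1 = (q.2.2 - q.2.1) / 2 &
  `|circ q| / 4 <= `|circ q'|].

Let child_exists q : exists q', child q q'.
Proof.
have [okq|nok] := pselect (ok q); last by exists q.
case: q okq => -[a b] [c d] [/= ab cd].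
pose m := (a + b) / 2; pose n := (c + d) / 2.
have half (x y : R) : x <= y -> [/\ x <= (x + y) / 2, (x + y) / 2 <= y,
    (x + y) / 2 - x = (y - x) / 2 & y - (x + y) / 2 = (y - x) / 2].
  by move=> xy; split; lra.
have [am mb ma bm] := half _ _ ab; have [cn nd nc dn] := half _ _ cd.
have E : circ ((a, b), (c, d)) = circulation a m c n + circulation a m n d +
    (circulation m b c n + circulation m b n d).
  by rewrite /circ/= (circ_splitx c d am mb) (circ_splity a m cn nd) (circ_splity m b cn nd).
set k := `|circ ((a, b), (c, d))| / 4.
have [h|h1] := leP k `|circulation a m c n|.
  by exists ((a, m), (c, n)); split.
have [h|h2] := leP k `|circulation a m n d|.
  by exists ((a, m), (n, d)); split.
have [h|h3] := leP k `|circulation m b c n|.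
  by exists ((m, b), (c, n)); split.
have [h|h4] := leP k `|circulation m b n d|.
  by exists ((m, b), (n, d)); split.
suff : `|circ ((a, b), (c, d))| < 4 * k by rewrite /k; lra.
rewrite E; apply: (le_lt_trans (ler_normD _ _)).
apply: (le_lt_trans (lerD (ler_normD _ _) (ler_normD _ _))); lra.
Qed.

(** Goursat's bisection. The circulation may shrink by 4 at each step, while the square of the side
    lengths shrinks by exactly 4, so the local estimate at the limit point bounds the original
    circulation by an arbitrary [e]. *)
Lemma circulation_eq0 a b c d : a <= b -> c <= d -> circulation a b c d = 0.
Proof.
move=> ab cd; have [F HF] := choice child_exists.
pose q n := iter n F ((a, b), (c, d)).
have okq n : ok (q n) by elim: n => [|n IH] //; have [] := HF (q n) IH.
have [x Hx] : exists x, forall n, (q n).1.1 <= x <= (q n).1.2.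
  apply: nested_segments => n; last by have [] := okq n.
    by have [_ []] := HF _ (okq n).
  by have [_ []] := HF _ (okq n).
have [y Hy] : exists y, forall n, (q n).2.1 <= y <= (q n).2.2.
  apply: nested_segments => n; last by have [] := okq n.
    by have [_ _ []] := HF _ (okq n).
  by have [_ _ []] := HF _ (okq n).
have wid n : (q n).1.2 - (q n).1.1 = (b - a) / 2 ^+ n /\
    (q n).2.2 - (q n).2.1 = (d - c) / 2 ^+ n.
  elim: n => [|n [IH1 IH2]]; first by rewrite /= expr0 !divr1.
  have [_ _ _ [-> ->] _] := HF _ (okq n).
  by rewrite IH1 IH2 exprS invfM; split; ring.
have low n : `|circulation a b c d| / 4 ^+ n <= `|circ (q n)|.
  elim: n => [|n IH]; first by rewrite expr0 divr1.
  have [_ _ _ _ ] := HF _ (okq n); apply: le_trans.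
  by rewrite exprSr invfM mulrA ler_wpM2r ?invr_ge0.
apply/eqP; rewrite -normr_le0; apply/ler_addgt0Pl => e e0; rewrite addr0.
set s := (b - a) + (d - c).
have s0 : 0 <= s by rewrite /s; lra.
have K : 0 < 1 + s ^+ 2 by rewrite ltr_pwDl// sqr_ge0.
have [r r0 Hr] := circ_small x y (divr_gt0 e0 K).
have [n Hn] : exists n, (1 + s) / 2 ^+ n < r.
  have : ((1 + s) * (2^-1) ^+ n) @[n --> \oo] --> (0 : R).
    rewrite -(mulr0 (1 + s)); apply: cvgM; first exact: cvg_cst.
    by apply: cvg_expr; rewrite ger0_norm ?invr_ge0// invf_lt1// ltr1n.
  move/cvgrPdist_lt => /(_ r r0) [N _ /(_ N (leqnn N))] /=.
  rewrite sub0r normrN exprVn => h; exists N; exact: le_lt_trans (ler_norm _) h.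
have [w1 w2] := wid n.
have p2 : 0 < 2 ^+ n :> R by rewrite exprn_gt0.
have h1 : (q n).1.2 - (q n).1.1 < r.
  by rewrite w1; apply: le_lt_trans Hn; rewrite ler_pM2r ?invr_gt0// /s; lra.
have h2 : (q n).2.2 - (q n).2.1 < r.
  by rewrite w2; apply: le_lt_trans Hn; rewrite ler_pM2r ?invr_gt0// /s; lra.
have := le_trans (low n) (Hr _ _ _ _ (Hx n) (Hy n) h1 h2).
rewrite w1 w2 -mulrDl -/s expr_div_n -exprM mulnC exprM.
rewrite (_ : 2 ^+ 2 = 4); last by rewrite expr2; ring.
rewrite mulrA ler_pM2r ?invr_gt0 ?exprn_gt0// => /le_trans; apply.
by rewrite mulrAC ler_pdivrMr// ler_wpM2l ?(ltW e0)// lerDr.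
Qed.

End Goursat.

Section CircleMean.
Variable R : realType.
Variable f : R[i] -> R[i].
Hypothesis fe : entire f.

(** The Cauchy-Riemann equations, read off the complex expansion of [g]. *)
Let cderiv_near_affine (g : R[i] -> R[i]) x0 y0 l : cderiv g (x0 +i* y0) l ->
  near_affine (fun x y => complex.Re (g (x +i* y))) x0 y0 (complex.Re l) (- complex.Im l) /\
  near_affine (fun x y => complex.Im (g (x +i* y))) x0 y0 (complex.Im l) (complex.Re l).
Proof.
move=> H; suff K e : 0 < e -> exists2 d, 0 < d & forall x y, `|x - x0| < d -> `|y - y0| < d ->
    cmod (g (x +i* y) - g (x0 +i* y0) - l * ((x - x0) +i* (y - y0))) <=
    e * (`|x - x0| + `|y - y0|).
  split=> e /K[d d0 Hd]; exists d => // x y hx hy; apply: le_trans (Hd x y hx hy).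
    apply: le_trans (normr_Re_le _); rewrite !reimE/=.
    by rewrite (_ : _ - _ - _ = complex.Re (g (x +i* y)) - complex.Re (g (x0 +i* y0)) -
      (complex.Re l * (x - x0) - complex.Im l * (y - y0)))//; ring.
  apply: le_trans (normr_Im_le _); rewrite !reimE/=.
  by rewrite (_ : _ - _ - _ = complex.Im (g (x +i* y)) - complex.Im (g (x0 +i* y0)) -
    (complex.Re l * (y - y0) + complex.Im l * (x - x0)))//; ring.
move=> e0; have [d d0 Hd] := H e e0.
exists (d / 2); first by rewrite divr_gt0.
move=> x y hx hy; have hd : cmod ((x - x0) +i* (y - y0)) < d.
  by apply: (le_lt_trans (cmod_le_ReIm _)); rewrite /= [d]splitr ltrD.
have E : x0 +i* y0 + ((x - x0) +i* (y - y0)) = x +i* y.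
  by apply: complexP => /=; ring.
have := Hd _ hd; rewrite E => /le_trans; apply.
by rewrite ler_wpM2l ?(ltW e0)//; exact: cmod_le_ReIm.
Qed.

(** Logarithmic polar coordinates: vertical segments of length 2 pi are mapped to circles around 0,
    and moving to the left shrinks these circles to the centre. *)
Let g x (z : R[i]) := f (x * cexp z).

Let g_deriv x z : exists l, cderiv (g x) z l.
Proof.
move/entireP: fe => /(_ (x * cexp z)) [l Hl].
exists (l * (x * cexp z)); apply: cderiv_comp => //.
have := cderivM (cderiv_cst x z) (cderiv_cexp z).
by rewrite mul0r add0r.
Qed.

Let cexp_period s : cexp (s +i* (pi *+ 2)) = cexp (s +i* 0) :> R[i].
Proof. by rewrite /cexp/= cos2pi sin2pi cos0 sin0. Qed.

Lemma circle_continuous x s :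
  continuous (fun t : R => complex.Re (f (x * cexp (s +i* t)))).
Proof.
move=> t; have [l /cderiv_near_affine [h _]] := @g_deriv x (s +i* t).
by have [] := near_affine_cont h.
Qed.

(** In logarithmic coordinates the horizontal sides of a rectangle of height 2 pi cancel by
    periodicity, so the mean over a circle does not depend on the radius. Continuity at 0 identifies
    its value. *)
Lemma circle_mean x :
  iI (fun t => complex.Re (f (x * cexp (0 +i* t)))) 0 (pi *+ 2) =
  complex.Re (f 0) * (pi *+ 2).
Proof.
have pi2 : 0 <= pi *+ 2 :> R by rewrite mulrn_wge0// pi_ge0.
have indep S : 0 <= S -> iI (fun t => complex.Re (f (x * cexp (0 +i* t)))) 0 (pi *+ 2) =
    iI (fun t => complex.Re (f (x * cexp (- S +i* t)))) 0 (pi *+ 2).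
  (* The form used is the imaginary part of g dz, where dz = ds + i dt. *)
  move=> S0; have := @circulation_eq0 R (fun s t => complex.Im (g x (s +i* t)))
    (fun s t => complex.Re (g x (s +i* t))) _ (- S) 0 0 (pi *+ 2) _ pi2.
  rewrite /circulation => H.
  have {}H := H _ _.
  have E : (fun s => complex.Im (g x (s +i* (pi *+ 2)))) =
      (fun s => complex.Im (g x (s +i* 0))).
    by apply/funext => s; rewrite /g cexp_period.
  apply/eqP; rewrite -subr_eq0; apply/eqP; rewrite -[RHS]H.
  - rewrite E /g; set A := iI _ 0 _; set B := iI _ 0 _; set D := iI _ _ _.
    by ring.
  - move=> s t; have [l /cderiv_near_affine [h1 h2]] := @g_deriv x (s +i* t).
    by exists (complex.Im l), (complex.Re l), (- complex.Im l).
  - by rewrite oppr_le0.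
apply/eqP; rewrite -subr_eq0 -normr_le0; apply/ler_addgt0Pl => e e0; rewrite addr0.
have K : 0 < 1 + pi *+ 2 :> R by rewrite ltr_pwDl.
have [d d0 Hd] := entire_ccont fe 0 (divr_gt0 e0 K).
have X : 0 < 1 + cmod x by rewrite ltr_pwDl// cmod_ge0.
(* Large enough that the circle of radius [cmod x * expR (- S)] lies in the disc where [f] is close
   to [f 0]; the maximum with 0 keeps the rectangle well oriented. *)
pose S := Num.max 0 (- ln (d / (1 + cmod x) / 2)).
have S0 : 0 <= S by rewrite le_max lexx.
rewrite (indep S S0) (_ : _ * _ = iI (fun=> complex.Re (f 0)) 0 (pi *+ 2)); last first.
  by rewrite iI_cst// subr0.
rewrite -iIB//; last first.
- by move=> t; exact: cvg_cst.
- exact: circle_continuous.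
apply: (@le_trans _ _ (e / (1 + pi *+ 2) * (pi *+ 2 - 0))).
  apply: iI_bound => //.
    move=> t; apply: cvgB; [exact: circle_continuous|exact: cvg_cst].
  move=> t _; rewrite -ReN -ReD; apply: (le_trans (normr_Re_le _)); apply: ltW.
  apply: Hd; rewrite subr0 cmodM cmod_cexp/=.
  have dx : 0 < d / (1 + cmod x) / 2 by rewrite !divr_gt0.
  have h : expR (- S) <= d / (1 + cmod x) / 2.
    by rewrite -[leRHS]lnK ?posrE// ler_expR lerNl le_max lexx orbT.
  apply: (le_lt_trans (ler_wpM2l (cmod_ge0 _) h)).
  apply: (@le_lt_trans _ _ (d / 2)); last by rewrite ltr_pdivrMr// mulr2n mulrDr mulr1 ltrDl.
  rewrite mulrA ler_pM2r ?invr_gt0// mulrCA ler_piMr ?(ltW d0)//.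
  by rewrite ler_pdivrMr// mul1r lerDr.
by rewrite subr0 mulrAC ler_pdivrMr// ler_wpM2l ?(ltW e0)// lerDr.
Qed.

End CircleMean.

Section GaussianMean.
Variable R : realType.
Local Notation leb := (@lebesgue_measure R).
Local Notation leb2 := (@plane_measure R).

Lemma gint_rotate (w : R[i]) (f : R[i] -> R) : cmod w = 1 -> gint f ->
  rmeas (fun z => f (w * z)) -> gint (fun z => f (w * z)).
Proof.
move=> w1 fi mf'; have mf := gint_rmeas fi; apply/integrableP.
split; first exact/measurable_EFinP.
have h : preserving (fun x => (complex.Re w * x.1 - complex.Im w * x.2,
    complex.Im w * x.1 + complex.Re w * x.2)).
  by apply: preserving_rotate; rewrite -cmod_sqr w1 expr1n.
have mfa : measurable_fun setT (fun x : plane R => (`|f (cx x)|)%:E).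
  by apply/measurable_EFinP; exact: rmeas_abs.
move/integrableP : fi => [_]; apply: le_lt_trans.
rewrite le_eqVlt; apply/orP; left; apply/eqP.
have := preserving_integral h mfa => /= H; rewrite -[RHS]H.
apply: eq_integral => x _; congr (EFin `|f _|).
by case: w {w1 h mf' H} => a b; rewrite /cx/=; apply: complexP; rewrite /=; ring.
Qed.

Lemma gauss_rotate b (w z : R[i]) : cmod w = 1 -> gauss b (w * z) = gauss b z.
Proof. by move=> w1; rewrite /gauss cmodM w1 mul1r. Qed.

(** The Gaussian integral is unchanged when the argument of [f] is rotated by [t]. Averaging over
    [t] and exchanging the integrals leaves a circle mean inside, which is the constant
    [Re (f 0)]. *)
Lemma gauss_mean_Re (f : R[i] -> R[i]) (b : R) : entire f ->
  cint (fun u => f u * (gauss b u)%:C) ->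
  gint (gauss b) ->
  rI (fun u => complex.Re (f u) * gauss b u) = complex.Re (f 0) * rI (gauss b).
Proof.
move=> fe fi gi.
have fri : gint (fun u => complex.Re (f u) * gauss b u).
  by have := cint_Re fi; rewrite (_ : (fun _ => _) = (fun u => complex.Re (f u) * gauss b u))//;
    apply/funext => u; rewrite reimE/= mulr0 subr0.
have pi2 : 0 < pi *+ 2 :> R by rewrite mulrn_wgt0// pi_gt0.
pose w (t : R) := cexp (0 +i* t).
have w1 t : cmod (w t) = 1 by rewrite cmod_cexp/= expR0.
pose k u t := complex.Re (f (u * w t)) * gauss b u.
pose D := `[0, pi *+ 2]%classic : set (measurableTypeR R).
have mD : measurable D by exact: measurable_itv.
have kE t u : k u t = complex.Re (f (w t * u)) * gauss b (w t * u).
  by rewrite /k gauss_rotate// [u * _]mulrC.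
have kJ t : rI (k^~ t) = rI (fun u => complex.Re (f u) * gauss b u).
  rewrite -(rI_rotate (w1 t) (gint_rmeas fri)); congr rI; apply/funext => u.
  exact: kE.
pose h (tx : measurableTypeR R * plane R) := k (cx tx.2) tx.1.
have mh : measurable_fun setT h.
  apply: measurable_funM; last first.
    by apply: (measurableT_comp (rmeas_gauss b)); exact: measurable_snd.
  (* Joint measurability in angle and point: the rotation is written out with [cos], [sin] and real
     coordinates. *)
  pose W (tx : measurableTypeR R * plane R) : plane R :=
    (tx.2.1 * cos tx.1 - tx.2.2 * sin tx.1, tx.2.1 * sin tx.1 + tx.2.2 * cos tx.1).
  have mW : measurable_fun setT W.
    have mc : measurable_fun setT (fun tx : measurableTypeR R * plane R => cos tx.1).
      apply: (measurableT_comp (f := @cos R)); last exact: measurable_fst.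
      by apply: continuous_measurable_fun; exact: continuous_cos.
    have ms : measurable_fun setT (fun tx : measurableTypeR R * plane R => sin tx.1).
      apply: (measurableT_comp (f := @sin R)); last exact: measurable_fst.
      by apply: continuous_measurable_fun; exact: continuous_sin.
    have m1 : measurable_fun setT (fun tx : measurableTypeR R * plane R => tx.2.1).
      by apply: (measurableT_comp (f := fst)); [exact: measurable_fst|exact: measurable_snd].
    have m2 : measurable_fun setT (fun tx : measurableTypeR R * plane R => tx.2.2).
      by apply: (measurableT_comp (f := snd)); [exact: measurable_snd|exact: measurable_snd].
    apply/measurable_fun_pairP; split => /=.
      by apply: measurable_funB; exact: measurable_funM.
    by apply: measurable_funD; exact: measurable_funM.
  have [hr _] := entire_cmeas fe.
  have := measurableT_comp hr mW; congr (measurable_fun _ _).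
  apply/funext => -[t [x y]] /=; congr (complex.Re (f _)).
  by apply: complexP; rewrite /= expR0; ring.
have kint t : gint (k^~ t).
  have mk : rmeas (k^~ t) by exact: (measurableT_comp mh (pair1_measurable t)).
  have E : k^~ t = (fun u => (fun v => complex.Re (f v) * gauss b v) (w t * u)).
    by apply/funext => u; exact: kE.
  by rewrite E; apply: (gint_rotate (w1 t) fri); rewrite -E.
(* The indicator moves the range of the angle into the integrand, so that Fubini applies on whole
   spaces. *)
pose F (tx : measurableTypeR R * plane R) := (\1_D tx.1 * h tx)%:E.
have mF : measurable_fun setT F.
  apply/measurable_EFinP; apply: measurable_funM => //.
  have mi : measurable_fun setT (\1_D : measurableTypeR R -> R) by exact: measurable_indic.
  exact: (measurableT_comp mi measurable_fst).
have intD (c : R) : (\int[leb]_t (\1_D t * c)%:E = (c * (pi *+ 2))%:E)%E.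
  transitivity (\int[leb]_(t in D) c%:E)%E.
    rewrite [RHS]integral_mkcond; apply: eq_integral => t _.
    by rewrite patchE indicE; case: ifP => _; rewrite ?mul1r ?mul0r.
  rewrite integral_cst//= lebesgue_measure_itv/= lte_fin pi2 -EFinB subr0.
  by rewrite EFinM.
have kabs t : rI (fun u => `|k u t|) = rI (fun u => `|complex.Re (f u) * gauss b u|).
  rewrite -(rI_rotate (w1 t) (gint_rmeas (gint_abs fri))); congr rI.
  by apply/funext => u; rewrite kE.
have Fi : (leb \x leb2)%E.-integrable setT F.
  apply/integrable12ltyP => //.
  under eq_integral => t _.
    rewrite (_ : (\int[_]_y _)%E = (\1_D t * rI (fun u => `|complex.Re (f u) * gauss b u|))%:E).
      over.
    rewrite -(kabs t) -rIZ; last exact: gint_abs.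
    rewrite rI_EFin; last by apply: gintZ; exact: gint_abs.
    apply: eq_integral => x _; rewrite /F/= normrM ger0_norm//.
  by rewrite intD ltry.
have := Fubini Fi; rewrite /fubini_F /fubini_G.
under eq_integral => t _.
  rewrite (_ : (\int[_]_y _)%E = (\1_D t * rI (fun u => complex.Re (f u) * gauss b u))%:E).
    over.
  rewrite -(kJ t) -rIZ// rI_EFin; last exact: gintZ.
  by apply: eq_integral.
rewrite intD.
under eq_integral => x _.
  rewrite (_ : (\int[_]_y _)%E = ((complex.Re (f 0) * (pi *+ 2)) * gauss b (cx x))%:E).
    over.
  rewrite -(circle_mean fe (cx x)).
  have cc := @circle_continuous R f fe (cx x) 0.
  have ci := iI_integrable 0 (pi *+ 2) cc.
  rewrite mulrC /iI -RintegralZl// /Rintegral fineK; last first.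
    exact: (integrable_fin_num mD (integrableZl mD (gauss b (cx x)) ci)).
  rewrite [RHS]integral_mkcond; apply: eq_integral => t _.
  rewrite patchE /F/= indicE /h /k/= mulrC; case: ifP => _; rewrite ?mulr1 ?mulr0//.
  by rewrite mulrC EFinM.
have H := rI_EFin (gintZ (complex.Re (f 0) * (pi *+ 2)) gi).
move=> E; have {E H}[] := etrans E (esym H).
rewrite rIZ// => /(congr1 (fun y => y / (pi *+ 2))).
by rewrite mulfK ?gt_eqF// mulrAC mulfK ?gt_eqF.
Qed.

Lemma gauss_mean (f : R[i] -> R[i]) (b : R) : entire f ->
  cint (fun u => f u * (gauss b u)%:C) -> gint (gauss b) ->
  cI (fun u => f u * (gauss b u)%:C) = f 0 * (rI (gauss b))%:C.
Proof.
move=> fe fi gi; apply: complexP; rewrite !reimE/= mulr0.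
  rewrite subr0 -gauss_mean_Re//; congr rI; apply/funext => u.
  by rewrite reimE/= mulr0 subr0.
(* The imaginary part of [f] is the real part of [- 'i * f]. *)
rewrite add0r; have nfe : entire (fun u => - 'i * f u + 0).
  apply/entireP => z; move/entireP: fe => /(_ z) [l Hl]; exists (- 'i * l).
  by apply: (@cderiv_comp R (fun y => - 'i * y + 0)) => //; exact: cderiv_affine.
have := gauss_mean_Re nfe _ gi.
rewrite (_ : (fun u => _ * (gauss b u)%:C) = (fun u => - 'i * (f u * (gauss b u)%:C))); last first.
  by apply/funext => u; ring.
move=> /(_ (cintZ _ fi)); rewrite (_ : (fun u => _ * gauss b u) =
   (fun u => complex.Im (f u * (gauss b u)%:C))).
  by move=> ->; rewrite !reimE/=; ring.
by apply/funext => u; rewrite !reimE/=; ring.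
Qed.

End GaussianMean.

(** * Entire functions of Gaussian growth *)

Section Growth.
Variable R : realType.
Implicit Types (f g : R[i] -> R[i]) (b c M : R) (z w u : R[i]).

Definition growth M c f := forall u, cmod (f u) <= M * expR (c * cmod u ^+ 2).

Lemma growth_ge0 M c f : growth M c f -> 0 <= M.
Proof.
move=> /(_ 0); rewrite cmod0 expr0n mulr0 expR0 mulr1; apply: le_trans.
exact: cmod_ge0.
Qed.

Lemma cmodD_sqr z w : cmod (z + w) ^+ 2 =
  cmod z ^+ 2 + cmod w ^+ 2 + 2 * complex.Re (w^* * z).
Proof. by rewrite !cmod_sqr !reimE; ring. Qed.

Lemma cmodD_sqr_le z w : cmod (z + w) ^+ 2 <= 2 * cmod z ^+ 2 + 2 * cmod w ^+ 2.
Proof.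
rewrite !cmod_sqr !reimE.
have := sqr_ge0 (complex.Re z - complex.Re w).
have := sqr_ge0 (complex.Im z - complex.Im w).
by nra.
Qed.

Lemma entireD f g : entire f -> entire g -> entire (fun z => f z + g z).
Proof.
move=> /entireP fe /entireP ge; apply/entireP => z.
have [l Hl] := fe z; have [k Hk] := ge z.
by exists (l + k); exact: cderivD.
Qed.

Lemma entireM f g : entire f -> entire g -> entire (fun z => f z * g z).
Proof.
move=> /entireP fe /entireP ge; apply/entireP => z.
have [l Hl] := fe z; have [k Hk] := ge z.
by exists (l * g z + f z * k); exact: cderivM.
Qed.

Lemma entire_comp f g : entire f -> entire g -> entire (fun z => f (g z)).
Proof.
move=> /entireP fe /entireP ge; apply/entireP => z.
have [k Hk] := ge z; have [l Hl] := fe (g z).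
by exists (l * k); exact: cderiv_comp.
Qed.

Lemma entire_affine (a c : R[i]) : entire (fun z => a * z + c).
Proof. by apply/entireP => z; exists a; exact: cderiv_affine. Qed.

Lemma entire_cst (c : R[i]) : entire (fun=> c).
Proof. by apply/entireP => z; exists 0; exact: cderiv_cst. Qed.

Lemma entire_cexp : entire (@cexp R).
Proof. by apply/entireP => z; exists (cexp z); exact: cderiv_cexp. Qed.

Lemma entire_translate w f : entire f -> entire (fun z => f (z + w)).
Proof.
move=> fe; have := entire_comp fe (@entire_affine 1 w).
by under eq_fun do rewrite mul1r.
Qed.

Lemma entireZ (c : R[i]) f : entire f -> entire (fun z => c * f z).
Proof. by move=> fe; exact: (@entireM (fun=> c) f (@entire_cst c) fe). Qed.

Lemma entire_explin (c : R[i]) : entire (fun z => cexp (c * z)).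
Proof.
have := entire_comp entire_cexp (@entire_affine c 0).
by under eq_fun do rewrite addr0.
Qed.

Lemma gauss_cexp b z : (gauss b z)%:C = cexp (- (b%:C * (z * z^*))).
Proof. by rewrite cmod_conjM -rmorphM -rmorphN cexpR /gauss mulNr. Qed.

Lemma gaussD b c z : gauss (b + c) z = gauss b z * gauss c z.
Proof. by rewrite /gauss -expRD opprD mulrDl. Qed.

Definition gmass b := rI (@gauss R b).

Lemma gmass_gt0 b : 0 < b -> 0 < gmass b.
Proof. by move=> /gauss_integral[]. Qed.

Lemma gint_gauss b : 0 < b -> gint (@gauss R b).
Proof. by move=> /gauss_integral[]. Qed.

Lemma linear_le_square (d r t : R) : 0 < d -> r * t <= d * t ^+ 2 + r ^+ 2 / (4 * d).
Proof.
move=> d0; rewrite -subr_ge0.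
rewrite (_ : _ - _ = d * (t - r / (2 * d)) ^+ 2).
  by rewrite mulr_ge0 ?sqr_ge0// ltW.
by field; rewrite gt_eqF.
Qed.

(** Half of the margin [b - c] absorbs the linear term by completing the square; the other half
    survives as an integrable Gaussian. *)
Lemma gauss_absorb b c r z : c < b ->
  expR (c * cmod z ^+ 2 + r * cmod z) * gauss b z <=
  expR (r ^+ 2 / (2 * (b - c))) * gauss ((b - c) / 2) z.
Proof.
move=> cb; rewrite /gauss -!expRD ler_expR.
have d0 : 0 < (b - c) / 2 by rewrite divr_gt0// subr_gt0.
have := linear_le_square r (cmod z) d0.
rewrite (_ : 4 * ((b - c) / 2) = 2 * (b - c)); last by field.
lra.
Qed.

Lemma gint_absorb b c r : c < b ->
  gint (fun z : R[i] => expR (c * cmod z ^+ 2 + r * cmod z) * gauss b z).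
Proof.
move=> cb; have d0 : 0 < (b - c) / 2 by rewrite divr_gt0// subr_gt0.
apply: (gint_le _ (gintZ (expR (r ^+ 2 / (2 * (b - c)))) (gint_gauss d0))).
  apply: rmeasM; last exact: rmeas_gauss.
  apply: rmeas_expR; apply: rmeasD; apply: rmeasM; try exact: rmeas_cst.
    exact: rmeas_cmod2.
  by apply: cmeas_cmod; exact: cmeas_id.
move=> z; rewrite ger0_norm ?mulr_ge0 ?expR_ge0 ?gauss_ge0//; exact: gauss_absorb.
Qed.

Lemma expR_ge_monomial (x : R) n : 0 <= x -> x ^+ n / n`!%:R <= expR x.
Proof.
case: n => [|n] x0; first by rewrite expr0 fact0 divr1 -[leLHS]expR0 ler_expR.
by apply: le_trans (expR_ge1Dxn n x0); rewrite lerDr.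
Qed.

(** Takes the place of Hölder's inequality in [pointwise_bound]. The price is an additive constant,
    so that bound is not homogeneous in [f]. *)
Lemma le_1Dpow (x p : R) : 0 <= x -> 1 <= p -> x <= 1 + x `^ p.
Proof.
move=> x0 p1; have [x1|x1] := leP x 1; first by rewrite (le_trans x1)// lerDl powR_ge0.
rewrite (le_trans (y := x `^ p))//; last by rewrite lerDr.
by rewrite -[leLHS]powRr1// ler_powR// ltW.
Qed.

(** The Gaussian mean value property for [f] translated by [w] and multiplied by an exponential that
    restores a Gaussian centred at 0 in the original variable. *)
Lemma pointwise_bound f a p K : entire f -> 0 < a -> 1 <= p ->
  gint (fun u => cmod (f u) `^ p * gauss a u) ->
  rI (fun u => cmod (f u) `^ p * gauss a u) <= K ->
  growth (2 * (gmass (a / p) + K) / gmass (2 * a / p)) (a / p) f.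
Proof.
move=> fe a0 p1 Yi YK w; have p0 : 0 < p by exact: lt_le_trans p1.
(* With this exponent the [p]-th power of [cmod f * gauss b] is the given integrand
   [cmod f ^ p * gauss a]. *)
set b := a / p; have b0 : 0 < b by rewrite divr_gt0.
have -> : 2 * a / p = 2 * b by rewrite /b mulrA.
have bb0 : 0 < 2 * b by rewrite mulr_gt0.
(* The exponential makes [cmod (h u) * gauss (2 * b) u] equal to [expR (b * cmod w ^+ 2)] times
   [cmod f * gauss b] at [u + w], times a spare [gauss b u] that integrates the constant of
   [le_1Dpow]. *)
pose h u := f (u + w) * cexp (- (2 * b)%:C * w^* * u).
pose Y u := cmod (f u) `^ p * gauss a u.
pose m u := expR (b * cmod w ^+ 2) * (gauss b u + Y (u + w)).
have he : entire h by apply: entireM; [exact: entire_translate|exact: entire_explin].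
have mi : gint m by apply: gintZ; apply: gintD; [exact: gint_gauss|exact: (gint_translate w Yi)].
have hm u : cmod (h u * (gauss (2 * b) u)%:C) <= m u.
  rewrite cmodM [cmod (h u)]cmodM cmod_cexp cmodR ger0_norm ?gauss_ge0//.
  set X := cmod (f (u + w)) * gauss b (u + w).
  have X0 : 0 <= X by rewrite mulr_ge0 ?cmod_ge0 ?gauss_ge0.
  have XY : X `^ p = Y (u + w).
    rewrite /X powRM ?cmod_ge0 ?gauss_ge0// /Y; congr (_ * _).
    rewrite /gauss -expRM; congr expR; rewrite mulrAC; congr (_ * _).
    by rewrite mulNr /b divfK// gt_eqF.
  have E : cmod (f (u + w)) * expR (complex.Re (- (2 * b)%:C * w^* * u)) *
      gauss (2 * b) u = expR (b * cmod w ^+ 2) * (X * gauss b u).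
    rewrite (_ : _ * (X * _) = cmod (f (u + w)) *
        (expR (b * cmod w ^+ 2) * gauss b (u + w) * gauss b u)); last by rewrite /X; ring.
    rewrite -mulrA; congr (_ * _); rewrite /gauss -!expRD; congr expR.
    by rewrite (cmodD_sqr u w) !reimE/=; ring.
  rewrite E ler_wpM2l ?expR_ge0// -XY.
  have g1 : gauss b u <= 1.
    by rewrite -expR0 ler_expR mulNr oppr_le0 mulr_ge0 ?sqr_ge0 ?ltW.
  apply: (le_trans (ler_wpM2r (gauss_ge0 b u) (le_1Dpow X0 p1))).
  by rewrite mulrDl mul1r lerD2l ler_piMr// powR_ge0.
have hc : cint (fun u => h u * (gauss (2 * b) u)%:C).
  apply: (cint_le _ mi hm); apply: cmeasM; first exact: entire_cmeas.
  by apply: cmeas_real; exact: rmeas_gauss.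
have := gauss_mean he hc (gint_gauss bb0).
rewrite /h add0r mulr0 cexp0 mulr1 => /(congr1 (@cmod R)).
rewrite cmodM cmodR (ger0_norm (ltW (gmass_gt0 bb0))) => E.
have := cI_le hc mi hm; rewrite [cmod _]E rIZ; last first.
  by apply: gintD; [exact: gint_gauss|exact: (gint_translate w Yi)].
rewrite rID; [|exact: gint_gauss|exact: (gint_translate w Yi)].
rewrite (rI_translate w (gint_rmeas Yi)) -/(gmass b) => H.
rewrite mulrAC ler_pdivlMr ?gmass_gt0//; apply: (le_trans H).
by rewrite -[leRHS]mulrA ler_pM2l// mulrC ler_wpM2r ?expR_ge0// lerD2l.
Qed.

(* Bargmann's formula: the Gaussian mean value property recentered at [w]. *)
Lemma reproducing f b c M w : entire f -> growth M c f -> c < b -> 0 < b ->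
  cint (fun u => f u * cexp (b%:C * w * u^*) * (gauss b u)%:C) /\
  cI (fun u => f u * cexp (b%:C * w * u^*) * (gauss b u)%:C) = f w * (gmass b)%:C.
Proof.
move=> fe fM cb b0; set G := fun u => _.
have mG : cmeas G.
  apply: cmeasM; last by apply: cmeas_real; exact: rmeas_gauss.
  apply: cmeasM; first exact: entire_cmeas.
  apply: cmeas_cexp; apply: cmeasM; first exact: cmeas_cst.
  by apply: cmeasJ; exact: cmeas_id.
have Gi : cint G.
  apply: (cint_le mG (gintZ M (gint_absorb (b * cmod w) cb))) => u.
  rewrite cmodM [cmod (_ * cexp _)]cmodM cmod_cexp cmodR (ger0_norm (gauss_ge0 _ _)).
  rewrite mulrA ler_wpM2r ?gauss_ge0// expRD mulrA ler_pM ?cmod_ge0 ?expR_ge0//.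
  rewrite ler_expR (le_trans (ler_norm _))// (le_trans (normr_Re_le _))//.
  by rewrite !cmodM cmodJ cmodR ger0_norm// ltW.
split=> //; rewrite -(cI_translate w mG).
(* After the shift by [w], the kernel cancels the term in conj u of the expanded Gaussian; the mixed
   term that remains is holomorphic in [u]. *)
pose h u := f (u + w) * cexp (- b%:C * w^* * u).
have he : entire h by apply: entireM; [exact: entire_translate|exact: entire_explin].
have E u : G (u + w) = h u * (gauss b u)%:C.
  rewrite /G /h !gauss_cexp -[LHS]mulrA -[RHS]mulrA; congr (_ * _).
  rewrite -!cexpD; congr cexp.
  by rewrite rmorphD; ring.
have hi : cint (fun u => h u * (gauss b u)%:C).
  have := cint_translate w Gi; congr cint; apply/funext => u; exact: E.
have := gauss_mean he hi (gint_gauss b0).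
rewrite /h add0r mulr0 cexp0 mulr1 => <-; congr cI; apply/funext => u; exact: E.
Qed.
End Growth.

Section ComplexLimits.
Variable R : realType.
Implicit Types (f g : R[i] -> R[i]) (b c M : R) (z w u : R[i]).

Definition ccvg (x : nat -> R[i]) (l : R[i]) := forall e, 0 < e ->
  exists N, forall n, (N <= n)%N -> cmod (x n - l) < e.

Lemma ccvg_Re x l : ccvg x l -> complex.Re (x n) @[n --> \oo] --> complex.Re l.
Proof.
move=> H; apply/cvgrPdist_lt => e /H[N HN]; exists N => // n /HN; apply: le_lt_trans.
by rewrite distrC -ReN -ReD normr_Re_le.
Qed.

Lemma ccvg_Im x l : ccvg x l -> complex.Im (x n) @[n --> \oo] --> complex.Im l.
Proof.
move=> H; apply/cvgrPdist_lt => e /H[N HN]; exists N => // n /HN; apply: le_lt_trans.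
by rewrite distrC -ImN -ImD normr_Im_le.
Qed.

Lemma ccvg_ReIm x l : complex.Re (x n) @[n --> \oo] --> complex.Re l ->
  complex.Im (x n) @[n --> \oo] --> complex.Im l -> ccvg x l.
Proof.
move=> /cvgrPdist_lt hr /cvgrPdist_lt hi e e0; have e2 : 0 < e / 2 by rewrite divr_gt0.
have [N _ HN] := hr _ e2; have [N' _ HN'] := hi _ e2.
exists (maxn N N') => n; rewrite geq_max => /andP[/HN h1 /HN' h2].
apply: (le_lt_trans (cmod_le_ReIm _)); rewrite [e]splitr.
rewrite ReD ReN ImD ImN distrC [X in _ + X]distrC.
exact: ltrD h1 h2.
Qed.

Lemma ccvg_cmod x l : ccvg x l -> cmod (x n) @[n --> \oo] --> cmod l.
Proof.
move=> H; apply/cvgrPdist_lt => e /H[N HN]; exists N => // n /HN; apply: le_lt_trans.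
rewrite ler_norml; apply/andP; split.
  rewrite lerNl opprB lerBlDr (le_trans _ (cmodD _ _))//.
  by rewrite subrK.
by rewrite lerBlDr cmodBC (le_trans _ (cmodD _ _))// subrK.
Qed.

Lemma cmeas_lim (f_ : nat -> R[i] -> R[i]) f : (forall n, cmeas (f_ n)) ->
  (forall u, ccvg (f_ ^~ u) (f u)) -> cmeas f.
Proof.
move=> mf ff; split.
  apply: (measurable_fun_cvg (h := fun n (x : plane R) => complex.Re (f_ n (cx x)))).
    by move=> n; exact: (mf n).1.
  by move=> x _; exact: (ccvg_Re (ff (cx x))).
apply: (measurable_fun_cvg (h := fun n (x : plane R) => complex.Im (f_ n (cx x)))).
  by move=> n; exact: (mf n).2.
by move=> x _; exact: (ccvg_Im (ff (cx x))).
Qed.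

Lemma cI_dominated (f_ : nat -> R[i] -> R[i]) f (m : R[i] -> R) :
  (forall n, cmeas (f_ n)) -> (forall u, ccvg (f_ ^~ u) (f u)) ->
  gint m -> (forall n u, cmod (f_ n u) <= m u) -> ccvg (fun n => cI (f_ n)) (cI f).
Proof.
move=> mf ff mi fm; apply: ccvg_ReIm => /=.
  apply: (rI_dominated (f_ := fun n u => complex.Re (f_ n u)) _ _ mi _).2.
  - by move=> n; exact: (mf n).1.
  - by move=> u; exact: (ccvg_Re (ff u)).
  - by move=> n u; exact: le_trans (normr_Re_le _) (fm n u).
apply: (rI_dominated (f_ := fun n u => complex.Im (f_ n u)) _ _ mi _).2.
- by move=> n; exact: (mf n).2.
- by move=> u; exact: (ccvg_Im (ff u)).
- by move=> n u; exact: le_trans (normr_Im_le _) (fm n u).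
Qed.

Lemma ccvg_unique x l l' : ccvg x l -> ccvg x l' -> l = l'.
Proof.
move=> h h'; apply/eqP; rewrite -subr_eq0 -cmod_eq0 eq_le cmod_ge0 andbT.
apply/ler_addgt0Pl => e e0; rewrite addr0; have e2 : 0 < e / 2 by rewrite divr_gt0.
have [N HN] := h _ e2; have [N' HN'] := h' _ e2.
have := HN _ (leq_maxl N N'); have := HN' _ (leq_maxr N N').
set y := x _ => h1 h2; rewrite (_ : l - l' = (y - l') - (y - l)); last by ring.
by rewrite (le_trans (cmodB _ _))// [e]splitr lerD// ltW.
Qed.

End ComplexLimits.

(** * Taylor expansion obtained from the reproducing formula *)

Section Taylor.
Variable R : realType.
Implicit Types (f g : R[i] -> R[i]) (b c M : R) (z w u : R[i]).

(** The coefficient of w^k when exp (b w conj u) is expanded inside the reproducing formula. *)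
Definition tcoef b f k : R[i] := (b ^+ k / k`!%:R / gmass b)%:C *
  cI (fun u => f u * u^* ^+ k * (gauss b u)%:C).

Definition tbound b c r : R :=
  2 * rI (fun u : R[i] => expR (c * cmod u ^+ 2 + (2 * b * r) * cmod u) * gauss b u) / gmass b.

Lemma tbound_ge0 b c r : 0 < b -> 0 <= tbound b c r.
Proof.
move=> b0; rewrite divr_ge0 ?mulr_ge0 ?(ltW (gmass_gt0 b0))//.
by apply: rI_ge0 => u; rewrite mulr_ge0 ?expR_ge0 ?gauss_ge0.
Qed.

(** Subtracting [m] terms of the exponential series under the integral sign reduces the remainder of
    [f] to [cexp_tail]. The bound depends on [f] only through [M], which is what uniformity over a
    family requires. *)
Lemma taylor b c r f M m w : 0 < b -> c < b -> 0 < r -> entire f -> growth M c f ->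
  cmod w <= r ->
  cmod (f w - \sum_(k < m) tcoef b f k * w ^+ k) <= M * tbound b c r * (cmod w / r) ^+ m.
Proof.
move=> b0 cb r0 fe fM wr; have N0 := gmass_gt0 b0; have M0 := growth_ge0 fM.
have mf := entire_cmeas fe.
pose mono k u := f u * u^* ^+ k * (gauss b u)%:C.
have mmono k : cmeas (mono k).
  apply: cmeasM; last by apply: cmeas_real; exact: rmeas_gauss.
  apply: cmeasM => //; elim: k => [|k IH]; first exact: cmeas_cst.
  under eq_fun do rewrite exprS.
  by apply: cmeasM => //; apply: cmeasJ; exact: cmeas_id.
have imono k : cint (mono k).
  apply: (cint_le (mmono k) (gintZ (M * k`!%:R) (gint_absorb 1 cb))) => u.
  rewrite cmodM [cmod (f u * _)]cmodM cmodX cmodJ cmodR (ger0_norm (gauss_ge0 _ _)).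
  rewrite mulrA ler_wpM2r ?gauss_ge0// expRD mul1r.
  rewrite [leRHS](_ : _ = M * expR (c * cmod u ^+ 2) * (k`!%:R * expR (cmod u))); last by ring.
  apply: ler_pM; rewrite ?cmod_ge0 ?exprn_ge0 ?cmod_ge0//.
  by rewrite mulrC -ler_pdivrMr ?ltr0n ?fact_gt0// expR_ge_monomial// cmod_ge0.
pose H n u := f u * (cexp (b%:C * w * u^*) -
  \sum_(k < n) (k`!%:R^-1)%:C * (b%:C * w * u^*) ^+ k) * (gauss b u)%:C.
have key n : cint (H n) /\
    cI (H n) = (f w - \sum_(k < n) tcoef b f k * w ^+ k) * (gmass b)%:C.
  elim: n => [|n [IH1 IH2]].
    rewrite big_ord0 subr0 /H; under eq_fun do rewrite big_ord0 subr0.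
    exact: (reproducing w fe fM cb b0).
  pose t : R[i] := - (n`!%:R^-1 * b ^+ n)%:C * w ^+ n.
  have E : H n.+1 = (fun u => H n u + t * mono n u).
    apply/funext => u; rewrite /H big_ord_recr/= /t /mono !exprMn rmorphM rmorphXn.
    by move: (cexp _) (\sum_(i < n) _) => X Y; ring.
  rewrite E; split; first by apply: cintD => //; exact: cintZ.
  rewrite cID ?cIZ//; last exact: cintZ.
  rewrite IH2 big_ord_recr/= opprD addrA [RHS]mulrDl; congr (_ + _).
  rewrite /t /tcoef -/(mono n); set A := cI _.
  rewrite (_ : (b ^+ n / _ / _)%:C = (n`!%:R^-1 * b ^+ n)%:C / (gmass b)%:C); last first.
    by rewrite -fmorphV -rmorphM; congr (_%:C); ring.
  have N1 : (gmass b)%:C != 0 :> R[i] by rewrite -cmod_eq0 cmodR normr_eq0 gt_eqF.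
  move: ((gmass b)%:C) N1 ((n`!%:R^-1 * b ^+ n)%:C) => q q0 s.
  by field.
have [ci cE] := key m.
have hm u : cmod (H m u) <= (M * (cmod w / r) ^+ m) *
    (expR (c * cmod u ^+ 2 + (2 * b * r) * cmod u) * gauss b u).
  rewrite cmodM [cmod (f u * _)]cmodM cmodR (ger0_norm (gauss_ge0 _ _)).
  rewrite mulrA ler_wpM2r ?gauss_ge0// expRD.
  rewrite [leRHS](_ : _ = (M * expR (c * cmod u ^+ 2)) *
    ((cmod w / r) ^+ m * expR (2 * b * r * cmod u))); last by ring.
  apply: ler_pM; rewrite ?cmod_ge0//.
  apply: (le_trans (cexp_tail _ _)); rewrite !cmodM cmodJ cmodR (ger0_norm (ltW b0)).
  (* Once [(cmod w / r) ^+ m] is factored out of the tail, the monomial over the factorial and the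
     exponential are each at most [expR x]; hence the [2 * b * r] in [tbound]. *)
  set x := b * r * cmod u.
  have x0 : 0 <= x by rewrite !mulr_ge0 ?cmod_ge0 ?ltW.
  have wx : b * cmod w * cmod u = cmod w / r * x.
    by rewrite /x; field; rewrite gt_eqF.
  rewrite wx (_ : 2 * b * r * cmod u = x + x); last by rewrite /x; ring.
  have w1 : cmod w / r <= 1 by rewrite ler_pdivrMr// mul1r.
  have w0 : 0 <= cmod w / r by rewrite divr_ge0 ?cmod_ge0 ?ltW.
  rewrite exprMn expRD -!mulrA ler_wpM2l ?exprn_ge0// mulrA ler_pM ?expR_ge0//.
  - by rewrite divr_ge0 ?exprn_ge0.
  - exact: expR_ge_monomial.
  - by rewrite ler_expR mulrA ler_piMl.
have := cI_le ci (gintZ _ (gint_absorb (2 * b * r) cb)) hm.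
rewrite cE cmodM cmodR (ger0_norm (ltW N0)) rIZ; last exact: gint_absorb.
rewrite -ler_pdivlMr// => /le_trans; apply.
rewrite le_eqVlt; apply/orP; left; apply/eqP; rewrite /tbound.
by ring.
Qed.

Lemma tcoef0 b c f M : 0 < b -> c < b -> entire f -> growth M c f -> tcoef b f 0 = f 0.
Proof.
move=> b0 cb fe fM; have := @taylor b c 1 f M 1 0 b0 cb ltr01 fe fM.
rewrite cmod0 => /(_ ler01); rewrite mul0r expr0n/= mulr0 big_ord1 expr0 mulr1.
move=> h; apply/esym/eqP; rewrite -subr_eq0 -cmod_eq0 eq_le h; exact: cmod_ge0.
Qed.

(** A coefficient is the difference of two consecutive Taylor remainders at [w = 1]. *)
Lemma tcoef_le b c f M k : 0 < b -> c < b -> entire f -> growth M c f ->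
  cmod (tcoef b f k) <= 2 * (M * tbound b c 1).
Proof.
move=> b0 cb fe fM; have H n := @taylor b c 1 f M n 1 b0 cb ltr01 fe fM.
have {}H n := H n; rewrite cmod1 in H.
have h1 := H k (lexx _); have h2 := H k.+1 (lexx _).
move: h1 h2; rewrite !divr1 !expr1n !mulr1 big_ord_recr/= expr1n mulr1.
set X := f 1 - _ => h1.
rewrite opprD addrA -/X => h2.
rewrite (_ : tcoef b f k = X - (X - tcoef b f k)); last by ring.
by rewrite (le_trans (cmodB _ _))// mulr2n mulrDl mul1r lerD.
Qed.

End Taylor.

Section EntireFamilies.
Variable R : realType.
Implicit Types (f g : R[i] -> R[i]) (b c M : R) (z w u : R[i]).

Lemma growth_translate M c f w : 0 <= c -> growth M c f ->
  growth (M * expR (2 * c * cmod w ^+ 2)) (2 * c) (fun h => f (h + w)).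
Proof.
move=> c0 fM h; apply: (le_trans (fM _)).
rewrite -mulrA ler_wpM2l ?(growth_ge0 fM)// -expRD ler_expR.
have := ler_wpM2l c0 (cmodD_sqr_le h w); rewrite mulrDr.
lra.
Qed.

(* A uniform second order remainder gives differentiability under the integral. *)
Lemma entire_integral (F : R[i] -> R[i] -> R[i]) (m : R[i] -> R) c : 0 <= c ->
  (forall w, cmeas (F^~ w)) -> (forall u, entire (F u)) -> gint m ->
  (forall u, growth (m u) c (F u)) -> entire (fun w => cI (F^~ w)).
Proof.
move=> c0 mF eF mi Fm; apply/entireP => w.
pose b := 2 * c + 1; have b0 : 0 < b by rewrite ltr_wpDl// mulr_ge0.
have cb : 2 * c < b by rewrite ltrDl.
pose E := expR (2 * c * cmod w ^+ 2); have E0 : 0 <= E by exact: expR_ge0.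
pose G u h := F u (h + w).
have Ge u : entire (G u) by exact: entire_translate.
have Gm u : growth (m u * E) (2 * c) (G u) by exact: growth_translate.
pose a u := tcoef b (G u) 1; pose Q := tbound b (2 * c) 1.
have Q0 : 0 <= Q by exact: tbound_ge0.
have m0 u : 0 <= m u by exact: growth_ge0 (Fm u).
have T u h : cmod h <= 1 -> cmod (G u h - G u 0 - a u * h) <= m u * E * Q * cmod h ^+ 2.
  move=> h1; have := taylor 2 b0 cb ltr01 (Ge u) (Gm u) h1.
  rewrite !big_ord_recl big_ord0/= expr0 expr1 mulr1 addr0 divr1.
  by rewrite (tcoef0 b0 cb (Ge u) (Gm u)) opprD addrA.
have mG h : cmeas (fun u => G u h) by exact: mF.
(* The derivative in the parameter is a pointwise limit of difference quotients with step 1 / (n +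
   1), hence measurable; the second-order bound [T] gives the rate. *)
have ma : cmeas a.
  apply: (cmeas_lim (f_ := fun n u => (n.+1%:R) * (G u (n.+1%:R^-1)%:C - G u 0))).
    move=> n; apply: cmeasM; first exact: cmeas_cst.
    by apply: cmeasB.
  move=> u e e0; pose k := m u * E * Q; have k0 : 0 <= k := mulr_ge0 (mulr_ge0 (m0 u) E0) Q0.
  have [N HN] : exists N : nat, k / e < N%:R.
    exists (Num.truncn (k / e)).+1; exact: truncnS_gt.
  exists N => n Nn.
  have n0 : 0 < n.+1%:R :> R by rewrite ltr0n.
  have h1 : cmod ((n.+1%:R^-1)%:C : R[i]) <= 1.
    by rewrite cmodR ger0_norm ?invr_ge0 ?(ltW n0)// invf_le1// ler1n.
  have := T u _ h1; rewrite cmodR ger0_norm ?invr_ge0 ?(ltW n0)// -/k => H.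
  have nC : (n.+1%:R : R[i]) != 0 by rewrite pnatr_eq0.
  have iC : ((n.+1%:R^-1)%:C : R[i]) = n.+1%:R^-1 by rewrite fmorphV rmorph_nat.
  rewrite (_ : _ - a u = n.+1%:R * (G u (n.+1%:R^-1)%:C - G u 0 - a u * (n.+1%:R^-1)%:C)); last first.
    by rewrite iC; field.
  rewrite cmodM -(rmorph_nat (real_complex R)) cmodR (ger0_norm (ltW n0)).
  apply: (le_lt_trans (ler_wpM2l (ltW n0) H)).
  rewrite (_ : _ * (k * _) = k / n.+1%:R); last by field; rewrite gt_eqF.
  rewrite ltr_pdivrMr// mulrC -ltr_pdivrMr//; apply: (lt_le_trans HN).
  by rewrite ler_nat (leq_trans Nn).
have ia : cint a.
  apply: (cint_le ma (gintZ (2 * (E * Q)) mi)) => u.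
  have := tcoef_le 1 b0 cb (Ge u) (Gm u); rewrite -/(a u) -/Q.
  by rewrite (_ : 2 * (m u * E * Q) = 2 * (E * Q) * m u)//; ring.
have iF x : cint (fun u => F u x).
  apply: (cint_le (mF x) (gintZ (expR (c * cmod x ^+ 2)) mi)) => u.
  by rewrite mulrC; exact: Fm.
exists (cI a) => e e0.
pose K := 2 * (E * Q * rI m); have K0 : 0 <= K := mulr_ge0 (ler0n R 2) (mulr_ge0 (mulr_ge0 E0 Q0) (rI_ge0 m0)).
have K1 : 0 < 1 + K by rewrite ltr_pwDl.
exists (Num.min 1 (e / (1 + K))); first by rewrite lt_min ltr01 divr_gt0.
move=> h; rewrite lt_min => /andP[h1 he].
have D : cint (fun u => F u (w + h) - F u w - a u * h).
  have -> : (fun u => F u (w + h) - F u w - a u * h) =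
    (fun u => F u (w + h) + (-1) * F u w + (- h) * a u) by apply/funext => u; ring.
  by apply: cintD; [apply: cintD => //; exact: cintZ|exact: cintZ].
have -> : cI (F^~ (w + h)) - cI (F^~ w) - cI a * h =
    cI (fun u => F u (w + h) - F u w - a u * h).
  have -> : (fun u => F u (w + h) - F u w - a u * h) =
    (fun u => F u (w + h) + (-1) * F u w + (- h) * a u) by apply/funext => u; ring.
  have i1 := cintZ (-1) (iF w); have i2 := cintZ (- h) ia.
  rewrite (cID (cintD (iF (w + h)) i1) i2) (cID (iF (w + h)) i1) (cIZ _ (iF w)) (cIZ _ ia).
  by ring.
have := cI_le D (gintZ (E * Q * cmod h ^+ 2) mi).
have B u : cmod (F u (w + h) - F u w - a u * h) <= E * Q * cmod h ^+ 2 * m u.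
  have := T u h (ltW h1); rewrite /G add0r [h + w]addrC => /le_trans; apply.
  by rewrite le_eqVlt; apply/orP; left; apply/eqP; ring.
move=> /(_ B) /le_trans; apply; rewrite rIZ//.
rewrite (_ : 2 * _ = K * cmod h * cmod h); last by rewrite /K; ring.
rewrite ler_wpM2r ?cmod_ge0//; apply: (le_trans (ler_wpM2l K0 (ltW he))).
by rewrite mulrCA ler_piMr ?(ltW e0)// ler_pdivrMr// mul1r lerDr.
Qed.

(** Holomorphy in [w] comes from the exponential alone, so this applies to a [g] known only to be
    measurable and of Gaussian growth, such as the limit in [entire_lim]. *)
Lemma entire_bargmann g M b c : cmeas g -> growth M c g -> c < b -> 0 < b ->
  entire (fun w => cI (fun u => g u * cexp (b%:C * w * u^*) * (gauss b u)%:C)).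
Proof.
move=> mg gM cb b0; have bc : 0 < b - c by rewrite subr_gt0.
pose d := (b - c) / 2; have d0 : 0 < d by rewrite divr_gt0.
pose F u w := g u * cexp (b%:C * w * u^*) * (gauss b u)%:C.
have M0 := growth_ge0 gM.
apply: (@entire_integral F (fun u => M * gauss d u) (b ^+ 2 / (2 * (b - c)))).
- by rewrite divr_ge0 ?sqr_ge0// mulr_ge0// ltW.
- move=> w; apply: cmeasM; last by apply: cmeas_real; exact: rmeas_gauss.
  apply: cmeasM => //; apply: cmeas_cexp; apply: cmeasM; first exact: cmeas_cst.
  by apply: cmeasJ; exact: cmeas_id.
- move=> u; have -> : F u = (fun w => g u * (gauss b u)%:C * cexp (b%:C * u^* * w)).
    by apply/funext => w; rewrite /F mulrAC; congr (_ * cexp _); ring.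
  by apply: entireZ; exact: entire_explin.
- by apply: gintZ; exact: gint_gauss.
move=> u w; rewrite /F cmodM [cmod (g u * _)]cmodM cmod_cexp cmodR (ger0_norm (gauss_ge0 _ _)).
have h := gauss_absorb (b * cmod w) u cb.
have e1 : expR (complex.Re (b%:C * w * u^*)) <= expR (b * cmod w * cmod u).
  rewrite ler_expR (le_trans (ler_norm _))// (le_trans (normr_Re_le _))//.
  by rewrite !cmodM cmodJ cmodR ger0_norm// ltW.
apply: (@le_trans _ _ (M * (expR (c * cmod u ^+ 2 + b * cmod w * cmod u) * gauss b u))).
  rewrite mulrA ler_wpM2r ?gauss_ge0// expRD mulrA.
  by apply: ler_pM; rewrite ?cmod_ge0 ?expR_ge0//; exact: gM.
apply: (le_trans (ler_wpM2l M0 h)).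
rewrite -[leRHS]mulrA ler_wpM2l// mulrC ler_wpM2l ?gauss_ge0// ler_expR.
by rewrite exprMn mulrAC.
Qed.

Lemma growth_lim (f_ : nat -> R[i] -> R[i]) f M c : (forall n, growth M c (f_ n)) ->
  (forall u, ccvg (f_^~ u) (f u)) -> growth M c f.
Proof.
move=> fM ff u; have h := ccvg_cmod (ff u).
rewrite -(cvg_lim (@Rhausdorff R) h); apply: limr_le; first by apply/cvg_ex; eexists; exact: h.
by apply: nearW => n; exact: fM.
Qed.

(** Dominated convergence carries the reproducing formula over to the limit, and the right-hand side
    of that formula is entire by [entire_bargmann]. *)
Lemma entire_lim (f_ : nat -> R[i] -> R[i]) f M c : 0 <= c ->
  (forall n, entire (f_ n)) -> (forall n, growth M c (f_ n)) ->
  (forall u, ccvg (f_^~ u) (f u)) -> entire f.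
Proof.
move=> c0 fe fM ff; have fm := growth_lim fM ff.
have mf := cmeas_lim (fun n => entire_cmeas (fe n)) ff.
pose b := c + 1; have b0 : 0 < b by rewrite ltr_wpDl.
have cb : c < b by rewrite ltrDl.
have M0 := growth_ge0 fm.
have E w : f w = (gmass b)%:C^-1 *
    cI (fun u => f u * cexp (b%:C * w * u^*) * (gauss b u)%:C).
  have N1 : (gmass b)%:C != 0 :> R[i].
    by rewrite -cmod_eq0 cmodR normr_eq0 gt_eqF// gmass_gt0.
  apply: (mulfI N1); rewrite mulVKf//.
  apply: (ccvg_unique (x := fun n => (gmass b)%:C * f_ n w)).
    move=> e e0; have N0 : 0 < gmass b by exact: gmass_gt0.
    have [N HN] := ff w _ (divr_gt0 e0 N0); exists N => n /HN.
    by rewrite -mulrBr cmodM cmodR (ger0_norm (ltW N0)) ltr_pdivlMr// mulrC.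
  have : ccvg (fun n => cI (fun u => f_ n u * cexp (b%:C * w * u^*) * (gauss b u)%:C))
      (cI (fun u => f u * cexp (b%:C * w * u^*) * (gauss b u)%:C)).
    apply: (cI_dominated _ _ (gintZ M (gint_absorb (b * cmod w) cb))).
    - by move=> n; have [[]] := reproducing w (fe n) (fM n) cb b0.
    - move=> u e e0; set q := cexp _; set r := (gauss b u)%:C.
      have q0 : 0 < 1 + cmod (q * r) by rewrite ltr_pwDl ?cmod_ge0.
      have [N HN] := ff u _ (divr_gt0 e0 q0); exists N => n /HN.
      rewrite -mulrBl -mulrBl -mulrA [cmod (_ * (q * r))]cmodM ltr_pdivlMr// => h.
      by apply: le_lt_trans h; rewrite ler_wpM2l ?cmod_ge0// lerDr.
    - move=> n u; rewrite cmodM [cmod (f_ n u * _)]cmodM cmod_cexp cmodR (ger0_norm (gauss_ge0 _ _)).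
      rewrite mulrA ler_wpM2r ?gauss_ge0// expRD mulrA.
      apply: ler_pM; rewrite ?cmod_ge0 ?expR_ge0//; first exact: fM.
      rewrite ler_expR (le_trans (ler_norm _))// (le_trans (normr_Re_le _))//.
      by rewrite !cmodM cmodJ cmodR ger0_norm// ltW.
  congr ccvg; apply/funext => n.
  by rewrite (reproducing w (fe n) (fM n) cb b0).2 mulrC.
rewrite (funext E); apply: entireZ; exact: (entire_bargmann mf fm cb b0).
Qed.

(* The Taylor coefficients tend to [0] one after the other. *)
Lemma vitali (f_ : nat -> R[i] -> R[i]) M c : 0 <= c ->
  (forall n, entire (f_ n)) -> (forall n, growth M c (f_ n)) ->
  (forall t : R, 0 < t -> ccvg (fun n => f_ n t%:C) 0) ->
  forall w, ccvg (f_^~ w) 0.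
Proof.
move=> c0 fe fM ff; pose b := c + 1; have b0 : 0 < b by rewrite ltr_wpDl.
have cb : c < b by rewrite ltrDl.
have M0 := growth_ge0 (fM 0%N).
pose a n k := tcoef b (f_ n) k.
have sum0 m w : (forall k, (k < m)%N -> ccvg (a^~ k) 0) ->
    ccvg (fun n => \sum_(k < m) a n k * w ^+ k) 0.
  elim: m => [|m IH] H e e0; first by exists 0%N => n _; rewrite big_ord0 subr0 cmod0.
  have e2 : 0 < e / 2 by rewrite divr_gt0.
  have [N HN] := IH (fun k km => H k (ltnW km)) _ e2.
  have W : 0 < 1 + cmod (w ^+ m) by rewrite ltr_pwDl ?cmod_ge0.
  have [N' HN'] := H m (ltnSn m) _ (divr_gt0 e2 W).
  exists (maxn N N') => n; rewrite geq_max => /andP[/HN h1 /HN' h2].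
  rewrite big_ord_recr/= subr0 (le_lt_trans (cmodD _ _))// [e]splitr.
  rewrite subr0 in h1; rewrite subr0 ltr_pdivlMr// in h2.
  apply: ltrD => //; rewrite cmodM; apply: le_lt_trans h2.
  by rewrite ler_wpM2l ?cmod_ge0// lerDr.
have acvg k : ccvg (a^~ k) 0.
  elim/ltn_ind: k => k IH e e0.
  pose K := M * tbound b c 1; have K0 : 0 <= K by rewrite mulr_ge0// tbound_ge0.
  (* After division by [t ^+ k] the Taylor remainder of order k + 1 has size [K * t], uniformly in
     [n]: first [t] is fixed, then [n] is taken large. *)
  pose t := Num.min 1 (e / 2 / (1 + K)).
  have K1 : 0 < 1 + K by rewrite ltr_pwDl.
  have t0 : 0 < t by rewrite lt_min ltr01 !divr_gt0.
  have t1 : t <= 1 by rewrite ge_min lexx.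
  have e2 : 0 < e / 2 by rewrite divr_gt0.
  have d0 : 0 < t ^+ k * (e / 2) / 2 by rewrite divr_gt0 ?mulr_gt0 ?exprn_gt0.
  have [N HN] := ff t t0 _ d0; have [N' HN'] := sum0 k t%:C IH _ d0.
  exists (maxn N N') => n; rewrite geq_max => /andP[/HN h1 /HN' h2].
  rewrite !subr0 in h1 h2 *.
  have ct : cmod (t%:C : R[i]) = t by rewrite cmodR ger0_norm// ltW.
  have := @taylor R b c 1 (f_ n) M k.+1 t%:C b0 cb ltr01 (fe n) (fM n).
  rewrite ct divr1 => /(_ t1); rewrite big_ord_recr/= -/K -/(a n k) => h3.
  have : cmod (a n k * t%:C ^+ k) < t ^+ k * e.
    set S := \sum_(i < k) _ in h2 h3.
    rewrite (_ : a n k * _ = f_ n t%:C - S - (f_ n t%:C - (S + a n k * t%:C ^+ k))); last by ring.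
    apply: (le_lt_trans (cmodB _ _)).
    rewrite [e]splitr mulrDr; apply: ltr_leD.
      rewrite (le_lt_trans (cmodB _ _))// [t ^+ k * _]splitr; exact: ltrD.
    apply: (le_trans h3); rewrite exprSr mulrCA ler_wpM2l ?exprn_ge0 ?(ltW t0)//.
    apply: (@le_trans _ _ (K * (e / 2 / (1 + K)))).
      by rewrite ler_wpM2l// ge_min lexx orbT.
    by rewrite mulrCA ler_piMr ?(ltW e2)// ler_pdivrMr// mul1r lerDr.
  by rewrite cmodM cmodX ct mulrC ltr_pM2l// exprn_gt0.
(* At least twice [cmod w], so the remainders decay like powers of 1 / 2. *)
move=> w e e0; pose r := 2 * (1 + cmod w).
have r0 : 0 < r by rewrite mulr_gt0// ltr_pwDl// cmod_ge0.
have wr : cmod w <= r by rewrite /r; have := cmod_ge0 w; lra.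
have wr2 : cmod w / r <= 2^-1.
  by rewrite ler_pdivrMr// /r mulrA mulVf ?mul1r ?lerDr// pnatr_eq0.
pose K := M * tbound b c r; have K0 : 0 <= K by rewrite mulr_ge0// tbound_ge0.
have e2 : 0 < e / 2 by rewrite divr_gt0.
have [m Hm] : exists m, K * 2^-1 ^+ m < e / 2.
  have : (K * 2^-1 ^+ n) @[n --> \oo] --> (0 : R).
    rewrite -(mulr0 K); apply: cvgM; first exact: cvg_cst.
    by apply: cvg_expr; rewrite ger0_norm ?invr_ge0// invf_lt1// ltr1n.
  move/cvgrPdist_lt => /(_ _ e2) [N _ /(_ N (leqnn N))] /=.
  rewrite sub0r normrN => h; exists N; exact: le_lt_trans (ler_norm _) h.
have [N HN] := sum0 m w (fun k _ => acvg k) _ e2.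
exists N => n /HN; rewrite !subr0 => h1.
have := @taylor R b c r (f_ n) M m w b0 cb r0 (fe n) (fM n) wr; rewrite -/K => h2.
set S := \sum_(k < m) _ in h1 h2.
rewrite (_ : f_ n w = (f_ n w - S) + S); last by ring.
apply: (le_lt_trans (cmodD _ _)); rewrite [e]splitr; apply: ler_ltD => //.
apply: (le_trans h2); apply: le_trans (ltW Hm); rewrite ler_wpM2l//.
by rewrite lerXn2r ?nnegrE ?invr_ge0 ?divr_ge0 ?cmod_ge0 ?(ltW r0).
Qed.

End EntireFamilies.

(** * Extraction of convergent subsequences *)

Section DiagonalExtraction.
Variable R : realType.
Import ArrowAsProduct.

(** Tychonoff's theorem on the product of the segments [- B, B] provides a cluster point [p];
    countability of the index set turns it into the limit of a subsequence. *)
Lemma diagonal_extraction (I : countType) (x : nat -> I -> R) (B : R) :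
  (forall n k, `|x n k| <= B) ->
  exists2 phi : nat -> nat, {homo phi : m n / (m < n)%N} &
  forall k, exists l : R, x (phi n) k @[n --> \oo] --> l.
Proof.
move=> xB.
have cA := @tychonoff I (fun=> R) (fun=> `[- B, B]%classic) (fun=> @segment_compact R (- B) B).
have [|p [_ clp]] := cA (x @ \oo) _.
  by exists 0%N => // n _ k /=; rewrite in_itv/= -ler_norml.
(* A basic neighbourhood of [p] controls the finitely many coordinates of code below [j], and the
   sequence meets it past every [N]. *)
have step N j : exists n, (N <= n)%N /\
    forall k, (pickle k < j)%N -> `|x n k - p k| < j.+1%:R^-1.
  pose e : R := j.+1%:R^-1; have e0 : 0 < e by rewrite invr_gt0 ltr0n.
  have nV i : \forall q \near (p : I -> R), forall k, (pickle k < i)%N -> `|q k - p k| < e.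
    elim: i => [|i IH]; first by apply: (@filterS _ _ (nbhs_filter (p : I -> R)) setT); [move=> q _ k; rewrite ltn0|exact: filterT].
    have [[k0 k0i]|nok] := pselect (exists k : I, pickle k = i); last first.
      apply: filterS IH => q h k; rewrite ltnS leq_eqVlt => /predU1P[ki|]; last exact: h.
      by case: nok; exists k.
    have /cvgrPdist_lt /(_ e e0) := @proj_continuous I (fun=> R) k0 p.
    apply: filterS2 IH => q h1 h2 k; rewrite ltnS leq_eqVlt => /predU1P[ki|]; last exact: h1.
    have -> : k = k0 by apply: (pcan_inj pickleK); rewrite ki k0i.
    by rewrite distrC.
  have nN : (x @ \oo) [set x n | n in [set n | (N <= n)%N]].
    by exists N => // n Nn; exists n.
  have [_ [[n /= Nn <-] Vn]] := clp _ _ nN (nV j).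
  by exists n.
have [G HG] := choice (fun Nj : nat * nat => step Nj.1 Nj.2).
(* The first argument of [G] forces strict growth; the second tightens the tolerance and enlarges
   the set of controlled coordinates. *)
pose phi := fix phi j := if j is j'.+1 then G ((phi j').+1, j) else G (0%N, 0%N).
have phiS j : (phi j < phi j.+1)%N by have [] := HG ((phi j).+1, j.+1).
have phij j k : (pickle k < j)%N -> `|x (phi j) k - p k| < j.+1%:R^-1.
  case: j => [//|j] kj; have [_ /(_ k)] := HG ((phi j).+1, j.+1); exact.
exists phi; first exact: homo_ltn ltn_trans phiS.
move=> k; exists (p k); apply/cvgrPdist_lt => e e0.
have /cvgrPdist_lt /(_ e e0) [N _ HN] := @cvg_harmonic R.
exists (maxn N (pickle k).+1); first by [].
move=> n /=; rewrite geq_max => /andP[Nn kn].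
rewrite distrC; apply: lt_trans (phij _ _ kn) _.
by have := HN n Nn; rewrite /= sub0r normrN ger0_norm.
Qed.

End DiagonalExtraction.

Section Montel.
Variable R : realType.

Lemma cauchy_ccvg (x : nat -> R[i]) : (forall e : R, 0 < e -> exists N, forall n m,
  (N <= n)%N -> (N <= m)%N -> cmod (x n - x m) < e) -> exists l, ccvg x l.
Proof.
move=> H.
have main (pr : R[i] -> R) : (forall z w, `|pr z - pr w| <= cmod (z - w)) ->
    exists l : R, pr (x n) @[n --> \oo] --> l.
  move=> prle; have : cauchy (pr (x n) @[n --> \oo]).
    apply: cauchy_exP => e e0; have [N HN] := H e e0.
    exists (pr (x N)); exists N => // n Nn /=.
    by rewrite /ball/=; apply: le_lt_trans (prle _ _) (HN _ _ _ Nn).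
  by move=> /cauchy_cvgP /cvg_ex.
have [|a ha] := main (@complex.Re R).
  by move=> z w; rewrite -ReN -ReD normr_Re_le.
have [|b hb] := main (@complex.Im R).
  by move=> z w; rewrite -ImN -ImD normr_Im_le.
by exists (a +i* b); exact: ccvg_ReIm.
Qed.

(** Only countably many bounded numbers have to converge, the real and imaginary parts of the Taylor
    coefficients. The tails are small uniformly over the family, so pointwise convergence follows
    everywhere. *)
Lemma montel (f_ : nat -> R[i] -> R[i]) (M c : R) : 0 <= c ->
  (forall n, entire (f_ n)) -> (forall n, growth M c (f_ n)) ->
  exists2 phi : nat -> nat, {homo phi : m n / (m < n)%N} &
  exists g, [/\ entire g, growth M c g & forall w, ccvg (fun n => f_ (phi n) w) (g w)].
Proof.
move=> c0 fe fM; pose b := c + 1; have b0 : 0 < b by rewrite ltr_wpDl.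
have cb : c < b by rewrite ltrDl.
have M0 := growth_ge0 (fM 0%N).
pose a n k := tcoef b (f_ n) k.
pose y n (k : nat * bool) := if k.2 then complex.Re (a n k.1) else complex.Im (a n k.1).
have [n [k s]|phi phiS ycvg] := @diagonal_extraction R (nat * bool)%type y (2 * (M * tbound b c 1)).
  apply: le_trans (tcoef_le k b0 cb (fe n) (fM n)).
  by case: s; [exact: (normr_Re_le (tcoef b (f_ n) k))|exact: (normr_Im_le (tcoef b (f_ n) k))].
exists phi => //.
have acvg k : exists l, ccvg (fun n => a (phi n) k) l.
  have [u hu] := ycvg (k, true); have [v hv] := ycvg (k, false).
  by exists (u +i* v); exact: ccvg_ReIm.
have sum_cauchy m w e : 0 < e -> exists N, forall i j, (N <= i)%N -> (N <= j)%N ->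
    cmod (\sum_(k < m) a (phi i) k * w ^+ k - \sum_(k < m) a (phi j) k * w ^+ k) < e.
  elim: m e => [|m IH] e e0; first by exists 0%N => i j _ _; rewrite !big_ord0 subrr cmod0.
  have e2 : 0 < e / 2 by rewrite divr_gt0.
  have [N HN] := IH _ e2; have [l Hl] := acvg m.
  have W : 0 < 1 + cmod (w ^+ m) by rewrite ltr_pwDl ?cmod_ge0.
  have [N' HN'] := Hl _ (divr_gt0 (divr_gt0 e2 (ltr0Sn R 1)) W).
  exists (maxn N N') => i j; rewrite !geq_max => /andP[/HN hi1 /HN' hi2] /andP[/hi1 h1 /HN' hj2].
  rewrite !big_ord_recr/=; set A := \sum_(k < m) _ in h1 *; set B := \sum_(k < m) _ in h1 *.
  rewrite (_ : _ - _ = (A - B) + (a (phi i) m - l - (a (phi j) m - l)) * w ^+ m); last by ring.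
  apply: (le_lt_trans (cmodD _ _)); rewrite [e]splitr; apply: ltrD => //.
  rewrite cmodM; have h : cmod (a (phi i) m - l - (a (phi j) m - l)) < e / 2 / (1 + cmod (w ^+ m)).
    apply: (le_lt_trans (cmodB _ _)).
    by rewrite [e / 2]splitr [X in _ < X]mulrDl; exact: ltrD.
  move: h; rewrite ltr_pdivlMr// => h; apply: le_lt_trans h.
  by rewrite ler_wpM2l ?cmod_ge0// lerDr.
have fcauchy w : exists l, ccvg (fun n => f_ (phi n) w) l.
  apply: cauchy_ccvg => e e0; pose r := 2 * (1 + cmod w).
  have r0 : 0 < r by rewrite mulr_gt0// ltr_pwDl// cmod_ge0.
  have wr : cmod w <= r by rewrite /r; have := cmod_ge0 w; lra.
  have wr2 : cmod w / r <= 2^-1.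
    by rewrite ler_pdivrMr// /r mulrA mulVf ?mul1r ?lerDr// pnatr_eq0.
  pose K := M * tbound b c r; have K0 : 0 <= K by rewrite mulr_ge0// tbound_ge0.
  have e2 : 0 < e / 2 by rewrite divr_gt0.
  have e4 : 0 < e / 2 / 2 by rewrite divr_gt0.
  have [m Hm] : exists m, K * 2^-1 ^+ m < e / 2 / 2.
    have : (K * 2^-1 ^+ n) @[n --> \oo] --> (0 : R).
      rewrite -(mulr0 K); apply: cvgM; first exact: cvg_cst.
      by apply: cvg_expr; rewrite ger0_norm ?invr_ge0// invf_lt1// ltr1n.
    move/cvgrPdist_lt => /(_ _ e4) [N _ /(_ N (leqnn N))] /=.
    rewrite sub0r normrN => h; exists N; exact: le_lt_trans (ler_norm _) h.
  have [N HN] := sum_cauchy m w _ e2; exists N => i j Ni Nj.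
  have tail n : cmod (f_ n w - \sum_(k < m) a n k * w ^+ k) < e / 2 / 2.
    apply: le_lt_trans Hm; apply: (le_trans (taylor m b0 cb r0 (fe n) (fM n) wr)).
    rewrite ler_wpM2l// lerXn2r ?nnegrE ?invr_ge0//.
    by rewrite divr_ge0 ?cmod_ge0 ?(ltW r0).
  have h := HN _ _ Ni Nj; have h1 := tail (phi i); have h2 := tail (phi j).
  set A := \sum_(k < m) _ in h h1; set B := \sum_(k < m) _ in h h2.
  rewrite (_ : _ - _ = (A - B) + ((f_ (phi i) w - A) - (f_ (phi j) w - B))); last by ring.
  apply: (le_lt_trans (cmodD _ _)); rewrite [e]splitr; apply: ltrD => //.
  by apply: (le_lt_trans (cmodB _ _)); rewrite [e / 2]splitr; exact: ltrD.
have [g gP] := choice fcauchy; exists g; split => //.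
  exact: (entire_lim c0 (fun n => fe (phi n)) (fun n => fM (phi n))).
exact: (growth_lim (fun n => fM (phi n))).
Qed.

End Montel.

(** * The Fock space *)

Section GaussMeasure.
Variables (R : realType) (alpha : {posnum R}).
Local Notation leb2 := (@plane_measure R).
Local Notation dens := (gauss_density alpha).
Import HBNNSimple.

(** True for indicators by definition of the measure, hence for simple functions, hence for limits
    of increasing simple functions. *)
Lemma integral_gauss_measure (f : R * R -> \bar R) : measurable_fun setT f ->
  (forall x, 0 <= f x)%E ->
  (\int[gauss_measure alpha]_x f x = \int[leb2]_x (f x * (dens x)%:E))%E.
Proof.
move=> mf f0; pose h := nnsfun_approx measurableT mf.
have md : measurable_fun setT (fun x : plane R => (dens x)%:E).
  by apply/measurable_EFinP; exact: measurable_gauss_density.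
have d0 x : (0 <= (dens x)%:E)%E by rewrite lee_fin gauss_density_ge0.
have mh n : measurable_fun setT (fun x : plane R => (h n x)%:E).
  have H : measurable_fun setT (h n) by [].
  by apply/measurable_EFinP; exact: H.
have hnd x a b : (a <= b)%N -> h a x <= h b x.
  by move=> ab; exact/lefP/nd_nnsfun_approx.
have -> : (\int[gauss_measure alpha]_x f x =
    lim (\int[gauss_measure alpha]_x (h n x)%:E @[n --> \oo]))%E.
  have fE x : f x = (lim ((h n x)%:E @[n --> \oo]))%E.
    by apply/esym/cvg_lim => //; apply: cvg_nnsfun_approx.
  under eq_integral => x _ do rewrite fE.
  apply: monotone_convergence => //.
  - by move=> n x _; rewrite lee_fin.
  - by move=> x _ a b ab; rewrite lee_fin; exact: hnd.
have -> : (\int[leb2]_x (f x * (dens x)%:E) =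
    lim (\int[leb2]_x ((h n x)%:E * (dens x)%:E) @[n --> \oo]))%E.
  have fg x : (f x * (dens x)%:E = lim ((h n x)%:E * (dens x)%:E @[n --> \oo]))%E.
    apply/esym/cvg_lim => //; apply: cvgeZr => //.
    by apply: cvg_nnsfun_approx.
  under eq_integral => x _ do rewrite fg.
  apply: monotone_convergence => [//| | |].
  - by move=> n; apply: emeasurable_funM.
  - by move=> n x _; apply: mule_ge0 => //; rewrite lee_fin.
  - move=> x _ a b ab /=; apply: lee_wpmul2r => //.
    by rewrite lee_fin; exact: hnd.
apply: (congr1 (fun v : nat -> \bar R => limn v)); apply/funext => n.
have mpre r : measurable (h n @^-1` [set r]) by [].
have indich r : measurable_fun setT (fun x : plane R => (r * \1_(h n @^-1` [set r]) x)%:E).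
  by apply/measurable_EFinP; apply: measurable_funM => //; exact: measurable_indic (mpre r).
transitivity (\int[gauss_measure alpha]_x
   (\sum_(y \in range (h n)) (y * \1_(h n @^-1` [set y]) x)%:E))%E.
  by apply: eq_integral => t tE; rewrite fimfunE -fsumEFin.
rewrite ge0_integral_fsum//; last first.
- by move=> m y Ey; exact: nnfun_muleindic_ge0.
transitivity (\int[leb2]_x (\sum_(y \in range (h n))
    (y * \1_(h n @^-1` [set y]) x)%:E * (dens x)%:E))%E; last first.
  apply: eq_integral => x xE.
  rewrite -ge0_mule_fsuml => [|y]; last exact: nnfun_muleindic_ge0.
  by rewrite [h n x]fimfunE -fsumEFin.
rewrite ge0_integral_fsum//; last 2 first.
- by move=> y; apply: emeasurable_funM => //; exact: indich.
- by move=> m y Ey; rewrite mule_ge0// nnfun_muleindic_ge0.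
apply: eq_fsbigr => r rhn.
under eq_integral do rewrite EFinM.
rewrite integralZl_indic_nnsfun => //.
under [RHS]eq_integral do rewrite EFinM -muleA.
have r0 : (0 <= r%:E)%E by move: rhn; rewrite inE => -[t _ <-]; rewrite lee_fin.
rewrite [RHS]ge0_integralZl//; last 2 first.
- apply: emeasurable_funM => //; apply/measurable_EFinP; exact: measurable_indic (mpre r).
- by move=> t Et; apply: mule_ge0 => //; rewrite lee_fin.
congr (_ * _)%E; rewrite integral_indic// setIT.
rewrite [LHS]integral_mkcond; apply: eq_integral => x _.
by rewrite patchE indicE; case: ifP => _; rewrite ?mul1e ?mul0e.
Qed.

End GaussMeasure.

Section Weighted.
Variables (R : realType) (alpha : {posnum R}).
Local Notation a := (alpha%:num).
Local Notation leb2 := (@plane_measure R).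
Implicit Types f g : R[i] -> R[i].

Definition wt (u : R[i]) : R := a / pi * gauss a u.

Lemma wt_gt0 u : 0 < wt u.
Proof. by rewrite mulr_gt0 ?gauss_gt0// divr_gt0 ?pi_gt0. Qed.

Lemma wt_ge0 u : 0 <= wt u.
Proof. exact: ltW (wt_gt0 u). Qed.

Lemma rmeas_wt : rmeas wt.
Proof. by apply: rmeasM; [exact: rmeas_cst|exact: rmeas_gauss]. Qed.

Lemma integral_wt (h : R[i] -> R) : rmeas h -> (forall z, 0 <= h z) ->
  (\int[gauss_measure alpha]_x (h (x.1 +i* x.2))%:E =
   \int[leb2]_x (h (cx x) * wt (cx x))%:E)%E.
Proof.
move=> mh h0; have mh' : measurable_fun setT (fun x : plane R => (h (cx x))%:E).
  by apply/measurable_EFinP.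
apply: etrans (integral_gauss_measure alpha mh' _) _; first by move=> x; rewrite lee_fin.
apply: eq_integral => x _; rewrite -EFinM; congr ((_ * _)%:E).
by rewrite /gauss_density /wt /gauss cmod_sqr.
Qed.

Lemma fnorm_powR p f : cmeas f -> p != 0 ->
  (fnorm alpha p f `^ p = \int[leb2]_x (cmod (f (cx x)) `^ p * wt (cx x))%:E)%E.
Proof.
move=> mf p0; rewrite /fnorm poweR_Lnorm//.
under eq_integral => x _ do rewrite gee0_abs ?lee_fin ?cmod_ge0// poweR_EFin.
apply: (@integral_wt (fun z => cmod (f z) `^ p)) => [|z]; last exact: powR_ge0.
have : rmeas (fun z => cmod (f z)) by exact: cmeas_cmod.
by move=> h; apply: (@measurableT_comp _ _ _ _ _ _ (fun x : R => x `^ p)).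
Qed.

Lemma rmeas_powR p (h : R[i] -> R) : rmeas h -> rmeas (fun z => h z `^ p).
Proof. by move=> mh; apply: (@measurableT_comp _ _ _ _ _ _ (fun x : R => x `^ p)). Qed.

Lemma fnorm_le p f C : cmeas f -> 0 < p -> (fnorm alpha p f <= C%:E)%E ->
  gint (fun u => cmod (f u) `^ p * wt u) /\ rI (fun u => cmod (f u) `^ p * wt u) <= C `^ p.
Proof.
move=> mf p0 fC; have C0 : 0 <= C by rewrite -lee_fin; apply: le_trans fC; exact: Lnorm_ge0.
have H : (\int[leb2]_x (cmod (f (cx x)) `^ p * wt (cx x))%:E <= (C `^ p)%:E)%E.
  rewrite -fnorm_powR ?gt_eqF// -poweR_EFin; apply: gt0_ler_poweR => //.
  - exact: ltW.
  - by rewrite in_itv/= Lnorm_ge0 leey.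
  - by rewrite in_itv/= lee_fin C0 leey.
have G : gint (fun u => cmod (f u) `^ p * wt u).
  apply: gint_lty => [|z|].
  - by apply: rmeasM; [apply: rmeas_powR; exact: cmeas_cmod|exact: rmeas_wt].
  - by rewrite mulr_ge0 ?powR_ge0 ?wt_ge0.
  - exact: le_lt_trans H (ltry _).
by split => //; rewrite -lee_fin (rI_EFin G).
Qed.

Definition l2 f := cmeas f /\ gint (fun u => cmod (f u) ^+ 2 * wt u).
(** The square of [fnorm 2] as a real number, free of real powers and extended values (see
    [fnorm2E]). *)
Definition sqn f := rI (fun u => cmod (f u) ^+ 2 * wt u).

Lemma sqn_ge0 f : 0 <= sqn f.
Proof. by apply: rI_ge0 => z; rewrite mulr_ge0 ?sqr_ge0 ?wt_ge0. Qed.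

Lemma fnorm2E f : l2 f -> fnorm alpha 2 f = (Num.sqrt (sqn f))%:E.
Proof.
move=> [mf If]; have p2 : (2 : R) != 0 by rewrite pnatr_eq0.
have /(congr1 (fun x => x `^ 2^-1)%E) := fnorm_powR mf p2.
rewrite -poweRrM mulfV// poweRe1 ?Lnorm_ge0// => ->.
under eq_integral => x _ do rewrite powR_mulrn ?cmod_ge0//.
rewrite -(rI_EFin If) poweR_EFin; congr (_%:E).
by rewrite powR12_sqrt//; exact: sqn_ge0.
Qed.

Lemma fnorm2_lty f : cmeas f -> (fnorm alpha 2 f < +oo)%E -> l2 f.
Proof.
move=> mf; rewrite -ge0_fin_numE ?Lnorm_ge0// => fin.
have [] := @fnorm_le 2 f (fine (fnorm alpha 2 f)) mf (ltr0Sn _ 1).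
  by rewrite fineK.
move=> If _; split => //; move: If; congr gint; apply/funext => u.
by rewrite powR_mulrn ?cmod_ge0.
Qed.

Lemma fockP f : fock alpha f <-> entire f /\ l2 f.
Proof.
split=> [[ef fl]|[ef fl]]; split => //; first exact: fnorm2_lty (entire_cmeas ef) fl.
by rewrite fnorm2E// ltry.
Qed.

Lemma fnorm2_cvg0 (F : nat -> R[i] -> R[i]) : (forall n, l2 (F n)) ->
  sqn (F n) @[n --> \oo] --> (0 : R) -> fnorm alpha 2 (F n) @[n --> \oo] --> 0%E.
Proof.
move=> Fl F0; under eq_fun do rewrite (fnorm2E (Fl _)).
apply: cvg_EFin; first exact: nearW.
rewrite -(sqrtr0 R); apply: continuous_cvg => //; exact: sqrt_continuous.
Qed.

Lemma innerE f g : cmeas f -> cmeas g ->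
  inner alpha f g = cI (fun u => f u * (g u)^* * (wt u)%:C).
Proof.
move=> mf mg; have [mRe mIm] := cmeasM mf (cmeasJ mg).
have main (h : R[i] -> R) : rmeas h -> Rintegral (gauss_measure alpha) setT
    (fun x => h (x.1 +i* x.2)) = rI (fun u => h u * wt u).
  move=> mh; rewrite /rI /Rintegral; congr fine.
  have mpos : rmeas (fun z => Num.max (h z) 0) by apply: measurable_maxr.
  have mneg : rmeas (fun z => Num.max (- h z) 0) by apply: measurable_maxr; [exact: rmeasN|].
  rewrite [LHS]integralE [RHS]integralE; congr (_ - _)%E.
  - transitivity (\int[gauss_measure alpha]_x (Num.max (h (x.1 +i* x.2)) 0)%:E)%E.
      by apply: eq_integral => x _; rewrite !unlock EFin_max.
    rewrite (integral_wt mpos) => [|z]; last by rewrite le_max lexx orbT.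
    apply: eq_integral => x _; rewrite !unlock -EFin_max; congr (_%:E).
    by rewrite maxr_pMl ?wt_ge0// mul0r.
  - transitivity (\int[gauss_measure alpha]_x (Num.max (- h (x.1 +i* x.2)) 0)%:E)%E.
      by apply: eq_integral => x _; rewrite !unlock EFin_max.
    rewrite (integral_wt mneg) => [|z]; last by rewrite le_max lexx orbT.
    apply: eq_integral => x _; rewrite !unlock -EFin_max; congr (_%:E).
    by rewrite maxr_pMl ?wt_ge0// mul0r mulNr.
rewrite /inner /cintegral (main _ mRe) (main _ mIm).
congr (_ +i* _); congr rI; apply/funext => u.
  by rewrite [RHS]ReM mulr0 subr0.
by rewrite [RHS]ImM mulr0 add0r.
Qed.

Lemma l2D f g : l2 f -> l2 g -> l2 (fun z => f z + g z).
Proof.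
move=> [mf If] [mg Ig]; split; first exact: cmeasD.
apply: (gint_le _ (gintZ 2 (gintD If Ig))) => [|z].
  by apply: rmeasM; [apply: rmeasX; apply: cmeas_cmod; exact: cmeasD|exact: rmeas_wt].
rewrite (ger0_norm (mulr_ge0 (sqr_ge0 _) (wt_ge0 z))).
by have := wt_ge0 z; have := cmodD_sqr_le (f z) (g z); nra.
Qed.

Lemma l2Z c f : l2 f -> l2 (fun z => c * f z).
Proof.
move=> [mf If]; split; first by apply: cmeasM => //; exact: cmeas_cst.
move: (gintZ (cmod c ^+ 2) If); congr gint; apply/funext => z.
by rewrite cmodM exprMn mulrA.
Qed.

Lemma l2B f g : l2 f -> l2 g -> l2 (fun z => f z - g z).
Proof.
move=> lf lg; have := l2D lf (l2Z (-1) lg); congr l2; apply/funext => z.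
by rewrite mulN1r.
Qed.

Lemma l2_cint f g : l2 f -> l2 g -> cint (fun u => f u * (g u)^* * (wt u)%:C).
Proof.
move=> [mf If] [mg Ig]; apply: cint_le (gintD If Ig) _ => [|z].
  apply: cmeasM; last by apply: cmeas_real; exact: rmeas_wt.
  by apply: cmeasM => //; exact: cmeasJ.
rewrite !cmodM cmodJ cmodR ger0_norm ?wt_ge0// -mulrDl ler_wpM2r ?wt_ge0//.
by have := cmod_ge0 (f z); have := cmod_ge0 (g z); nra.
Qed.

Lemma fockD f g : fock alpha f -> fock alpha g -> fock alpha (fun z => f z + g z).
Proof.
move=> /fockP[ef lf] /fockP[eg lg]; apply/fockP; split; [exact: entireD|exact: l2D].
Qed.

Lemma fockZ c f : fock alpha f -> fock alpha (fun z => c * f z).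
Proof.
move=> /fockP[ef lf]; apply/fockP; split; [exact: entireZ|exact: l2Z].
Qed.

Lemma fockB f g : fock alpha f -> fock alpha g -> fock alpha (fun z => f z - g z).
Proof.
move=> hf hg; have := fockD hf (fockZ (-1) hg); congr (fock _ _); apply/funext => z.
by rewrite mulN1r.
Qed.

End Weighted.

Section Tonelli.
Variable R : realType.
Local Notation leb2 := (@plane_measure R).
Variable G : R[i] -> R[i] -> R.
Hypothesis cG : forall w, rcont (G^~ w).
Hypothesis mG : forall u, rmeas (G u).
Hypothesis G0 : forall u w, 0 <= G u w.
Hypothesis iG : forall u, gint (G u).

(** Continuity in one variable and measurability in the other suffice for joint measurability. *)
Let joint : measurable_fun setT (fun xt : plane R * plane R => (G (cx xt.1) (cx xt.2))%:E).
Proof.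
apply/measurable_EFinP.
by apply: (@caratheodory_measurable R _ (plane R) (fun u x => G u (cx x))) => [t|z]; [exact: cG|exact: mG].
Qed.

Let joint0 (xt : plane R * plane R) : (0 <= (G (cx xt.1) (cx xt.2))%:E)%E.
Proof. by rewrite lee_fin. Qed.

Lemma rmeas_rI : rmeas (fun u => rI (G u)).
Proof.
apply/measurable_EFinP; have := measurable_fun_fubini_tonelli_F (m2 := leb2) _ joint joint0.
by congr measurable_fun; apply/funext => x; exact/esym/rI_EFin/iG.
Qed.

Lemma rI_tonelli : gint (fun u => rI (G u)) -> (forall w, gint (G^~ w)) ->
  gint (fun w => rI (G^~ w)) /\ rI (fun w => rI (G^~ w)) = rI (fun u => rI (G u)).
Proof.
move=> iGG iG'.
have E := fubini_tonelli (m1 := leb2) (m2 := leb2) _ joint joint0.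
have E1 : (\int[leb2]_x \int[leb2]_y (G (cx x) (cx y))%:E = (rI (fun u => rI (G u)))%:E)%E.
  by rewrite (rI_EFin iGG); apply: eq_integral => x _; rewrite (rI_EFin (iG _)).
have E2 : (\int[leb2]_y (rI (G^~ (cx y)))%:E = (rI (fun u => rI (G u)))%:E)%E.
  by rewrite -E1; apply: etrans (esym E); apply: eq_integral => y _; rewrite (rI_EFin (iG' _)).
split; last by rewrite [LHS]/rI /Rintegral E2.
apply: gint_lty => [|z|]; last by rewrite E2 ltry.
- apply/measurable_EFinP; have := measurable_fun_fubini_tonelli_G (m1 := leb2) _ joint joint0.
  by congr measurable_fun; apply/funext => x; exact/esym/rI_EFin/iG'.
- exact: rI_ge0.
Qed.

End Tonelli.

(** * Functions holomorphic in two variables and polarization *)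

Section Osgood.
Variable R : realType.
Implicit Types (f : R[i] -> R[i]) (E : R[i] -> R[i] -> R[i]).

Lemma cIJ f : cint f -> cI (fun u => (f u)^*) = (cI f)^*.
Proof.
move=> fi; apply: complexP; rewrite ?ReJ ?ImJ.
  by congr rI; apply/funext => u; rewrite ReJ.
rewrite -mulN1r -(rIZ (-1) (cint_Im fi)); congr rI; apply/funext => u.
by rewrite ImJ mulN1r.
Qed.

(** Used to make the kernel, antiholomorphic in its first variable, holomorphic in the conjugate of
    that variable. *)
Lemma entireJ f : entire f -> entire (fun z => (f z^* )^* ).
Proof.
move=> /entireP ef; apply/entireP => z; have [l hl] := ef z^*; exists l^* => e e0.
have [d d0 Hd] := hl e e0; exists d => // h hd.
have := Hd h^*; rewrite cmodJ => /(_ hd); congr (_ <= _).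
by rewrite -[LHS]cmodJ !(rmorphB, rmorphM, rmorphD) /= conjCK.
Qed.

(* Bargmann's formula in the first variable writes the composite as an
   integral of entire functions, which avoids Hartogs' theorem. *)
Lemma entire_affine_subst E M c a1 b1 a2 b2 : 0 <= c ->
  (forall y, entire (E^~ y)) -> (forall x, entire (E x)) ->
  (forall x y, cmod (E x y) <= M * expR (c * cmod x ^+ 2 + c * cmod y ^+ 2)) ->
  entire (fun z => E (a1 * z + b1) (a2 * z + b2)).
Proof.
move=> c0 e1 e2 gE; pose b := c + 1; have b0 : 0 < b by rewrite ltr_wpDl.
have cb : c < b by rewrite ltrDl.
have gx y : growth (M * expR (c * cmod y ^+ 2)) c (E^~ y).
  by move=> x; rewrite -mulrA -expRD [X in expR X]addrC.
have M0 : 0 <= M.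
  by have := le_trans (cmod_ge0 _) (gE 0 0); rewrite pmulr_lge0 ?expR_gt0.
pose F u z := E u (a2 * z + b2) * cexp (b%:C * (a1 * z + b1) * u^*) * (gauss b u)%:C.
(* The mixed term in [cmod z * cmod u] is split by the inequality of means. Its share of
   [cmod u ^+ 2] raises the exponent to c + 1/2, still below b = c + 1. *)
pose m u := M * expR (2 * c * cmod b2 ^+ 2) *
  (expR ((c + 2^-1) * cmod u ^+ 2 + b * cmod b1 * cmod u) * gauss b u).
suff H : entire (fun z => cI (F^~ z)).
  have -> : (fun z => E (a1 * z + b1) (a2 * z + b2)) =
      (fun z => ((gmass b)^-1)%:C * cI (F^~ z)).
    apply/funext => z; have [_ ->] := reproducing (a1 * z + b1) (e1 _) (gx (a2 * z + b2)) cb b0.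
    rewrite mulrCA -rmorphM mulVf ?mulr1//; apply/lt0r_neq0/gmass_gt0 => //.
  exact: entireZ.
apply: (@entire_integral R F m (2 * c * cmod a2 ^+ 2 + b ^+ 2 * cmod a1 ^+ 2 / 2)).
- by rewrite addr_ge0// ?divr_ge0// mulr_ge0 ?sqr_ge0// mulr_ge0.
- move=> z; apply: cmeasM; last by apply: cmeas_real; exact: rmeas_gauss.
  apply: cmeasM; first exact: entire_cmeas.
  apply: cmeas_cexp; apply: cmeasM; first exact: cmeas_cst.
  by apply: cmeasJ; exact: cmeas_id.
- move=> u; have eA : entire (fun z => a2 * z + b2) by exact: entire_affine.
  have -> : F u = (fun z => (gauss b u)%:C * (E u (a2 * z + b2) *
      cexp (b%:C * a1 * u^* * z + b%:C * b1 * u^*))).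
    by apply/funext => z; rewrite /F mulrC; congr (_ * (_ * cexp _)); ring.
  have eE := entire_comp (e2 u) eA.
  have eC := entire_comp (@entire_cexp R) (@entire_affine R (b%:C * a1 * u^*) (b%:C * b1 * u^*)).
  exact: entireZ (entireM eE eC).
- by apply: gintZ; apply: gint_absorb; rewrite /b ltrD2l invf_lt1// ltr1n.
move=> u z; rewrite /F cmodM [cmod (E _ _ * _)]cmodM cmod_cexp cmodR (ger0_norm (gauss_ge0 _ _)).
have h1 := gE u (a2 * z + b2).
have h2 := cmodD_sqr_le (a2 * z) b2; rewrite cmodM exprMn in h2.
have h3 : complex.Re (b%:C * (a1 * z + b1) * u^*) <= b * (cmod a1 * cmod z + cmod b1) * cmod u.
  apply: le_trans (le_trans (ler_norm _) (normr_Re_le _)) _.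
  rewrite cmodM [cmod (b%:C * _)]cmodM cmodJ cmodR (ger0_norm (ltW b0)) ler_wpM2r ?cmod_ge0//.
  by rewrite ler_wpM2l ?(ltW b0)// -cmodM; exact: cmodD.
set X := cmod (a2 * z + b2) in h1 h2 *; set Y := complex.Re _ in h3 *.
apply: le_trans (ler_wpM2r (gauss_ge0 b u) (ler_wpM2r (expR_ge0 Y) h1)) _.
have mulE p q r s : M * expR p * (expR q * r) * expR s = M * expR (p + q + s) * r.
  by rewrite !expRD; ring.
rewrite /m mulE -[M * _ * expR Y]mulrA -expRD ler_wpM2r ?gauss_ge0// ler_wpM2l// ler_expR.
have h4 : c * X ^+ 2 <= c * (2 * (cmod a2 ^+ 2 * cmod z ^+ 2) + 2 * cmod b2 ^+ 2).
  by rewrite ler_wpM2l.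
have h5 : b * cmod a1 * cmod z * cmod u <= 2^-1 * cmod u ^+ 2 + (b * cmod a1 * cmod z) ^+ 2 / 2.
  by have := sqr_ge0 (b * cmod a1 * cmod z - cmod u); lra.
by lra.
Qed.

(* In the coordinates [x = t - i s], [y = t + i s] the set [x = y^*] is given by
   real [s] and [t]; apply [vitali] in [t], then in [s]. *)
Lemma polarize (E_ : nat -> R[i] -> R[i] -> R[i]) M c : 0 <= c ->
  (forall n y, entire ((E_ n)^~ y)) -> (forall n x, entire (E_ n x)) ->
  (forall n x y, cmod (E_ n x y) <= M * expR (c * cmod x ^+ 2 + c * cmod y ^+ 2)) ->
  (forall t, ccvg (fun n => E_ n t^* t) 0) ->
  forall x y, ccvg (fun n => E_ n x y) 0.
Proof.
move=> c0 e1 e2 gE E0.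
have M0 : 0 <= M.
  by have := le_trans (cmod_ge0 _) (gE 0%N 0 0); rewrite pmulr_lge0 ?expR_gt0.
pose G n s t := E_ n (t - 'i * s) (t + 'i * s).
have eG1 n s : entire (G n s).
  have := @entire_affine_subst (E_ n) M c 1 (- ('i * s)) 1 ('i * s) c0 (e1 n) (e2 n) (gE n).
  by congr entire; apply/funext => t; rewrite /G !mul1r.
have eG2 n t : entire ((G n)^~ t).
  have := @entire_affine_subst (E_ n) M c (- 'i) t 'i t c0 (e1 n) (e2 n) (gE n).
  by congr entire; apply/funext => s; rewrite /G mulNr; congr (E_ n _ _); rewrite addrC.
have gG n s t : cmod (G n s t) <= M * expR (4 * c * cmod s ^+ 2 + 4 * c * cmod t ^+ 2).
  apply: (le_trans (gE _ _ _)); rewrite ler_wpM2l// ler_expR.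
  have h1 := cmodD_sqr_le t (- ('i * s)); have h2 := cmodD_sqr_le t ('i * s).
  have ci : cmod ('i * s) = cmod s.
    rewrite cmodM; have -> : cmod 'i = 1 :> R; last by rewrite mul1r.
    by apply/eqP; rewrite -(@eqrXn2 _ 2) ?cmod_ge0// cmod_sqr /= expr0n expr1n add0r.
  rewrite cmodN ci in h1; rewrite ci in h2.
  have h3 := ler_wpM2l c0 h1; have h4 := ler_wpM2l c0 h2.
  by lra.
have c4 : 0 <= 4 * c by rewrite mulr_ge0.
have step1 (s : R) t : ccvg (fun n => G n s%:C t) 0.
  apply: (@vitali R (fun n => G n s%:C) (M * expR (4 * c * cmod s%:C ^+ 2)) (4 * c) c4) => [n|n t'|t' _].
  - exact: eG1.
  - by rewrite -mulrA -expRD.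
  - have := E0 (t'%:C + 'i * s%:C); congr ccvg; apply/funext => n; congr (E_ n _ _).
    by apply: complexP; rewrite !reimE /=; ring.
have step2 s t : ccvg (fun n => G n s t) 0.
  apply: (@vitali R (fun n => (G n)^~ t) (M * expR (4 * c * cmod t ^+ 2)) (4 * c) c4) => [n|n s'|s' _].
  - exact: eG2.
  - by rewrite -mulrA -expRD addrC.
  - exact: step1.
move=> x y; have := step2 ('i * (x - y) / 2%:R) ((x + y) / 2%:R); congr ccvg.
have ii : 'i * 'i = -1 :> R[i] by rewrite -expr2 sqrCi.
have C2 : (2%:R : R[i]) != 0 by rewrite pnatr_eq0.
apply/funext => n; rewrite /G mulrA mulrA ii; congr (E_ n _ _); by field.
Qed.

End Osgood.

Section ReproducingKernel.
Variables (R : realType) (alpha : {posnum R}).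
Local Notation a := (alpha%:num).
Implicit Types f : R[i] -> R[i].

Let a0 : 0 < a. Proof. by []. Qed.
Let ap0 : 0 < a / pi. Proof. by rewrite divr_gt0 ?pi_gt0. Qed.

(** The constant of [pointwise_bound] at [p = 2] for a function with [sqn] at most 1: removing the
    factor [a / pi] from the weight turns 1 into [pi / a]. *)
Definition evbound : R := 2 * (gmass (a / 2) + pi / a) / gmass a.
(* Its value is [1], but only its positivity is needed. *)
Definition cmass : R := a / pi * gmass a.

Lemma cmass_gt0 : 0 < cmass.
Proof. by rewrite mulr_gt0// gmass_gt0. Qed.

Lemma cmassC_neq0 : cmass%:C != 0 :> R[i].
Proof.
rewrite -[X in _ != X](rmorph0 (real_complex R)) (inj_eq (@complexI R)).
by rewrite gt_eqF// cmass_gt0.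
Qed.

Lemma evbound_ge0 : 0 <= evbound.
Proof.
have h1 : 0 <= gmass a by exact/ltW/gmass_gt0.
have h2 : 0 <= gmass (a / 2) by apply/ltW/gmass_gt0; rewrite divr_gt0.
apply: (divr_ge0 _ h1); apply: (mulr_ge0 (ler0n R 2)); apply: (addr_ge0 h2).
exact: (divr_ge0 (pi_ge0 R) (ltW a0)).
Qed.

(** [pointwise_bound] is not homogeneous, so it is applied to [f / s]. *)
Lemma fock_growth f s : fock alpha f -> 0 < s -> sqn alpha f <= s ^+ 2 ->
  growth (evbound * s) (a / 2) f.
Proof.
move=> /fockP[ef [mf If]] s0 fs.
have sV : 0 < s^-1 by rewrite invr_gt0.
pose g z := (s^-1)%:C * f z; have eg : entire g by exact: entireZ.
have E : (fun u => cmod (g u) `^ 2 * gauss a u) =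
    (fun u => (pi / a * s^-1 ^+ 2) * (cmod (f u) ^+ 2 * wt alpha u)).
  apply/funext => u; rewrite powR_mulrn ?cmod_ge0// cmodM cmodR (ger0_norm (ltW sV)).
  have pn : (pi : R) != 0 by rewrite gt_eqF ?pi_gt0.
  have sn : s != 0 by rewrite gt_eqF.
  have an : a != 0 by rewrite gt_eqF.
  rewrite /wt; move: pn; move: (pi : R) => q qn.
  by field; rewrite qn sn an.
have := @pointwise_bound R g a 2 (pi / a) eg a0 (ler1n _ 2); rewrite E.
move=> /(_ (gintZ _ If)); rewrite rIZ//.
have -> : 2 * a / 2 = a by field.
have H : pi / a * s^-1 ^+ 2 * rI (fun u => cmod (f u) ^+ 2 * wt alpha u) <= pi / a.
  rewrite -[leRHS]mulr1 -mulrA ler_wpM2l ?divr_ge0 ?pi_ge0// exprVn mulrC.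
  by rewrite ler_pdivrMr ?exprn_gt0// mul1r.
move=> /(_ H) gg u; have := gg u; rewrite /g cmodM cmodR (ger0_norm (ltW sV)).
by rewrite mulrC ler_pdivrMr// /evbound [in X in _ -> X]mulrAC.
Qed.

Lemma rkernel_entire w : entire (rkernel alpha w).
Proof.
have := @entire_explin R (a%:C * w^*); congr entire; apply/funext => z.
by rewrite /rkernel mulrAC.
Qed.

Lemma nkernelE z w : nkernel alpha z w =
  (expR (- (a / 2) * cmod z ^+ 2))%:C * rkernel alpha z w.
Proof.
rewrite /nkernel /rkernel cexpD -cexpR; congr (cexp _ * _).
by rewrite [RHS]rmorphM; congr (_ * _); rewrite [RHS]rmorphN; congr (- _); rewrite [RHS]rmorphM; congr (_ * _); rewrite [RHS]fmorphV rmorph_nat.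
Qed.

Lemma cmod_rkernel z w : cmod (rkernel alpha z w) = expR (a * complex.Re (w * z^* )).
Proof.
rewrite /rkernel cmod_cexp -mulrA; congr expR.
by rewrite [LHS]ReM mul0r subr0.
Qed.

(** Against the weight, [nkernel z] has a Gaussian profile centred at [z]; therefore its norm does
    not depend on [z]. *)
Lemma nkernel_wt z w : cmod (nkernel alpha z w) ^+ 2 * wt alpha w = a / pi * gauss a (w + - z).
Proof.
rewrite nkernelE cmodM cmodR ger0_norm ?expR_ge0// cmod_rkernel /wt /gauss.
rewrite mulrCA -expRD -expRM_natl -expRD; congr (_ * expR _).
rewrite [cmod (w - z) ^+ 2]cmodD_sqr cmodN.
have -> : complex.Re ((- z)^* * w) = - complex.Re (w * z^* ) by rewrite rmorphN mulNr ReN mulrC.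
by field.
Qed.

Lemma nkernel_entire z : entire (nkernel alpha z).
Proof.
rewrite (_ : nkernel alpha z =
  (fun w => (expR (- (a / 2) * cmod z ^+ 2))%:C * rkernel alpha z w)).
  by apply: entireZ; exact: rkernel_entire.
by apply/funext => w; exact: nkernelE.
Qed.

Lemma nkernel_fock z : fock alpha (nkernel alpha z).
Proof.
apply/fockP; split; first exact: nkernel_entire.
split; first exact/entire_cmeas/nkernel_entire.
have -> : (fun u => cmod (nkernel alpha z u) ^+ 2 * wt alpha u) =
    (fun u => a / pi * gauss a (u + - z)).
  by apply/funext => u; exact: nkernel_wt.
by apply: gintZ; apply: gint_translate; exact: gint_gauss.
Qed.

Lemma sqn_nkernel z : sqn alpha (nkernel alpha z) = cmass.
Proof.
rewrite /sqn; under eq_fun do rewrite nkernel_wt.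
rewrite rIZ; last by apply: gint_translate; exact: gint_gauss.
by rewrite rI_translate//; exact: rmeas_gauss.
Qed.

Lemma rkernel_fock z : fock alpha (rkernel alpha z).
Proof.
have := fockZ (expR (a / 2 * cmod z ^+ 2))%:C (nkernel_fock z).
congr (fock _ _); apply/funext => w; rewrite nkernelE mulrA -rmorphM -expRD.
by rewrite mulNr subrr expR0 mul1r.
Qed.

(** [reproducing] at [b = a]; it applies because Fock functions have growth exponent [a / 2]. *)
Lemma inner_rkernel f w : fock alpha f -> inner alpha f (rkernel alpha w) = f w * cmass%:C.
Proof.
move=> ff; have /fockP[ef [mf If]] := ff.
rewrite innerE//; last by apply: entire_cmeas; exact: rkernel_entire.
(* For q >= 0, 1 + q is positive and its square exceeds q: this avoids a square root and the case q
   = 0. *)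
have s0 : 0 < 1 + sqn alpha f by rewrite ltr_pwDl ?sqn_ge0.
have g := fock_growth ff s0; have {}g : growth (evbound * (1 + sqn alpha f)) (a / 2) f.
  by apply: g; have := sqn_ge0 alpha f; nra.
have ab : a / 2 < a by rewrite ltr_pdivrMr// mulr_natr mulr2n ltrDl.
have [i e] := reproducing w ef g ab a0.
transitivity (cI (fun u => (a / pi)%:C * (f u * cexp (a%:C * w * u^*) * (gauss a u)%:C))).
  congr cI; apply/funext => u; rewrite /rkernel cexpJ.
  have -> : (a%:C * u * w^* )^* = a%:C * w * u^* by apply: complexP; rewrite !reimE /=; ring.
  by rewrite /wt rmorphM; ring.
by rewrite cIZ// e /cmass rmorphM; ring.
Qed.

End ReproducingKernel.

Section RealContinuity.
Variable R : realType.
Implicit Types f g : R[i] -> R.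

Lemma rcont_cst (k : R) : rcont (fun=> k).
Proof. by move=> z e e0; exists 1 => // w _; rewrite subrr normr0. Qed.

Lemma rcontM f g : rcont f -> rcont g -> rcont (fun z => f z * g z).
Proof.
move=> cf cg z e e0; have e2 : 0 < e / 2 by rewrite divr_gt0.
have F : 0 < 1 + `|f z| by rewrite ltr_pwDl.
have G : 0 < 1 + `|g z| by rewrite ltr_pwDl.
have [d1 d10 H1] := cf z _ (divr_gt0 e2 G).
have [d2 d20 H2] := cg z _ (divr_gt0 e2 F).
have [d3 d30 H3] := cg z _ ltr01.
exists (Num.min d1 (Num.min d2 d3)); first by rewrite !lt_min d10 d20.
move=> w; rewrite !lt_min => /and3P[/H1 h1 /H2 h2 /H3 h3].
have gw : `|g w| <= 1 + `|g z|.
  rewrite -[g w](subrK (g z)); apply: (le_trans (ler_normD _ _)).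
  by rewrite lerD2r ltW.
rewrite (_ : _ - _ = (f w - f z) * g w + f z * (g w - g z)); last by ring.
apply: (le_lt_trans (ler_normD _ _)); rewrite !normrM [e]splitr; apply: ltr_leD.
  apply: (le_lt_trans (ler_wpM2l (normr_ge0 _) gw)).
  by rewrite -ltr_pdivlMr.
rewrite mulrC; apply: (le_trans (ler_wpM2r (normr_ge0 _) (ltW h2))).
by rewrite mulrAC ler_pdivrMr// ler_wpM2l ?(ltW e2)// lerDr.
Qed.

Lemma rcont_cmod (f : R[i] -> R[i]) : ccont f -> rcont (fun z => cmod (f z)).
Proof.
move=> cf z e /(cf z)[d d0 H]; exists d => // w /H; apply: le_lt_trans.
rewrite ler_norml -[cmod (f w)]cmodN; apply/andP; split.
  rewrite lerNl opprB lerBlDr -[f z in leLHS](subrK (f w)) cmodN.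
  by apply: (le_trans (cmodD _ _)); rewrite cmodBC.
rewrite cmodN lerBlDr -[f w in leLHS](subrK (f z)); exact: cmodD.
Qed.

Lemma rcont_gauss b : rcont (@gauss R b).
Proof.
move=> z e e0; pose h (x : R) := expR (- b * x ^+ 2).
have ch : {for cmod z, continuous h}.
  apply: (@continuous_comp _ _ _ (fun x : R => - b * x ^+ 2) (@expR R)); last exact: continuous_expR.
  apply: cvgM; first exact: cvg_cst.
  exact: exprn_continuous.
move/cvgrPdist_lt : ch => /(_ e e0) /nbhs_ballP[d d0 Hd].
have ci : ccont (@id R[i]) by move=> ? ? ?; eexists; first eassumption.
have [d' d'0 H'] := rcont_cmod ci z d0.
exists d' => // w /H' hw; rewrite distrC; apply: Hd.
by rewrite /ball/= distrC.
Qed.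

End RealContinuity.

(** * Integral operators *)

Section KernelOperator.
Variables (R : realType) (alpha : {posnum R}).
Local Notation a := (alpha%:num).
Variables (Phi : R[i] -> R[i] -> R[i]) (K c : R).
Hypothesis c0 : 0 < c.
Hypothesis K_gt0 : 0 < K.
Hypothesis Phi_entire : forall u, entire (Phi u).
Hypothesis Phi_conj_entire : forall w, entire (fun u => (Phi u w)^*).
Hypothesis Phi_le : forall u w, cmod (Phi u w) <=
  K * expR (a / 2 * cmod u ^+ 2 + a / 2 * cmod w ^+ 2 - c * cmod (u - w) ^+ 2).
Implicit Types f : R[i] -> R[i].

Let a0 : 0 < a. Proof. by []. Qed.
Let ap0 : 0 < a / pi. Proof. by rewrite divr_gt0 ?pi_gt0. Qed.

(** The factor [cmass^-1] matches [inner_rkernel]: the kernel [Phi = rkernel alpha] gives the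
    identity on the Fock space. *)
Definition kop f w := (cmass alpha)^-1%:C * cI (fun u => f u * Phi u w * (wt alpha u)%:C).
(** The weight is shared between the two variables. Together with [nfun] this moves the operator to
    unweighted L^2 of the plane, where its kernel is dominated by a convolution Gaussian. *)
Definition nker u w := cmod (Phi u w) * expR (- (a / 2) * cmod u ^+ 2 - a / 2 * cmod w ^+ 2).
Definition nfun f u := cmod (f u) * expR (- (a / 2) * cmod u ^+ 2).
Definition kmass := K * gmass c.
Definition krow u := rI (nker u).

Let K0 : 0 <= K.
Proof. exact: ltW. Qed.

Lemma nker_ge0 u w : 0 <= nker u w.
Proof. by rewrite mulr_ge0 ?cmod_ge0 ?expR_ge0. Qed.

Lemma nker_le u w : nker u w <= K * gauss c (u - w).
Proof.
apply: le_trans (ler_wpM2r (expR_ge0 _) (Phi_le u w)) _.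
rewrite -[leLHS]mulrA -expRD ler_wpM2l// /gauss ler_expR; lra.
Qed.

Lemma gaussN (b : R) z : gauss b (- z) = gauss b z.
Proof. by rewrite /gauss cmodN. Qed.

Lemma nker_le' u w : nker u w <= K * gauss c (w - u).
Proof. by rewrite -gaussN opprB; exact: nker_le. Qed.

Lemma rmeas_nker u : rmeas (nker u).
Proof.
apply: rmeasM; first by apply: cmeas_cmod; exact: entire_cmeas.
apply: rmeas_expR; apply: rmeasD; first exact: rmeas_cst.
by apply: rmeasN; apply: rmeasM; [exact: rmeas_cst|exact: rmeas_cmod2].
Qed.

Lemma rmeas_nker' w : rmeas (nker^~ w).
Proof.
apply: rmeasM.
  have := cmeas_cmod (entire_cmeas (@Phi_conj_entire w)).
  by apply: eq_rmeas => u; rewrite cmodJ.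
apply: rmeas_expR; apply: rmeasD; last exact: rmeas_cst.
by apply: rmeasM; [exact: rmeas_cst|exact: rmeas_cmod2].
Qed.

Let gauss_shift w : gint (fun u => gauss c (u - w)) /\ rI (fun u => gauss c (u - w)) = gmass c.
Proof.
split; first by apply: (gint_translate (- w)); exact: gint_gauss.
by apply: (rI_translate (- w)); exact: rmeas_gauss.
Qed.

Lemma gint_nker u : gint (nker u).
Proof.
apply: (gint_le (rmeas_nker u) (gintZ K (gauss_shift u).1)) => w.
by rewrite ger0_norm ?nker_ge0//; exact: nker_le'.
Qed.

Lemma gint_nker' w : gint (nker^~ w).
Proof.
apply: (gint_le (rmeas_nker' w) (gintZ K (gauss_shift w).1)) => u.
by rewrite ger0_norm ?nker_ge0//; exact: nker_le.
Qed.

Lemma krow_ge0 u : 0 <= krow u.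
Proof. by apply: rI_ge0 => w; exact: nker_ge0. Qed.

Lemma krow_le u : krow u <= kmass.
Proof.
rewrite /kmass -(gauss_shift u).2 -rIZ; last exact: (gauss_shift u).1.
by apply: rI_le => [||w]; [exact: gint_nker|apply: gintZ; exact: (gauss_shift u).1|exact: nker_le'].
Qed.

Let kcol_le w : rI (nker^~ w) <= kmass.
Proof.
rewrite /kmass -(gauss_shift w).2 -rIZ; last exact: (gauss_shift w).1.
by apply: rI_le => [||u]; [exact: gint_nker'|apply: gintZ; exact: (gauss_shift w).1|exact: nker_le].
Qed.

Let kmass_ge0 : 0 <= kmass.
Proof. by rewrite mulr_ge0// ltW// gmass_gt0. Qed.

Lemma nfun_ge0 f u : 0 <= nfun f u.
Proof. by rewrite mulr_ge0 ?cmod_ge0 ?expR_ge0. Qed.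

Lemma nfun_sqr f u : nfun f u ^+ 2 = cmod (f u) ^+ 2 * gauss a u.
Proof. by rewrite exprMn -expRM_natl /gauss; congr (_ * expR _); field. Qed.

Lemma nfun_wt f u : a / pi * nfun f u ^+ 2 = cmod (f u) ^+ 2 * wt alpha u.
Proof. by rewrite nfun_sqr /wt mulrCA. Qed.

Lemma rmeas_nfun f : cmeas f -> rmeas (nfun f).
Proof.
move=> mf; apply: rmeasM; first exact: cmeas_cmod.
by apply: rmeas_expR; apply: rmeasM; [exact: rmeas_cst|exact: rmeas_cmod2].
Qed.

Lemma nfun_bounded f s : fock alpha f -> 0 < s -> sqn alpha f <= s ^+ 2 ->
  forall u, nfun f u <= evbound alpha * s.
Proof.
move=> ff s0 fs u; have := fock_growth ff s0 fs u; rewrite -ler_pdivrMr ?expR_gt0//.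
by rewrite -expRN -mulNr.
Qed.

Let nfun_bounded' f : fock alpha f -> exists2 M : R, 0 <= M & forall u, nfun f u <= M.
Proof.
move=> ff; have s0 : 0 < 1 + sqn alpha f by rewrite ltr_pwDl ?sqn_ge0.
have H : sqn alpha f <= (1 + sqn alpha f) ^+ 2 by have := sqn_ge0 alpha f; nra.
exists (evbound alpha * (1 + sqn alpha f)); first by rewrite mulr_ge0 ?evbound_ge0 ?(ltW s0).
exact: nfun_bounded.
Qed.

Lemma kop_integrand f u w : cmod (f u * Phi u w * (wt alpha u)%:C) =
  a / pi * expR (a / 2 * cmod w ^+ 2) * (nfun f u * nker u w).
Proof.
rewrite cmodM [cmod (f u * _)]cmodM cmodR (ger0_norm (wt_ge0 _ u)) /wt /nfun /nker /gauss.
rewrite (_ : - a * _ = (a / 2 * cmod w ^+ 2) + (- (a / 2) * cmod u ^+ 2) +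
  (- (a / 2) * cmod u ^+ 2 - a / 2 * cmod w ^+ 2)); last by field.
by rewrite !expRD; ring.
Qed.

Let cmeas_integrand f w : cmeas f -> cmeas (fun u => f u * Phi u w * (wt alpha u)%:C).
Proof.
move=> mf; apply: cmeasM; last by apply: cmeas_real; exact: rmeas_wt.
apply: cmeasM => //; have := cmeasJ (entire_cmeas (@Phi_conj_entire w)).
by congr cmeas; apply/funext => u; rewrite conjCK.
Qed.

Let gint_nfun_nker f w : fock alpha f -> gint (fun u => nfun f u * nker u w).
Proof.
move=> ff; have [M M0 HM] := nfun_bounded' ff; have /fockP[ef _] := ff.
apply: (gint_le _ (gintZ M (gint_nker' w))) => [|u].
  by apply: rmeasM; [apply: rmeas_nfun; exact: entire_cmeas|exact: rmeas_nker'].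
rewrite (ger0_norm (mulr_ge0 (nfun_ge0 f u) (nker_ge0 u w))).
by apply: (ler_wpM2r (nker_ge0 u w)); exact: HM.
Qed.

Lemma kop_cint f w : fock alpha f -> cint (fun u => f u * Phi u w * (wt alpha u)%:C).
Proof.
move=> ff; have /fockP[ef _] := ff.
apply: (cint_le (cmeas_integrand w (entire_cmeas ef))
  (gintZ (a / pi * expR (a / 2 * cmod w ^+ 2)) (gint_nfun_nker w ff))) => u.
by rewrite kop_integrand.
Qed.

Lemma kop_entire f : fock alpha f -> entire (kop f).
Proof.
move=> ff; have [M M0 HM] := nfun_bounded' ff; have /fockP[ef _] := ff.
apply: entireZ.
(* The off-diagonal decay is traded by |u|^2 <= 2 |u - w|^2 + 2 |w|^2: it leaves decay [c / 2] in
   [u] and costs growth [c] in [w]. *)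
apply: (@entire_integral R (fun u w => f u * Phi u w * (wt alpha u)%:C)
  (fun u => a / pi * M * K * gauss (c / 2) u) (a / 2 + c)).
- by rewrite addr_ge0 ?(ltW c0)// divr_ge0.
- by move=> w; exact: cmeas_integrand (entire_cmeas ef).
- move=> u; have := @entireZ R (f u * (wt alpha u)%:C) _ (@Phi_entire u).
  by congr entire; apply/funext => w; rewrite mulrAC.
- by apply: gintZ; apply: gint_gauss; rewrite divr_gt0.
move=> u w; rewrite kop_integrand.
have h1 : nfun f u * nker u w <= M * (K * gauss c (u - w)).
  exact: ler_pM (nfun_ge0 f u) (nker_ge0 u w) (HM u) (nker_le u w).
apply: le_trans (ler_wpM2l (mulr_ge0 (ltW ap0) (expR_ge0 _)) h1) _.
rewrite (_ : _ * _ * _ = (a / pi * M * K) * (expR (a / 2 * cmod w ^+ 2) * gauss c (u - w))); last by ring.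
rewrite -[leRHS]mulrA; apply: (ler_wpM2l (mulr_ge0 (mulr_ge0 (ltW ap0) M0) K0)).
rewrite /gauss -!expRD ler_expR.
have := cmodD_sqr_le (u - w) w; rewrite subrK => h2.
by have := ler_wpM2l (ltW c0) h2; lra.
Qed.

Let gint_sqr_nfun f : fock alpha f -> gint (fun u => nfun f u ^+ 2).
Proof.
move=> /fockP[_ [mf If]]; have := gintZ (pi / a) If; congr gint; apply/funext => u.
rewrite -nfun_wt mulrA mulrC -[RHS]mulr1; congr (_ * _).
by rewrite -invf_div mulVf// gt_eqF.
Qed.

Let kmass_gt0 : 0 < kmass.
Proof. exact: mulr_gt0 K_gt0 (gmass_gt0 c0). Qed.

Let gint_sqr_nfun_nker f w : fock alpha f -> gint (fun u => nfun f u ^+ 2 * nker u w).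
Proof.
move=> ff; have /fockP[ef _] := ff.
apply: (gint_le _ (gintZ K (gint_sqr_nfun ff))) => [|u].
  by apply: rmeasM; [apply: rmeasX; apply: rmeas_nfun; exact: entire_cmeas|exact: rmeas_nker'].
rewrite (ger0_norm (mulr_ge0 (sqr_ge0 _) (nker_ge0 u w))) mulrC.
apply: ler_wpM2r; first exact: sqr_ge0.
apply: (le_trans (nker_le u w)); rewrite -[leRHS]mulr1 ler_wpM2l//.
by rewrite /gauss -expR0 ler_expR mulNr oppr_le0 mulr_ge0 ?sqr_ge0// ltW.
Qed.

(* [int (F - s)^2 J >= 0] at [s = int F J / kmass], where [int J <= kmass]. *)
Lemma kop_cauchy_schwarz f w : fock alpha f ->
  rI (fun u => nfun f u * nker u w) ^+ 2 <= kmass * rI (fun u => nfun f u ^+ 2 * nker u w).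
Proof.
move=> ff; set I := rI (fun u => nfun f u * _); set X := rI (fun u => _ ^+ 2 * _).
pose s := I / kmass.
have i1 := gint_sqr_nfun_nker w ff.
have i2 := gintZ (- 2 * s) (gint_nfun_nker w ff).
have i3 := gintZ (s ^+ 2) (gint_nker' w).
have : 0 <= rI (fun u => (nfun f u - s) ^+ 2 * nker u w).
  by apply: rI_ge0 => u; exact: mulr_ge0 (sqr_ge0 _) (nker_ge0 _ _).
have -> : (fun u => (nfun f u - s) ^+ 2 * nker u w) = (fun u => nfun f u ^+ 2 * nker u w +
    (- 2 * s * (nfun f u * nker u w) + s ^+ 2 * nker u w)).
  by apply/funext => u; ring.
rewrite (rID i1 (gintD i2 i3)) (rID i2 i3) (rIZ _ (gint_nfun_nker w ff)) (rIZ _ (gint_nker' w)) -/I -/X => h.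
have h2 := ler_wpM2l (sqr_ge0 s) (kcol_le w).
have : 0 <= X - I ^+ 2 / kmass.
  rewrite (_ : X - _ = X + (- 2 * s * I + s ^+ 2 * kmass)); last first.
    by rewrite /s; field; rewrite gt_eqF.
  by apply: (le_trans h); lra.
by rewrite subr_ge0 ler_pdivrMr// mulrC.
Qed.

(** The 4 is the square of the factor in [cI_cmod], and [kmass] is the column bound from
    [kop_cauchy_schwarz]. *)
Definition kopc := 4 * (a / pi) ^+ 2 / cmass alpha ^+ 2 * kmass.

Lemma kopc_ge0 : 0 <= kopc.
Proof. by rewrite mulr_ge0// divr_ge0 ?sqr_ge0// mulr_ge0 ?sqr_ge0. Qed.

Lemma kop_pointwise f w : fock alpha f -> cmod (kop f w) ^+ 2 * wt alpha w <=
  kopc * (a / pi * rI (fun u => nfun f u ^+ 2 * nker u w)).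
Proof.
move=> ff; have cm := cmass_gt0 alpha.
have h := cI_cmod (kop_cint w ff).
have E : rI (fun u => cmod (f u * Phi u w * (wt alpha u)%:C)) =
    a / pi * expR (a / 2 * cmod w ^+ 2) * rI (fun u => nfun f u * nker u w).
  by rewrite -(rIZ _ (gint_nfun_nker w ff)); congr rI; apply/funext => u; exact: kop_integrand.
rewrite {}E in h.
have CS := kop_cauchy_schwarz w ff.
set I := rI (fun u => nfun f u * _) in h CS; set X := rI (fun u => _ ^+ 2 * _) in CS *.
rewrite /kop cmodM cmodR (ger0_norm (ltW _)) ?invr_gt0// /wt.
set Z := cmod (cI _) in h *; set e := expR _ in h.
have g : gauss a w = (e ^+ 2)^-1.
  by rewrite /gauss /e -expRM_natl -expRN; congr expR; field.
have e0 : 0 < e by exact: expR_gt0.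
have Z0 : 0 <= Z by exact: cmod_ge0.
have h2 : Z ^+ 2 <= (2 * (a / pi * e * I)) ^+ 2 by rewrite lerXn2r ?nnegrE// (le_trans Z0).
have {CS} CS : Z ^+ 2 <= 4 * (a / pi) ^+ 2 * e ^+ 2 * (kmass * X).
  apply: (le_trans h2); rewrite (_ : _ ^+ 2 = 4 * (a / pi) ^+ 2 * e ^+ 2 * I ^+ 2); last by ring.
  by apply: ler_wpM2l CS; exact: mulr_ge0 (mulr_ge0 (ler0n R 4) (sqr_ge0 _)) (sqr_ge0 _).
rewrite g /kopc.
rewrite (_ : (_ * Z) ^+ 2 * _ = (a / pi / (cmass alpha ^+ 2 * e ^+ 2)) * Z ^+ 2); last first.
  by move: (a / pi) => q; field; rewrite !gt_eqF.
rewrite (_ : 4 * _ / _ * _ * _ = (a / pi / (cmass alpha ^+ 2 * e ^+ 2)) *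
  (4 * (a / pi) ^+ 2 * e ^+ 2 * (kmass * X))); last first.
  by move: (a / pi) => q; field; rewrite !gt_eqF.
by apply: ler_wpM2l CS; rewrite divr_ge0 ?(ltW ap0)// mulr_ge0 ?sqr_ge0.
Qed.

(** Schur's test in which the columns are bounded by [kmass] but the rows stay in the integral as
    the weight [krow]. A uniform bound on [krow] gives boundedness; its decay at infinity gives
    compactness. *)
Lemma kop_schur f : fock alpha f -> [/\ l2 alpha (kop f),
  gint (fun u => cmod (f u) ^+ 2 * wt alpha u * krow u) &
  sqn alpha (kop f) <= kopc * rI (fun u => cmod (f u) ^+ 2 * wt alpha u * krow u)].
Proof.
move=> ff; have /fockP[ef [mf If]] := ff.
pose G u w := a / pi * (nfun f u ^+ 2 * nker u w).
have iG u : gint (G u) by do 2 apply: gintZ; exact: gint_nker.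
have iG' w : gint (G^~ w) by apply: gintZ; exact: gint_sqr_nfun_nker.
have G0 u w : 0 <= G u w.
  exact: mulr_ge0 (ltW ap0) (mulr_ge0 (sqr_ge0 _) (nker_ge0 _ _)).
have mG u : rmeas (G u) by exact: gint_rmeas.
have cG w : rcont (G^~ w).
  (* Tonelli asks for continuity in [u]. The conjugate of [Phi] is the function that is entire in
     [u], and it has the same modulus. *)
  pose h u := f u * f u * (Phi u w)^*.
  have -> : G^~ w = (fun u => expR (- (a / 2) * cmod w ^+ 2) * a / pi * (cmod (h u) * gauss (3 / 2 * a) u)).
    apply/funext => u; rewrite /G nfun_sqr /nker /h cmodM [cmod (f u * _)]cmodM cmodJ expRD.
    rewrite (_ : 3 / 2 * a = a + a / 2) ?gaussD; last by field.
    by rewrite /gauss -[- (a / 2 * _)]mulNr; ring.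
  apply: rcontM; first exact: rcont_cst.
  apply: rcontM; last exact: rcont_gauss.
  apply: rcont_cmod; apply: entire_ccont; apply: entireM; last exact: Phi_conj_entire.
  exact: entireM.
have rG u : rI (G u) = cmod (f u) ^+ 2 * wt alpha u * krow u.
  rewrite -nfun_wt -[RHS]mulrA /G rIZ; last by apply: gintZ; exact: gint_nker.
  by rewrite rIZ//; exact: gint_nker.
have iH : gint (fun u => cmod (f u) ^+ 2 * wt alpha u * krow u).
  apply: (gint_le _ (gintZ kmass If)) => [|u].
    have := rmeas_rI cG mG G0 iG; apply: eq_rmeas => u; exact/esym/rG.
  rewrite -rG ger0_norm ?rI_ge0// rG mulrC ler_wpM2r ?krow_le//.
  by rewrite mulr_ge0 ?sqr_ge0 ?wt_ge0.
have iGG : gint (fun u => rI (G u)) by move: iH; congr gint; apply/funext => u; rewrite rG.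
have [iX rX] := rI_tonelli cG mG G0 iG iGG iG'.
have XE w : rI (G^~ w) = a / pi * rI (fun u => nfun f u ^+ 2 * nker u w).
  exact: rIZ (gint_sqr_nfun_nker w ff).
have mT : cmeas (kop f) by apply: entire_cmeas; exact: kop_entire.
have iT : gint (fun w => cmod (kop f w) ^+ 2 * wt alpha w).
  apply: (gint_le _ (gintZ kopc iX)) => [|w].
    by apply: rmeasM; [apply: rmeasX; exact: cmeas_cmod|exact: rmeas_wt].
  rewrite (ger0_norm (mulr_ge0 (sqr_ge0 _) (wt_ge0 _ _))) XE; exact: kop_pointwise.
have HE : rI (fun u => cmod (f u) ^+ 2 * wt alpha u * krow u) = rI (fun u => rI (G u)).
  by congr rI; apply/funext => u; rewrite rG.
split; [exact: (conj mT iT) | exact: iH |].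
rewrite HE -rX -(rIZ _ iX); apply: (rI_le iT (gintZ kopc iX)) => w.
by rewrite XE; exact: kop_pointwise.
Qed.

Lemma kop_fock f : fock alpha f -> fock alpha (kop f).
Proof.
move=> ff; apply/fockP; split; first exact: kop_entire.
by have [] := kop_schur ff.
Qed.

Lemma kop_linear d f g : fock alpha f -> fock alpha g ->
  kop (fun z => d * f z + g z) = (fun z => d * kop f z + kop g z).
Proof.
move=> ff fg; apply/funext => w; rewrite /kop mulrCA -mulrDr; congr (_ * _).
rewrite -(cIZ _ (kop_cint w ff)) -(cID (cintZ _ (kop_cint w ff)) (kop_cint w fg)).
congr cI; apply/funext => u; ring.
Qed.

End KernelOperator.

Section Fatou.
Variable R : realType.
Local Notation leb2 := (@plane_measure R).

(** Keeps pointwise limits of norm-bounded Fock functions inside the Fock space. *)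
Lemma rI_fatou (f_ : nat -> R[i] -> R) f B : (forall n, gint (f_ n)) ->
  (forall n z, 0 <= f_ n z) -> (forall n, rI (f_ n) <= B) -> rmeas f ->
  (forall z, f_ n z @[n --> \oo] --> f z) -> gint f /\ rI f <= B.
Proof.
move=> fi f0 fB mf fc.
have f0' z : 0 <= f z.
  rewrite -(cvg_lim (@Rhausdorff R) (fc z)); apply: limr_ge; last exact: nearW.
  exact: cvgP (fc z).
have H : (\int[leb2]_x (f (cx x))%:E <= B%:E)%E.
  have -> : (\int[leb2]_x (f (cx x))%:E =
      \int[leb2]_x limn_einf (fun n => (f_ n (cx x))%:E))%E.
    apply: eq_integral => x _; apply/esym; apply: (fun h => (cvg_limn_einf_sup h).1).
    by apply: cvg_EFin; [exact: nearW|exact: fc].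
  apply: le_trans (fatou _ _ _ _) _ => //.
  - by move=> n; apply/measurable_EFinP; exact: gint_rmeas (fi n).
  - by move=> n x _; rewrite lee_fin.
  rewrite limn_einf_lim; apply: lime_le; first exact: is_cvg_einfs.
  apply: nearW => n; apply: le_trans (ereal_inf_lbound _) _; first by exists n => /=.
  by rewrite -(rI_EFin (fi n)) lee_fin.
have G : gint f by apply: gint_lty => //; exact: le_lt_trans H (ltry _).
by split => //; rewrite -lee_fin (rI_EFin G).
Qed.

End Fatou.

(** * Compactness from vanishing row integrals *)

Section KernelCompact.
Variables (R : realType) (alpha : {posnum R}).
Local Notation a := (alpha%:num).
Variables (Phi : R[i] -> R[i] -> R[i]) (K c : R).
Hypothesis c0 : 0 < c.
Hypothesis K_gt0 : 0 < K.
Hypothesis Phi_entire : forall u, entire (Phi u).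
Hypothesis Phi_conj_entire : forall w, entire (fun u => (Phi u w)^*).
Hypothesis Phi_le : forall u w, cmod (Phi u w) <=
  K * expR (a / 2 * cmod u ^+ 2 + a / 2 * cmod w ^+ 2 - c * cmod (u - w) ^+ 2).
Local Notation nker := (nker alpha Phi).
Local Notation krow := (krow alpha Phi).
Local Notation kop := (kop alpha Phi).

(** If some rows near infinity stayed above [e], recentring each at its own base point would put all
    of them under the single integrable majorant [K * gauss c], and dominated convergence would
    contradict the choice. *)
Lemma krow_vanish : (forall z_ : nat -> R[i], (forall n, n%:R < cmod (z_ n)) ->
    forall t, nker (z_ n) (t + z_ n) @[n --> \oo] --> (0 : R)) ->
  forall e, 0 < e -> exists rho, forall u, rho < cmod u -> krow u <= e.
Proof.
move=> H e e0; apply: contrapT => /forallNP nex.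
have /choice[z_ zP] : forall n : nat, exists u, n%:R < cmod u /\ e < krow u.
  move=> n; have /existsNP[u] := nex n%:R.
  by move=> /not_implyP[un /negP]; rewrite -ltNge => ue; exists u.
have zn n : n%:R < cmod (z_ n) by have [] := zP n.
have mf n : rmeas (fun t => nker (z_ n) (t + z_ n)).
  exact: gint_rmeas (gint_translate (z_ n) (gint_nker c0 K_gt0 Phi_entire Phi_le (z_ n))).
have [] := rI_dominated mf (H z_ zn) (gintZ K (gint_gauss c0)).
  move=> n t; rewrite ger0_norm ?nker_ge0//.
  by have := nker_le' K_gt0 Phi_le (z_ n) (t + z_ n); rewrite addrK.
move=> _; rewrite (_ : rI (fun=> 0) = 0); last first.
  by rewrite /rI /Rintegral integral0.
move/cvgrPdist_lt => /(_ e e0) [N _ /(_ N (leqnn N))] /=.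
rewrite sub0r normrN rI_translate; last exact: rmeas_nker.
by rewrite ltNge => /negP; apply; apply: le_trans (ler_norm _); have [_ /ltW] := zP N.
Qed.

(** The differences [d n] need not tend to 0 in norm, but the weight [krow] of [kop_schur] is small
    far out, and near the origin pointwise convergence with a uniform growth bound is enough. *)
Lemma kop_compact (u_ : nat -> R[i] -> R[i]) s :
  (forall e, 0 < e -> exists rho, forall u, rho < cmod u -> krow u <= e) ->
  0 < s -> (forall n, fock alpha (u_ n)) -> (forall n, sqn alpha (u_ n) <= s ^+ 2) ->
  exists2 phi : nat -> nat, {homo phi : m n / (m < n)%N} &
  exists2 g, fock alpha g &
    sqn alpha (fun z => kop (u_ (phi n)) z - kop g z) @[n --> \oo] --> (0 : R).
Proof.
move=> kv s0 uf us; pose M := evbound alpha * s.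
have ug n : growth M (a / 2) (u_ n) by exact: fock_growth.
have ue n : entire (u_ n) by have /fockP[] := uf n.
have a2 : 0 <= a / 2 by rewrite divr_ge0.
have [phi phiS [g [ge gg gc]]] := montel a2 ue ug.
exists phi => //.
have uL n : l2 alpha (u_ (phi n)) by have /fockP[] := uf (phi n).
have mg : cmeas g by exact: entire_cmeas.
have [Ig Sg] : gint (fun z => cmod (g z) ^+ 2 * wt alpha z) /\ sqn alpha g <= s ^+ 2.
  apply: (@rI_fatou R (fun n z => cmod (u_ (phi n) z) ^+ 2 * wt alpha z)).
  - by move=> n; have [] := uL n.
  - by move=> n z; exact: mulr_ge0 (sqr_ge0 _) (wt_ge0 _ _).
  - by move=> n; exact: us.
  - by apply: rmeasM; [apply: rmeasX; exact: cmeas_cmod|exact: rmeas_wt].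
  move=> z; apply: cvgM; last exact: cvg_cst.
  have := ccvg_cmod (gc z) => h; exact: (cvgM h h).
have gf : fock alpha g by apply/fockP; split.
exists g => //; pose d n z := u_ (phi n) z - g z.
have df n : fock alpha (d n) by exact: fockB.
have kd n : (fun z => kop (u_ (phi n)) z - kop g z) = kop (d n).
  have := kop_linear c0 K_gt0 Phi_conj_entire Phi_le (-1) gf (uf (phi n)).
  rewrite (_ : (fun z => -1 * g z + u_ (phi n) z) = d n); last first.
    by apply/funext => z; rewrite mulN1r addrC.
  by move=> ->; apply/funext => z; rewrite mulN1r addrC.
under eq_fun do rewrite kd.
have dL n : gint (fun z => cmod (d n z) ^+ 2 * wt alpha z).
  by have /fockP[_ []] := df n.
have dle n z : cmod (d n z) ^+ 2 <= 2 * cmod (u_ (phi n) z) ^+ 2 + 2 * cmod (g z) ^+ 2.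
  by have := cmodD_sqr_le (u_ (phi n) z) (- g z); rewrite cmodN.
have Sd n : sqn alpha (d n) <= 4 * s ^+ 2.
  have H : sqn alpha (d n) <= 2 * sqn alpha (u_ (phi n)) + 2 * sqn alpha g.
    have i1 := gintZ 2 (uL n).2; have i2 := gintZ 2 Ig.
    rewrite /sqn -(rIZ 2 (uL n).2) -(rIZ 2 Ig) -(rID i1 i2).
    apply: (rI_le (dL n) (gintD i1 i2)) => z.
    by have := ler_wpM2r (wt_ge0 alpha z) (dle n z); lra.
  by apply: (le_trans H); have := us (phi n); lra.
(* The extra [gauss 1] supplies the integrable majorant: the growth of [d n] is exactly compensated
   by the weight, so the integrand is at most a constant times [gauss 1]. *)
have D0 : rI (fun z => cmod (d n z) ^+ 2 * wt alpha z * gauss 1 z) @[n --> \oo] --> (0 : R).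
  have [|z|||] := @rI_dominated R (fun n z => cmod (d n z) ^+ 2 * wt alpha z * gauss 1 z)
    (fun=> 0) (fun z => 4 * M ^+ 2 * (a / pi) * gauss 1 z).
  - move=> n; apply: rmeasM; last exact: rmeas_gauss.
    exact: gint_rmeas (dL n).
  - have dz : cmod (d n z) @[n --> \oo] --> (0 : R).
      apply/cvgrPdist_lt => e e0; have [N HN] := gc z e e0; exists N => // n Nn /=.
      by rewrite sub0r normrN ger0_norm ?cmod_ge0//; exact: HN.
    rewrite -(mul0r (gauss 1 z)); apply: cvgM; last exact: cvg_cst.
    rewrite -(mul0r (wt alpha z)); apply: cvgM; last exact: cvg_cst.
    by rewrite -(mul0r 0); exact: (cvgM dz dz).
  - by apply: gintZ; exact: gint_gauss.
  - move=> n z; rewrite ger0_norm; last first.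
      exact: mulr_ge0 (mulr_ge0 (sqr_ge0 _) (wt_ge0 _ _)) (gauss_ge0 _ _).
    apply: (ler_wpM2r (gauss_ge0 _ _)).
    pose E := expR (a / 2 * cmod z ^+ 2).
    have h : cmod (d n z) <= 2 * M * E.
      by apply: (le_trans (cmodB _ _)); have := ug (phi n) z; have := gg z; rewrite -/E; lra.
    have h2 : cmod (d n z) ^+ 2 <= (2 * M * E) ^+ 2.
      by rewrite lerXn2r ?nnegrE ?cmod_ge0// (le_trans (cmod_ge0 _) h).
    have EG : E ^+ 2 * gauss a z = 1.
      by rewrite /E -expRM_natl /gauss -expRD -expR0; congr expR; field.
    apply: le_trans (ler_wpM2r (wt_ge0 _ _) h2) _; rewrite le_eqVlt; apply/orP; left; apply/eqP.
    transitivity (4 * M ^+ 2 * (a / pi) * (E ^+ 2 * gauss a z)); last by rewrite EG mulr1.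
    by rewrite /wt; ring.
  by move=> _; rewrite (_ : rI (fun=> 0) = 0)// /rI /Rintegral integral0.
apply/cvgrPdist_lt => e e0.
pose k := kopc alpha K c; have k0 : 0 <= k by exact: kopc_ge0.
have S0 : 0 <= 4 * s ^+ 2 by exact: mulr_ge0 (ler0n R 4) (sqr_ge0 _).
have W1 : 0 < 1 + k * (4 * s ^+ 2) by rewrite ltr_pwDl// mulr_ge0.
have e2 : 0 < e / 2 by rewrite divr_gt0.
(* Half of [e] pays for the far region, where the norms of [d n] are bounded but not small. *)
pose e1 := e / 2 / (1 + k * (4 * s ^+ 2)); have e10 : 0 < e1 by rewrite divr_gt0.
have [rho Hrho] := kv e1 e10.
(* On the disc of radius [rho] the product [C * gauss 1] is at least [kmass], so one Gaussian covers
   the inner region without an indicator function. *)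
pose C := kmass K c * expR (rho ^+ 2).
have km0 : 0 <= kmass K c := le_trans (krow_ge0 alpha Phi 0) (krow_le c0 K_gt0 Phi_entire Phi_le 0).
have C0 : 0 <= C by exact: mulr_ge0 km0 (expR_ge0 _).
have W2 : 0 < 1 + k * C by rewrite ltr_pwDl// mulr_ge0.
have kb u : krow u <= e1 + C * gauss 1 u.
  have [/Hrho h|h] := ltP rho (cmod u).
    by apply: (le_trans h); rewrite lerDl (mulr_ge0 C0 (gauss_ge0 _ _)).
  apply: (le_trans (krow_le c0 K_gt0 Phi_entire Phi_le u)).
  apply: le_trans (_ : C * gauss 1 u <= _); last by rewrite lerDr ltW.
  rewrite /C -mulrA -expRD ler_peMr// -[X in X <= _]expR0 ler_expR mulN1r subr_ge0.
  by rewrite lerXn2r ?nnegrE ?cmod_ge0// (le_trans (cmod_ge0 u) h).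
move/cvgrPdist_lt : D0 => /(_ _ (divr_gt0 e2 W2))[N _ HN].
exists N => // n Nn /=; rewrite sub0r normrN (ger0_norm (sqn_ge0 _ _)).
have := HN n Nn; rewrite /= sub0r normrN => /(le_lt_trans (ler_norm _)).
set r := rI _ => rlt.
have [_ iH sH] := kop_schur c0 K_gt0 Phi_entire Phi_conj_entire Phi_le (df n).
have iG : gint (fun z => cmod (d n z) ^+ 2 * wt alpha z * gauss 1 z).
  apply: (gint_le _ (dL n)) => [|z].
    by apply: rmeasM; [exact: gint_rmeas (dL n)|exact: rmeas_gauss].
  have w0 : 0 <= cmod (d n z) ^+ 2 * wt alpha z by exact: mulr_ge0 (sqr_ge0 _) (wt_ge0 _ _).
  rewrite (ger0_norm (mulr_ge0 w0 (gauss_ge0 _ _))) -[leRHS]mulr1; apply: (ler_wpM2l w0).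
  by rewrite /gauss mulN1r -expR0 ler_expR oppr_le0 sqr_ge0.
have h : rI (fun z => cmod (d n z) ^+ 2 * wt alpha z * krow z) <= e1 * sqn alpha (d n) + C * r.
  have i1 := gintZ e1 (dL n); have i2 := gintZ C iG.
  rewrite /sqn /r -(rIZ e1 (dL n)) -(rIZ C iG) -(rID i1 i2).
  apply: (rI_le iH (gintD i1 i2)) => z.
  have w0 : 0 <= cmod (d n z) ^+ 2 * wt alpha z by exact: mulr_ge0 (sqr_ge0 _) (wt_ge0 _ _).
  by have := ler_wpM2l w0 (kb z); lra.
apply: (le_lt_trans sH); rewrite -/k.
apply: (le_lt_trans (ler_wpM2l k0 h)).
have h1 : e1 * sqn alpha (d n) <= e1 * (4 * s ^+ 2) by rewrite ler_wpM2l ?(ltW e10).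
have h2 : k * (e1 * sqn alpha (d n)) <= k * (e1 * (4 * s ^+ 2)) by rewrite ler_wpM2l.
have h3 : e1 * (1 + k * (4 * s ^+ 2)) = e / 2 by rewrite /e1 divfK// gt_eqF.
have h4 : r * (1 + k * C) < e / 2 by rewrite -ltr_pdivlMr.
have r0 : 0 <= r.
  apply: rI_ge0 => z; exact: mulr_ge0 (mulr_ge0 (sqr_ge0 _) (wt_ge0 _ _)) (gauss_ge0 _ _).
by lra.
Qed.

End KernelCompact.

(** * Decay of Fock functions at infinity *)

Section FockDecay.
Variables (R : realType) (alpha : {posnum R}).
Local Notation a := (alpha%:num).

Let a0 : 0 < a. Proof. by []. Qed.
Let ap0 : 0 < a / pi. Proof. by rewrite divr_gt0 ?pi_gt0. Qed.

Lemma gauss_escape b (z_ : nat -> R[i]) u : 0 < b -> (forall n, n%:R < cmod (z_ n)) ->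
  gauss b (u - z_ n) @[n --> \oo] --> (0 : R).
Proof.
move=> b0 zn; apply/cvgrPdist_lt => e e0.
(* Beyond this distance y = |u - z_n| exceeds both 1 and 1 / (b e), so b y^2 > 1 / e, and exp (- t)
   < 1 / t concludes. *)
pose x := cmod u + 1 + (b * e)^-1; exists (Num.truncn x).+1 => // n /= Nn.
rewrite sub0r normrN ger0_norm ?gauss_ge0//.
have xn : x < n%:R by apply: (lt_le_trans (truncnS_gt x)); rewrite ler_nat.
have h1 : cmod (z_ n) <= cmod (u - z_ n) + cmod u.
  by rewrite cmodBC -[z_ n in leLHS](subrK u); exact: cmodD.
have be : 0 < (b * e)^-1 by rewrite invr_gt0 mulr_gt0.
have h2 : 1 + (b * e)^-1 < cmod (u - z_ n).
  by have := zn n; move: xn; rewrite /x; lra.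
set y := cmod (u - z_ n) in h1 h2 *.
have y0 : 0 < y by apply: lt_trans h2; rewrite ltr_pwDr.
have h3 : e^-1 < b * y ^+ 2.
  have : (b * e)^-1 < y ^+ 2.
    apply: (@lt_le_trans _ _ y); first by apply: lt_trans h2; rewrite ltrDr.
    by rewrite expr2 ler_peMr ?(ltW y0)//; apply: le_trans (ltW h2); rewrite lerDl ltW.
  by rewrite invfM ltr_pdivrMl.
rewrite /gauss -/y mulNr expRN -[e]invrK ltf_pV2 ?posrE ?invr_gt0 ?expR_gt0//.
by apply: lt_le_trans h3 _; apply: le_trans (expR_ge1Dx _); rewrite lerDr.
Qed.

(** The reproducing formula bounds [nfun g] at [z_n] by an average of [nfun g] against a Gaussian
    centred at [z_n]. Since [nfun g] is square integrable, the escaping Gaussian sees less and less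
    of it. *)
Lemma fock_decay g (z_ : nat -> R[i]) : fock alpha g -> (forall n, n%:R < cmod (z_ n)) ->
  nfun alpha g (z_ n) @[n --> \oo] --> (0 : R).
Proof.
move=> gf zn; have /fockP[ge [mg Ig]] := gf.
have a2 : 0 < a / 2 by rewrite divr_gt0.
have cm := cmass_gt0 alpha.
pose X n := rI (fun u => nfun alpha g u ^+ 2 * gauss (a / 2) (u - z_ n)).
have mX n : rmeas (fun u => nfun alpha g u ^+ 2 * gauss (a / 2) (u - z_ n)).
  apply: rmeasM; first by apply: rmeasX; exact: rmeas_nfun.
  exact: gint_rmeas (gint_translate (- z_ n) (gint_gauss a2)).
have I2 : gint (fun u => nfun alpha g u ^+ 2).
  have := gintZ (pi / a) Ig; congr gint; apply/funext => u.
  by rewrite -nfun_wt mulrA -invf_div mulVf ?mul1r// gt_eqF.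
have gle1 z : gauss (a / 2) z <= 1.
  by rewrite /gauss -expR0 ler_expR mulNr oppr_le0 mulr_ge0 ?sqr_ge0// ltW.
have Xb n u : `|nfun alpha g u ^+ 2 * gauss (a / 2) (u - z_ n)| <= nfun alpha g u ^+ 2.
  rewrite (ger0_norm (mulr_ge0 (sqr_ge0 _) (gauss_ge0 _ _))) -[leRHS]mulr1.
  by apply: (ler_wpM2l (sqr_ge0 _)).
have X0 : X n @[n --> \oo] --> (0 : R).
  have [] := @rI_dominated R (fun n u => nfun alpha g u ^+ 2 * gauss (a / 2) (u - z_ n))
    (fun=> 0) _ mX _ I2 Xb.
    move=> u; rewrite -(mulr0 (nfun alpha g u ^+ 2)); apply: cvgM; first exact: cvg_cst.
    exact: gauss_escape.
  by move=> _; rewrite (_ : rI (fun=> 0) = 0)// /rI /Rintegral integral0.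
(* A Cauchy-Schwarz inequality in the form F <= e + F^2 / e: the first part has fixed Gaussian mass,
   the second is [X n], which tends to 0. *)
have main n e : 0 < e -> nfun alpha g (z_ n) * cmass alpha <=
    2 * (a / pi * (e * gmass (a / 2) + e^-1 * X n)).
  move=> e0; have kf := rkernel_fock alpha (z_ n).
  have /fockP[ke [mk Ik]] := kf.
  have := inner_rkernel (z_ n) gf; rewrite innerE// => E.
  have ci := l2_cint (conj mg Ig) (conj mk Ik).
  have h := cI_cmod ci; rewrite E cmodM cmodR (ger0_norm (ltW cm)) in h.
  pose Ez := expR (- (a / 2) * cmod (z_ n) ^+ 2).
  have F u : cmod (g u * (rkernel alpha (z_ n) u)^* * (wt alpha u)%:C) * Ez =
      a / pi * (nfun alpha g u * gauss (a / 2) (u - z_ n)).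
    rewrite cmodM [cmod (g u * _)]cmodM cmodJ cmod_rkernel cmodR (ger0_norm (wt_ge0 _ _)).
    rewrite /wt /nfun /gauss cmodD_sqr cmodN.
    have -> : complex.Re ((- z_ n)^* * u) = - complex.Re (u * (z_ n)^* ).
      by rewrite rmorphN mulNr ReN mulrC.
    set q := complex.Re _.
    have ee : expR (a * q) * expR (- a * cmod u ^+ 2) * Ez = expR (- (a / 2) * cmod u ^+ 2) *
        expR (- (a / 2) * (cmod u ^+ 2 + cmod (z_ n) ^+ 2 + 2 * - q)).
      by rewrite /Ez -!expRD; congr expR; field.
    transitivity (a / pi * (cmod (g u) * (expR (a * q) * expR (- a * cmod u ^+ 2) * Ez))).
      by ring.
    by rewrite ee; ring.
  have i1 : gint (fun u => gauss (a / 2) (u - z_ n)).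
    by apply: (gint_translate (- z_ n)); exact: gint_gauss.
  have i2 : gint (fun u => nfun alpha g u ^+ 2 * gauss (a / 2) (u - z_ n)).
    exact: gint_le (mX n) I2 (Xb n).
  have i3 := gintZ Ez ci.2.
  have i4 := gintZ e i1; have i5 := gintZ e^-1 i2.
  have Ez0 : 0 <= Ez by exact: expR_ge0.
  have := ler_wpM2r Ez0 h; rewrite (_ : _ * _ * Ez = nfun alpha g (z_ n) * cmass alpha); last first.
    by rewrite /nfun -/Ez mulrAC.
  move=> /le_trans; apply; rewrite -[leLHS]mulrA [rI _ * Ez]mulrC; apply: (ler_wpM2l (ler0n R 2)); rewrite -(rIZ _ ci.2).
  have rg : rI (fun u => gauss (a / 2) (u - z_ n)) = gmass (a / 2).
    by apply: (rI_translate (- z_ n)); exact: rmeas_gauss.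
  rewrite -rg /X -(rIZ _ i1) -(rIZ _ i2) -(rID i4 i5) -(rIZ _ (gintD i4 i5)).
  apply: (rI_le i3 (gintZ _ (gintD i4 i5))) => u.
  rewrite mulrC F; apply: (ler_wpM2l (ltW ap0)); rewrite mulrA -mulrDl.
  apply: (ler_wpM2r (gauss_ge0 _ _)).
  have : e * nfun alpha g u <= e ^+ 2 + nfun alpha g u ^+ 2.
    by have := nfun_ge0 alpha g u; nra.
  rewrite mulrC -ler_pdivlMr// => /le_trans; apply.
  by rewrite mulrDl expr2 -mulrA mulfV ?gt_eqF// mulr1 [_ ^+ 2 * _]mulrC.
apply/cvgrPdist_lt => e e0.
have G2 := gmass_gt0 a2.
pose A := 2 * (a / pi) / cmass alpha.
have A0 : 0 < A by rewrite divr_gt0// mulr_gt0.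
(* Makes the first part of [main] equal to half of the target. *)
pose d := e / 2 / (A * gmass (a / 2)).
have d0 : 0 < d by exact: divr_gt0 (divr_gt0 e0 (ltr0Sn R 1)) (mulr_gt0 A0 G2).
have dV : 0 < d^-1 by rewrite invr_gt0.
have t0 : 0 < e / 2 / (A * d^-1) := divr_gt0 (divr_gt0 e0 (ltr0Sn R 1)) (mulr_gt0 A0 dV).
move/cvgrPdist_lt : X0 => /(_ _ t0)[N _ HN]; exists N => // n Nn /=.
have := HN n Nn; rewrite /= !sub0r !normrN (ger0_norm (nfun_ge0 _ _ _)).
move=> /(le_lt_trans (ler_norm _)) Xn.
have := main n d d0; rewrite -ler_pdivlMr// => /le_lt_trans; apply.
rewrite (_ : _ / _ = A * gmass (a / 2) * d + A * d^-1 * X n); last first.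
  by rewrite /A; ring.
have Ed : A * gmass (a / 2) * d = e / 2.
  by rewrite /d mulrC divfK// (gt_eqF (mulr_gt0 A0 G2)).
rewrite Ed [e in ltRHS]splitr ltrD2l mulrC -ltr_pdivlMr//.
exact: mulr_gt0.
Qed.

End FockDecay.

(** * The compactness criterion *)

Section OperatorKernel.
Variables (R : realType) (alpha : {posnum R}).
Local Notation a := (alpha%:num).
Variable S : operator alpha.
Hypothesis hS : admissible S.

Let a0 : 0 < a. Proof. by []. Qed.

Definition skernel u := S (rkernel alpha u).
(* For [f = 1] the function [S_z f] is [fun v => ckernel z (z - v)]
   (see [conj_by_U1]). *)
Definition ckernel u v := skernel u v * cexp (- (a%:C * v * u^* )).

Lemma rkernel_dom u : odom S (rkernel alpha u).
Proof.
have [h _ _] := hS; apply: h; exists 1%N, (fun=> 1), (fun=> u).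
by apply/funext => z; rewrite big_ord1 mul1r.
Qed.

Lemma skernel_fock u : fock alpha (skernel u).
Proof. exact: oapp_fock (rkernel_dom u). Qed.

Lemma inner_conj f g : l2 alpha f -> l2 alpha g -> inner alpha g f = (inner alpha f g)^*.
Proof.
move=> lf lg; rewrite (innerE alpha lf.1 lg.1) (innerE alpha lg.1 lf.1) -cIJ; last exact: l2_cint.
congr cI; apply/funext => u; rewrite !rmorphM /= conjCK [g u * _]mulrC; congr (_ * _).
by apply: complexP; rewrite !reimE /= ?oppr0.
Qed.

(** The witness is the adjoint of [S] applied to the kernel at [w]. Pairing it with kernels
    identifies its values, which is where antiholomorphy of [skernel] in its first variable comes
    from. *)
Lemma adjoint_kernel w : exists h, [/\ fock alpha h, (forall u, h u = (skernel u w)^* ) &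
  forall f, odom S f -> S f w * (cmass alpha)%:C = inner alpha f h].
Proof.
have [_ + _] := hS; move=> /(_ (rkernel alpha w)) [].
  exists 1%N, (fun=> 1), (fun=> w).
  by apply/funext => z; rewrite big_ord1 mul1r.
move=> _ [h hf hE]; exists h.
have H f : odom S f -> S f w * (cmass alpha)%:C = inner alpha f h.
  by move=> fd; rewrite -hE// inner_rkernel//; exact: oapp_fock.
split => // u.
have cm := cmassC_neq0 alpha.
have /fockP[_ lk] := rkernel_fock alpha u; have /fockP[_ lh] := hf.
apply: (mulIf cm); rewrite -(inner_rkernel u hf) (inner_conj lk lh) -H; last exact: rkernel_dom.
by rewrite rmorphM; congr (_ * _); apply: complexP; rewrite !reimE /= ?oppr0.
Qed.

Lemma skernel_entire u : entire (skernel u).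
Proof. by have /fockP[] := skernel_fock u. Qed.

Lemma skernel_conj_entire w : entire (fun u => (skernel u w)^* ).
Proof.
have [h [/fockP[he _] hE _]] := adjoint_kernel w.
by move: he; congr entire; apply/funext.
Qed.

(** The adjoint is tested against [f] itself, so the formula holds on the whole domain of [S], with
    no passage to the limit from combinations of kernels. *)
Lemma kop_operator f : odom S f -> kop alpha skernel f = S f.
Proof.
move=> fd; apply/funext => w; have [h [hf hE H]] := adjoint_kernel w.
have cm := cmassC_neq0 alpha.
have /fockP[_ [mf _]] := odom_fock fd; have /fockP[_ [mh _]] := hf.
have := H f fd; rewrite innerE// => e.
rewrite /kop (_ : cI _ = S f w * (cmass alpha)%:C).
  by rewrite fmorphV mulrCA mulVf ?mulr1.
by rewrite e; congr cI; apply/funext => u; rewrite hE conjCK.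
Qed.

Lemma oapp0 : S (fun=> 0) = (fun=> 0).
Proof.
have := oapp_linear (-1) (odom0 S) (odom0 S).
rewrite (_ : (fun z => -1 * 0 + 0) = (fun=> 0)); last by apply/funext => z; rewrite mulr0 addr0.
by move=> ->; apply/funext => z; rewrite mulN1r addNr.
Qed.

(** The trailing [+ 0] gives the shape required by [odom_linear] and [oapp_linear]. *)
Let nkernel_lin z : nkernel alpha z = (fun w => (expR (- (a / 2) * cmod z ^+ 2))%:C * rkernel alpha z w + 0).
Proof. by apply/funext => w; rewrite addr0; exact: nkernelE. Qed.

Lemma nkernel_dom z : odom S (nkernel alpha z).
Proof. rewrite nkernel_lin; apply: odom_linear; [exact: rkernel_dom|exact: odom0]. Qed.

Lemma oapp_nkernel z w : S (nkernel alpha z) w = (expR (- (a / 2) * cmod z ^+ 2))%:C * skernel z w.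
Proof.
rewrite nkernel_lin oapp_linear; [|exact: rkernel_dom|exact: odom0].
by rewrite oapp0 addr0.
Qed.

Let gauss_split z : (expR (- (a / 2) * cmod z ^+ 2))%:C * (expR (- (a / 2) * cmod z ^+ 2))%:C =
  cexp (- (a%:C * (z * z^* ))) :> R[i].
Proof. by rewrite -rmorphM -expRD -gauss_cexp /gauss; congr ((expR _)%:C); field. Qed.

(** [U_z 1] is the normalised kernel. Its constant and that of the outer [U_z] multiply to exp (-
    alpha |z|^2), which completes the exponential of [ckernel] at the reflected point. *)
Lemma conj_by_U1 z v : conj_by_U S z (fun=> 1) v = ckernel z (z - v).
Proof.
rewrite /conj_by_U {1}/Uop (_ : Uop alpha z (fun=> 1) = nkernel alpha z); last first.
  by apply/funext => w; rewrite /Uop mul1r.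
rewrite oapp_nkernel nkernelE /rkernel.
transitivity (skernel z (z - v) * (((expR (- (a / 2) * cmod z ^+ 2))%:C *
  (expR (- (a / 2) * cmod z ^+ 2))%:C) * cexp (a%:C * v * z^* ))); first by ring.
by rewrite gauss_split -cexpD /ckernel; congr (_ * cexp _); ring.
Qed.

(** [nkernel z] is a multiple of the kernel at [z], so the inner product is an evaluation. *)
Lemma berezinE z : berezin S z = (cmass alpha)%:C * ckernel z z.
Proof.
have Sf : fock alpha (S (nkernel alpha z)) by exact/oapp_fock/nkernel_dom.
have /fockP[_ lS] := Sf; have /fockP[_ lk] := rkernel_fock alpha z.
have /fockP[_ ln] := nkernel_fock alpha z.
rewrite /berezin (innerE alpha lS.1 ln.1).
have -> : (fun u => S (nkernel alpha z) u * (nkernel alpha z u)^* * (wt alpha u)%:C) =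
   (fun u => (expR (- (a / 2) * cmod z ^+ 2))%:C *
     (S (nkernel alpha z) u * (rkernel alpha z u)^* * (wt alpha u)%:C)).
  apply/funext => u; rewrite nkernelE rmorphM /=.
  have -> : ((expR (- (a / 2) * cmod z ^+ 2))%:C)^* = (expR (- (a / 2) * cmod z ^+ 2))%:C :> R[i].
    by apply: complexP; rewrite !reimE /= ?oppr0.
  by ring.
rewrite (cIZ _ (l2_cint lS lk)) -(innerE alpha lS.1 lk.1) inner_rkernel// oapp_nkernel.
transitivity ((cmass alpha)%:C * (((expR (- (a / 2) * cmod z ^+ 2))%:C *
  (expR (- (a / 2) * cmod z ^+ 2))%:C) * skernel z z)); first by ring.
by rewrite gauss_split /ckernel; congr (_ * _); rewrite mulrC; congr (_ * cexp _); ring.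
Qed.

(** Separates the factor controlled by the L^p hypothesis from the off-diagonal Gaussian. On the
    diagonal, [nker] is the modulus of the Berezin transform up to [cmass]. *)
Lemma nker_ckernel u w : nker alpha skernel u w = cmod (ckernel u w) * gauss (a / 2) (w - u).
Proof.
rewrite /nker /ckernel cmodM cmod_cexp -[RHS]mulrA; congr (_ * _).
rewrite /gauss -expRD cmodD_sqr cmodN; congr expR.
have -> : complex.Re ((- u)^* * w) = - complex.Re (w * u^* ).
  by rewrite rmorphN mulNr ReN mulrC.
have -> : complex.Re (- (a%:C * w * u^* )) = - (a * complex.Re (w * u^* )).
  by rewrite ReN -[_ * _ * _^*]mulrA; congr (- _); rewrite [LHS]ReM mul0r subr0.
by field.
Qed.

Section Bound.
Variables (p C : R).
Hypothesis p2 : 2 < p.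
Hypothesis C0 : 0 < C.
Hypothesis hC : forall z, (fnorm alpha p (conj_by_U S z (fun=> 1%R)) <= C%:E)%E.

(** The constant of [pointwise_bound] for an integral of at most [pi / a * C ^ p], the L^p bound
    with the normalising factor of the weight removed. *)
Definition ckernel_bound := 2 * (gmass (a / p) + pi / a * C `^ p) / gmass (2 * a / p).

(** [pointwise_bound] for [S_u 1] at the point [u - v]. The hypothesis is uniform in [u], hence so
    is the bound, which depends on the difference alone. *)
Lemma ckernel_le u v : cmod (ckernel u v) <= ckernel_bound * expR (a / p * cmod (u - v) ^+ 2).
Proof.
have p0 : 0 < p by apply: lt_trans p2.
have e1 : entire (fun v => ckernel u (u - v)).
  have en : entire (fun v => u - v).
    have := @entire_affine R (-1) u; congr entire; apply/funext => w.
    by rewrite mulN1r addrC.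
  have eC := entire_comp (@entire_cexp R) (@entire_affine R (a%:C * u^* ) (- (a%:C * u * u^* ))).
  have := entireM (entire_comp (@skernel_entire u) en) eC.
  by congr entire; apply/funext => w; rewrite /ckernel; congr (_ * cexp _); ring.
have E : (fun v => ckernel u (u - v)) = conj_by_U S u (fun=> 1).
  by apply/funext => w; rewrite conj_by_U1.
have m1 := entire_cmeas e1.
have [] := @fnorm_le R alpha p _ C m1 p0; first by rewrite E; exact: hC.
have -> : (fun v => cmod (ckernel u (u - v)) `^ p * wt alpha v) =
    (fun v => a / pi * (cmod (ckernel u (u - v)) `^ p * gauss a v)).
  by apply/funext => w; rewrite /wt mulrCA.
move=> i1; have i2 : gint (fun v => cmod (ckernel u (u - v)) `^ p * gauss a v).
  have := gintZ (pi / a) i1; congr gint; apply/funext => w.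
  by rewrite mulrA -invf_div mulVf ?mul1r// gt_eqF// divr_gt0 ?pi_gt0.
rewrite (rIZ _ i2) mulrC -ler_pdivlMr ?divr_gt0 ?pi_gt0// invf_div mulrC => le1.
have := pointwise_bound e1 a0 _ i2 le1 => /(_ (ltW (lt_trans (ltr1n _ 2) p2))) /(_ (u - v)).
by rewrite opprB addrCA subrr addr0.
Qed.

End Bound.

End OperatorKernel.

Section Criterion.
Variables (R : realType) (alpha : {posnum R}).
Local Notation a := (alpha%:num).
Variable S : operator alpha.
Hypothesis hS : admissible S.
Variables (p C : R).
Hypothesis p2 : 2 < p.
Hypothesis C0 : 0 < C.
Hypothesis hC : forall z, (fnorm alpha p (conj_by_U S z (fun=> 1%R)) <= C%:E)%E.

Let a0 : 0 < a. Proof. by []. Qed.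
Let p0 : 0 < p. Proof. by apply: lt_trans p2. Qed.
Let K := ckernel_bound alpha p C.
(** The Gaussian decay [a / 2] of [nker_ckernel] minus the growth [a / p] of [ckernel]; positive
    because [2 < p]. *)
Let c := a / 2 - a / p.
Local Notation Phi := (skernel S).

Let c0 : 0 < c.
Proof. by rewrite /c subr_gt0 ltr_pM2l// ltf_pV2 ?posrE. Qed.

Let K0 : 0 < K.
Proof.
have g1 : 0 < gmass (a / p) by apply: gmass_gt0; exact: divr_gt0.
have g2 : 0 < gmass (2 * a / p) by apply: gmass_gt0; rewrite divr_gt0// mulr_gt0.
apply: (divr_gt0 _ g2); apply: (mulr_gt0 (ltr0Sn R 1)); apply: (ltr_wpDr _ g1).
by rewrite mulr_ge0 ?powR_ge0// divr_ge0 ?pi_ge0.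
Qed.

Let Phi_le u w : cmod (Phi u w) <=
  K * expR (a / 2 * cmod u ^+ 2 + a / 2 * cmod w ^+ 2 - c * cmod (u - w) ^+ 2).
Proof.
have := ler_wpM2r (gauss_ge0 (a / 2) (w - u)) (ckernel_le hS p2 hC u w).
rewrite -nker_ckernel /nker -ler_pdivlMr ?expR_gt0// => /le_trans; apply.
rewrite -expRN -[leLHS]mulrA -[leLHS]mulrA ler_wpM2l ?(ltW K0)// /gauss -!expRD ler_expR.
by rewrite [cmod (w - u)]cmodBC /c; lra.
Qed.

Let Phi_entire u : entire (Phi u). Proof. exact: skernel_entire. Qed.
Let Phi_conj_entire w : entire (fun u => (Phi u w)^* ). Proof. exact: skernel_conj_entire. Qed.

(** The estimate [ckernel_le] is invariant under translation, so recentring at [z_ n] produces a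
    sequence with bounds independent of [n], as [polarize] requires. *)
Lemma krow_berezin : vanishes_at_infinity (berezin S) ->
  forall e, 0 < e -> exists rho, forall u, rho < cmod u -> krow alpha Phi u <= e.
Proof.
(* In [E_] the first variable is conjugated to make it holomorphic. At (conj t, t) it takes the
   diagonal value of [ckernel] at z_n + t, which is the Berezin transform up to [cmass]. *)
move=> Bv; apply: (krow_vanish c0 K0 Phi_entire Phi_le) => z_ zn t.
pose E_ n x y := ckernel S (z_ n + x^* ) (z_ n + y).
have ci : 0 <= 2 * (a / p) by rewrite mulr_ge0// divr_ge0// ltW.
have main x y : ccvg (fun n => E_ n x y) 0.
  apply: (polarize ci (M := K)) => {x y} [n y|n x|n x y|t'].
  - have e1 := entireJ (@entire_translate R (z_ n) _ (@Phi_conj_entire (z_ n + y))).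
    have e2 := entire_comp (@entire_cexp R)
      (@entire_affine R (- (a%:C * (z_ n + y))) (- (a%:C * (z_ n + y) * (z_ n)^* ))).
    have := entireM e1 e2; congr entire; apply/funext => x.
    rewrite /E_ /ckernel conjCK [x^* + _]addrC; congr (_ * cexp _).
    by rewrite rmorphD /= conjCK; ring.
  - have e1 := @entire_translate R (z_ n) _ (@Phi_entire (z_ n + x^* )).
    have e2 := entire_comp (@entire_cexp R)
      (@entire_affine R (- (a%:C * (z_ n + x^* )^* )) (- (a%:C * z_ n * (z_ n + x^* )^* ))).
    have := entireM e1 e2; congr entire; apply/funext => y.
    by rewrite /E_ /ckernel [y + _]addrC; congr (_ * cexp _); ring.
  - apply: (le_trans (ckernel_le hS p2 hC _ _)); rewrite ler_wpM2l ?(ltW K0)// ler_expR.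
    rewrite (_ : z_ n + x^* - (z_ n + y) = x^* + - y); last by ring.
    have := cmodD_sqr_le x^* (- y); rewrite cmodN cmodJ => h.
    have ap : 0 <= a / p by rewrite divr_ge0 ?ltW.
    by have := ler_wpM2l ap h; lra.
  - move=> e e0; have cm := cmass_gt0 alpha.
    have [M HM] := Bv _ (mulr_gt0 cm e0).
    exists (Num.truncn (M + cmod t')).+1 => n Nn; rewrite subr0 /E_ conjCK.
    have h1 : M + cmod t' < n%:R by apply: (lt_le_trans (truncnS_gt _)); rewrite ler_nat.
    have h2 : cmod (z_ n) <= cmod (z_ n + t') + cmod t'.
      by rewrite -[z_ n in leLHS](addrK t'); exact: cmodB.
    have := HM (z_ n + t'); rewrite (berezinE hS) cmodM cmodR (ger0_norm (ltW cm)) ltr_pM2l//.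
    by apply; have := zn n; lra.
(* Smallness has spread to x = 0, y = t, which is the kernel at the pair (z_n, z_n + t). *)
have := ccvg_cmod (main 0 t); rewrite cmod0 => h.
rewrite -(mul0r (gauss (a / 2) t)).
under eq_fun do rewrite nker_ckernel addrK.
apply: cvgM; last exact: cvg_cst.
by under eq_fun do rewrite addrC -[X in ckernel S X](addr0 (z_ _)) -[0 in X in ckernel S X](conjC0).
Qed.

Lemma compact_of_vanishing : vanishes_at_infinity (berezin S) -> extends_to_compact S.
Proof.
move=> Bv; have kv := krow_berezin Bv.
have f0 : fock alpha (fun=> 0) by exact: odom_fock (odom0 S).
have flin d f g : fock alpha f -> fock alpha g -> fock alpha (fun z => d * f z + g z).
  by move=> ff fg; exact: fockD (fockZ d ff) fg.
have kf f := @kop_fock R alpha Phi K c c0 K0 Phi_entire Phi_conj_entire Phi_le f.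
have kl d f g := @kop_linear R alpha Phi K c c0 K0 Phi_conj_entire Phi_le d f g.
(* The extension is given by the kernel formula on the whole Fock space. *)
pose T := @Operator R alpha (fock alpha) (kop alpha Phi) (@subset_refl _ _) f0 flin kf kl.
exists T; split => // [u_ uf [M uM]|f fd]; last exact: kop_operator.
have s0 : 0 < 1 + `|M| by rewrite ltr_pwDl.
have us n : sqn alpha (u_ n) <= (1 + `|M|) ^+ 2.
  have := uM n; have /fockP[_ lu] := uf n; rewrite (fnorm2E lu) lee_fin => h.
  rewrite -[leLHS]sqr_sqrtr ?sqn_ge0// lerXn2r ?nnegrE ?sqrtr_ge0 ?(ltW s0)//.
  by apply: (le_trans h); apply: (le_trans (ler_norm M)); rewrite lerDr.
have [phi phiS [g gf gc]] := kop_compact c0 K0 Phi_entire Phi_conj_entire Phi_le kv s0 uf us.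
exists phi => //; exists (kop alpha Phi g); first exact: (kf g gf).
apply: fnorm2_cvg0 gc => n.
by apply: l2B; [have /fockP[] := kf _ (uf (phi n))|have /fockP[] := kf _ gf].
Qed.

End Criterion.

Lemma homo_ltn_ge (phi : nat -> nat) : {homo phi : m n / (m < n)%N} -> forall n, (n <= phi n)%N.
Proof.
by move=> phiS; elim=> // n IH; apply: leq_ltn_trans IH (phiS _ _ _).
Qed.

(** The Berezin transform is a weighted evaluation of [S k_y] at the moving point [y]. Such
    evaluations are bounded uniformly in [y] by [evbound], so norm convergence to a fixed [g]
    reduces the claim to [fock_decay]. *)
Lemma vanishing_of_compact (R : realType) (alpha : {posnum R}) (S : operator alpha) :
  admissible S -> extends_to_compact S -> vanishes_at_infinity (berezin S).
Proof.
move=> hS [T [domT cT TS]] e e0; apply: contrapT => /forallNP nex.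
have /choice[z_ zP] : forall n : nat, exists z, n%:R < cmod z /\ e <= cmod (berezin S z).
  move=> n; have /existsNP[z] := nex n%:R.
  by move=> /not_implyP[zn /negP]; rewrite -leNgt => ze; exists z.
have cm := cmass_gt0 alpha.
have kT n : odom T (nkernel alpha (z_ n)) by rewrite domT; exact: nkernel_fock.
have [|phi phiS [g gf gc]] := cT _ kT.
  exists (Num.sqrt (cmass alpha)) => n.
  by have /fockP[_ lk] := nkernel_fock alpha (z_ n); rewrite (fnorm2E lk) sqn_nkernel.
pose y n := z_ (phi n).
have yn n : n%:R < cmod (y n).
  by apply: le_lt_trans (zP (phi n)).1; rewrite ler_nat homo_ltn_ge.
pose d n w := T (nkernel alpha (y n)) w - g w.
have df n : fock alpha (d n) by exact: fockB (oapp_fock (kT (phi n))) gf.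
pose k := evbound alpha; have k0 : 0 <= k by exact: evbound_ge0.
(* Bounds the share of [d] by [e / 2] after multiplication by [cmass]; [1 + k] is positive even if
   [k] vanishes. *)
pose e1 := e / 2 / (cmass alpha * (1 + k)).
have k1 : 0 < 1 + k by rewrite ltr_pwDl.
have e10 : 0 < e1 := divr_gt0 (divr_gt0 e0 (ltr0Sn R 1)) (mulr_gt0 cm k1).
have e20 : 0 < e / 2 / cmass alpha := divr_gt0 (divr_gt0 e0 (ltr0Sn R 1)) cm.
have /cvgrPdist_lt /(_ _ e20)[N1 _ H1] := fock_decay gf yn.
have [N2 H2] : exists N, forall n, (N <= n)%N -> sqn alpha (d n) <= e1 ^+ 2.
  have h : Num.sqrt (sqn alpha (d n)) @[n --> \oo] --> (0 : R).
    have E : (fun n => Num.sqrt (sqn alpha (d n))) = (fun n => fine (fnorm alpha 2 (d n))).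
      by apply/funext => n; rewrite fnorm2E//; have /fockP[] := df n.
    by rewrite E; exact: fine_cvg gc.
  move/cvgrPdist_lt : h => /(_ _ e10)[N _ HN]; exists N => n /HN /=.
  rewrite sub0r normrN ger0_norm ?sqrtr_ge0// => h.
  by rewrite -[leLHS]sqr_sqrtr ?sqn_ge0// lerXn2r ?nnegrE ?sqrtr_ge0 ?(ltW e10)// ltW.
pose n := maxn N1 N2; have := H1 n (leq_maxl _ _); have {}H2 := H2 n (leq_maxr _ _).
rewrite /= sub0r normrN (ger0_norm (nfun_ge0 _ _ _)) => {}H1.
have h := nfun_bounded (df n) e10 H2 (y n).
have := (zP (phi n)).2; rewrite -/(y n) (berezinE hS) leNgt => /negP; apply.
have -> : cmod ((cmass alpha)%:C * ckernel S (y n) (y n)) =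
    cmass alpha * nfun alpha (S (nkernel alpha (y n))) (y n).
  rewrite cmodM cmodR (ger0_norm (ltW cm)); congr (_ * _).
  have := nker_ckernel S (y n) (y n).
  rewrite subrr /gauss cmod0 expr0n mulr0 expR0 mulr1 => <-.
  rewrite /nfun (oapp_nkernel hS) cmodM cmodR (ger0_norm (expR_ge0 _)) /nker.
  by rewrite [RHS]mulrAC -expRD [RHS]mulrC; congr (_ * expR _); lra.
have hle : nfun alpha (S (nkernel alpha (y n))) (y n) <= nfun alpha (d n) (y n) + nfun alpha g (y n).
  rewrite -TS; last exact: nkernel_dom.
  rewrite /nfun -mulrDl ler_wpM2r ?expR_ge0// -[T _ _](subrK (g (y n))); exact: cmodD.
apply: le_lt_trans (ler_wpM2l (ltW cm) hle) _.
have h2 : k * e1 <= e / 2 / cmass alpha.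
  rewrite (_ : k * e1 = e / 2 / cmass alpha * (k / (1 + k))); last first.
    by rewrite /e1; field; rewrite !gt_eqF.
  by rewrite ler_piMr ?(ltW e20)// ler_pdivrMr// mul1r lerDr.
rewrite mulrDr [e]splitr; apply: ler_ltD.
  by rewrite mulrC -ler_pdivlMr//; exact: le_trans h h2.
by rewrite mulrC -ltr_pdivlMr.
Qed.

Theorem theoremC (R : realType) (alpha : {posnum R}) (S : operator alpha)
    (hS : admissible S)
    (hp : exists p C : R, [/\ 2 < p, 0 < C &
       forall z : R[i],
         (fnorm alpha p (conj_by_U S z (fun=> 1%R)) <= C%:E)%E]) :
  extends_to_compact S <-> vanishes_at_infinity (berezin S).
Proof.
split; first exact: vanishing_of_compact.
by have [p [C [p2 C0 hC]]] := hp; exact: compact_of_vanishing hC.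
Qed.
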